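(* Let $n\ge 2$, let $X$ be a real diagonal $n\times n$ matrix with $X_{j,j}\ge X_{j+1,j+1}$, let $a\in\mathbb{R}^n$ have non-negative entries with $a_{j+1}=0$ whenever $X_{j,j}=X_{j+1,j+1}$, and let $r\in\mathbb{R}$. Let $M$ be the (local) Bochner--Kähler manifold associated with the parameters $a$, $X$, $r$. The infinitesimal automorphisms of $M$ correspond to the vector fields $$(\beta+\mathrm{i} H z+\alpha w+2\mathrm{i} \langle z,\alpha\rangle z+\rho zw)\frac{\partial}{\partial z}+(2\mathrm{i} \langle z,\beta \rangle + 2\mathrm{i} \langle z,\alpha\rangle w+\rho w^2)\frac{\partial}{\partial w},$$ where $$\alpha=\mathrm{i} X \beta \quad\text{and}\quad \rho =2\,\mathrm{Im} \langle \beta,a\rangle,$$ and the Hermitian $n\times n$ matrix $H$ and the vector $\beta\in\mathbb{C}^n$ satisfy $$[H,X]=-2\mathrm{i}(a\beta^*+\beta a^* ) \quad\text{and}\quad -\mathrm{i} H a=(X^2+r\,\mathrm{I})\beta .$$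
   Context: Notation: $\langle x,y\rangle=\sum_j x_j\bar y_j$ on $\mathbb{C}^n$; $^*$ is conjugate transpose; $\mathrm{I}$ is the identity matrix; $[H,X]=HX-XH$; for a $\mathbb{C}^n$-valued function $f$, $f\frac{\partial}{\partial z}$ means $\sum_j f_j\frac{\partial}{\partial z_j}$. A Bochner--Kähler manifold is a Kähler manifold whose Bochner curvature (the traceless part of the Kähler curvature) vanishes. The local Bochner--Kähler manifold $M$ associated with $(a,X,r)$ is a neighbourhood of $0\in\mathbb{C}^n$ with Kähler form $\frac{\mathrm{i}}{2}\partial\bar\partial F$, where $F$ is the real function near $0$ with $F(0)=0$ determined by $$\begin{bmatrix} 0& z^* & \frac{\mathrm{i}}{2} \end{bmatrix} \mathrm{e}^{2\mathrm{i} AF}\begin{bmatrix} 1\\ z\\ 0 \end{bmatrix}=0,\qquad A=\begin{bmatrix} 0& -2\mathrm{i} a^* & r\\0&\mathrm{i} X& a\\1&0&0 \end{bmatrix}.$$ The manifold $M$ is the local leaf space at $0$ of the Heisenberg sphere $\{(z,w)\in\mathbb{C}^n\times\mathbb{C}: \mathrm{Im}\, w=\langle z,z\rangle\}$ by the flow of the real part of a distinguished infinitesimal CR automorphism $\mathcal{Z}$ of the sphere (the Reeb field), the one represented by the matrix $A$ acting linearly on homogeneous coordinates $(\psi,\phi,\omega)$ with $z=\phi/\psi$, $w=\omega/\psi$. The correspondence in the claim is this: the infinitesimal automorphisms of $M$ come from the infinitesimal CR automorphisms of the Heisenberg sphere that commute with $\mathcal{Z}$, taken modulo the span of $\mathcal{Z}$,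 and the vector fields in the claim are representatives of these classes.
   Formalization: The sign of ρ is corrected: the formal statement uses ρ = 2 Im⟨a,β⟩ = −2 Im⟨β,a⟩, since with ρ = 2 Im⟨β,a⟩ the displayed field does not commute with 𝒵 when Im⟨β,a⟩ ≠ 0 (e.g. X=diag(1,0), a=(1,1), r=0, β=(i,0)). *)

(* Defs.v *)
(* MathComp / MathComp-Analysis; the complex numbers are R[i] for R : realType. *)
From HB Require Import structures.
From mathcomp Require Export all_boot all_order all_algebra.
From mathcomp Require Export complex.
From mathcomp Require Export all_classical all_reals all_analysis.

Set Implicit Arguments.
Unset Strict Implicit.
Unset Printing Implicit Defensive.

Import Order.TTheory GRing.Theory Num.Theory numFieldNormedType.Exports.
Export Order.TTheory GRing.Theory Num.Theory numFieldNormedType.Exports.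

Local Open Scope complex_scope.
Local Open Scope classical_set_scope.
Local Open Scope ring_scope.

HB.instance Definition _ (R : realType) := NormedModule.copy R[i] (R[i])^o.

Section LinearAlgebra.
Variable R : realType.
Local Notation C := R[i].

Definition hdot m (x y : 'cV[C]_m) : C := \sum_j x j 0 * (y j 0)^*.

Definition adjmx m p (M : 'M[C]_(m, p)) : 'M[C]_(p, m) := map_mx Num.conj M^T.

Definition cmx m p (M : 'M[R]_(m, p)) : 'M[C]_(m, p) :=
  map_mx (real_complex R) M.

Definition expmx m (M : 'M[C]_m) : 'M[C]_m :=
  limn (series (fun k => (k`!%:R : C)^-1 *: M ^+ k)).

End LinearAlgebra.

Section Calculus.
Variable R : realType.
Local Notation C := R[i].

(* Derivative of f in the real direction e, where C^m is seen as R^(2m).  A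
   C^m-valued function v is read as the real vector field
   \sum_j (v_j d/dz_j + conj(v_j) d/dbar z_j), which acts on functions by
   f |-> (z |-> rderiv (v z) f z). *)
Definition rderiv m (e : 'cV[C]_m) (f : 'cV[C]_m -> C) (z : 'cV[C]_m) : C :=
  (derive1 (fun t : R => complex.Re (f (z + t%:C *: e))) 0 +i*
   derive1 (fun t : R => complex.Im (f (z + t%:C *: e))) 0)%C.

(* C^oo on a neighbourhood of 0: all iterated directional derivatives exist
   and are continuous. *)
Definition smooth0 m (f : 'cV[C]_m -> C) : Prop :=
  \forall z \near (0 : 'cV[C]_m), forall (l : seq 'cV[C]_m),
    {for z, continuous (foldr (@rderiv m) f l)} /\
    forall e : 'cV[C]_m,
      derivable (fun t : R => complex.Re (foldr (@rderiv m) f l (z + t%:C *: e)))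
        0 1 /\
      derivable (fun t : R => complex.Im (foldr (@rderiv m) f l (z + t%:C *: e)))
        0 1.

Definition dz m (j : 'I_m) (f : 'cV[C]_m -> C) (z : 'cV[C]_m) : C :=
  (rderiv (delta_mx j 0) f z - 'i * rderiv ('i *: delta_mx j 0) f z) / 2.

Definition dzbar m (j : 'I_m) (f : 'cV[C]_m -> C) (z : 'cV[C]_m) : C :=
  (rderiv (delta_mx j 0) f z + 'i * rderiv ('i *: delta_mx j 0) f z) / 2.

Definition holomorphic0 m p (v : 'cV[C]_m -> 'cV[C]_p) : Prop :=
  forall j, smooth0 (fun z => v z j 0) /\
    \forall z \near (0 : 'cV[C]_m), forall k, dzbar k (fun x => v x j 0) z = 0.

(* Bracket of the holomorphic fields Y d/dz and Z d/dz. *)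
Definition bracket m (Y Z : 'cV[C]_m -> 'cV[C]_m) (p : 'cV[C]_m) : 'cV[C]_m :=
  \col_j \sum_k (Y p k 0 * dz k (fun x => Z x j 0) p
               - Z p k 0 * dz k (fun x => Y x j 0) p).

Definition commute0 m (Y Z : 'cV[C]_m -> 'cV[C]_m) : Prop :=
  \forall p \near (0 : 'cV[C]_m), bracket Y Z p = 0.

End Calculus.

Section Sphere.
Variables (R : realType) (n : nat).
Local Notation C := R[i].

(* A point (z, w) of C^n x C is the column p : 'cV_(n + 1) with
   z = usubmx p and w = dsubmx p 0 0. *)
Definition zpart (p : 'cV[C]_(n + 1)) : 'cV[C]_n := usubmx p.
Definition wpart (p : 'cV[C]_(n + 1)) : C := dsubmx p 0 0.

Definition sphere_fun (p : 'cV[C]_(n + 1)) : C :=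
  'Im (wpart p) - hdot (zpart p) (zpart p).

(* Germs at 0 of infinitesimal CR automorphisms of the Heisenberg sphere
   sphere_fun = 0: holomorphic fields whose real part is tangent to it. *)
Definition inf_CR_automorphism (Y : 'cV[C]_(n + 1) -> 'cV[C]_(n + 1)) : Prop :=
  holomorphic0 Y /\
  \forall p \near (0 : 'cV[C]_(n + 1)),
    sphere_fun p = 0 -> rderiv (Y p) sphere_fun p = 0.

(* The vector field, in the affine coordinates (z, w) = (phi, omega) / psi, of
   the linear field B on the homogeneous coordinates (psi, phi, omega). *)
Definition affine_field (B : 'M[C]_(1 + (n + 1))) (p : 'cV[C]_(n + 1)) :
    'cV[C]_(n + 1) :=
  let q : 'cV[C]_(1 + (n + 1)) := B *m col_mx 1 p in
  dsubmx q - usubmx q 0 0 *: p.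

Variables (a : 'cV[R]_n) (X : 'M[R]_n) (r : R).

Definition Amx : 'M[C]_(1 + (n + 1)) :=
  block_mx 0 (row_mx (- (2 * 'i) *: adjmx (cmx a)) (r%:C)%:M)
           (col_mx 0 1) (block_mx ('i *: cmx X) (cmx a) 0 0).

Definition reeb : 'cV[C]_(n + 1) -> 'cV[C]_(n + 1) := affine_field Amx.

(* The sign of rho: in the bracket of this field with the Reeb field, the
   coefficient of w d/dw is 2i <b, a> - 2i <a, b> - 2 rho, so the two fields
   commute only if rho = 2 Im <a, b> = - 2 Im <b, a>. *)
Definition aut_field (H : 'M[C]_n) (b : 'cV[C]_n) (p : 'cV[C]_(n + 1)) :
    'cV[C]_(n + 1) :=
  let z := zpart p in
  let w := wpart p in
  let alpha := 'i *: (cmx X *m b) in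
  let rho := 2 * 'Im (hdot (cmx a) b) in
  col_mx
    (b + 'i *: (H *m z) + w *: alpha + (2 * 'i * hdot z alpha) *: z
       + (rho * w) *: z)
    (2 * 'i * hdot z b + 2 * 'i * hdot z alpha * w + rho * w ^+ 2)%:M.

Definition admissible (Hb : 'M[C]_n * 'cV[C]_n) : Prop :=
  let: (H, b) := Hb in
  [/\ adjmx H = H,
      H *m cmx X - cmx X *m H
        = - (2 * 'i) *: (cmx a *m adjmx b + b *m adjmx (cmx a)) &
      - 'i *: (H *m cmx a) = (cmx X *m cmx X + (r%:C)%:M) *m b].

(* The Reeb field equals d/dw at 0, so {w = 0} is transversal to its complex
   leaves near 0 and z is a coordinate on the leaf space: the leaf of the
   sphere point exp(i F(z) A)(1, z, 0) has coordinate z.  A field Y commuting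
   with the Reeb field descends to the field v such that Y and (v, 0) agree
   modulo the Reeb field along {w = 0}. *)
Definition descends_to (Y : 'cV[C]_(n + 1) -> 'cV[C]_(n + 1))
    (v : 'cV[C]_n -> 'cV[C]_n) : Prop :=
  \forall z \near (0 : 'cV[C]_n), exists c : C,
    Y (col_mx z 0) = col_mx (v z) 0 + c *: reeb (col_mx z 0).

Definition potential (F : 'cV[C]_n -> R) : Prop :=
  [/\ F 0 = 0, smooth0 (fun z => (F z)%:C) &
    \forall z \near (0 : 'cV[C]_n),
      row_mx 0 (row_mx (adjmx z) ('i / 2)%:M)
        *m expmx ((2 * 'i * (F z)%:C) *: Amx)
        *m col_mx 1 (col_mx z 0) = 0 :> 'M[C]_1].

End Sphere.

Section Kaehler.
Variables (R : realType) (n : nat).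
Local Notation C := R[i].

(* The Kaehler form (i/2) d dbar F is (i/2) \sum g_jk dz_j /\ dbar z_k. *)
Definition kmetric (F : 'cV[C]_n -> R) (j k : 'I_n) : 'cV[C]_n -> C :=
  dz j (dzbar k (fun z => (F z)%:C)).

(* For v holomorphic, the Lie derivative of the Kaehler form along the real
   vector field v is (i/2) \sum (lie_kmetric F v j k) dz_j /\ dbar z_k. *)
Definition lie_kmetric (F : 'cV[C]_n -> R) (v : 'cV[C]_n -> 'cV[C]_n)
    (j k : 'I_n) (z : 'cV[C]_n) : C :=
  rderiv (v z) (kmetric F j k) z
  + \sum_l (dz j (fun x => v x l 0) z * kmetric F l k z
          + (dz k (fun x => v x l 0) z)^* * kmetric F j l z).

(* Germs at 0 of vector fields preserving the complex structure and the
   Kaehler form. *)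
Definition inf_automorphism (F : 'cV[C]_n -> R) (v : 'cV[C]_n -> 'cV[C]_n) :
    Prop :=
  holomorphic0 v /\
  \forall z \near (0 : 'cV[C]_n), forall j k, lie_kmetric F v j k z = 0.

End Kaehler.

(* Main.v *)
(* Write J for the matrix of the Hermitian form defining the sphere, B for the
   matrix of the linear field inducing the field of the claim, zeta = (1, z, 0),
   eta = zeta^* J and E = exp (2i A F), so that eta E zeta = 0.

   For a holomorphic field v on M, the Lie derivative of the Kaehler form is
   (i/2) d dbar (v F), and differentiating eta E zeta = 0 along v expresses v F
   through E.  If v is Killing, then v F is pluriharmonic.  Setting zbar = 0 in the
   Taylor expansion of the dbar-derivative of that identity (there F = 0 and E = 1)
   shows that v is a polynomial field determined by b = v(0) and a Hermitian H.
   For this field J B + B^* J = 0 gives (v F) u = w u - eta [E, B] zeta, where u is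
   the derivative of eta E zeta in F and w = 2 Re <z, b>.  So v F = w, hence v is
   Killing, when A and B commute.  Conversely, if v is Killing, v F - w is
   pluriharmonic and vanishes when zbar = 0, so it is 0 and eta [E, B] zeta = 0; the
   terms of degree 2 in zbar of this equation yield [A, B] = 0, which is the
   admissibility of (H, b).

   If a CR field Y commutes with the Reeb field, Y is determined along the flow
   exp (2i x A) by its values on {w = 0}.  For real x = F(z) / 2 the flow takes
   (z, 0) to a point of the sphere, and tangency there says that the projection v
   of Y to M satisfies v F = Im c, where Y = (v, 0) + c (Reeb) on {w = 0} and c is
   holomorphic.  Hence v is Killing, Im (c - 2i <z, b>) = 0, and Y coincides on
   {w = 0} with the field of (H, b) plus a real multiple of the Reeb field; as
   both commute with the Reeb field, which is transversal to {w = 0}, they are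
   equal. *)
Require Import Defs.
From HB Require Import structures.
From mathcomp Require Import ring lra.
Local Open Scope complex_scope.
Local Open Scope classical_set_scope.
Local Open Scope ring_scope.

Set Implicit Arguments.
Unset Strict Implicit.
Unset Printing Implicit Defensive.

(** * Complex-valued curves *)

(** The potential is only assumed smooth, so its Taylor series at 0 need not represent it. Setting
    zbar = 0 is therefore a statement about jets: [cong k f g] compares only the iterated
    derivatives d/dz_j at 0 up to order k. These congruences respect sums, products and division by
    a function that does not vanish at 0, and the conjugate of a holomorphic function is congruent
    to its value at 0. An identity between smooth functions thus becomes, order by order, an
    identity between holomorphic ones, which holds near 0 by the identity principle; the latter is
    obtained from a maximum principle instead of Cauchy's formula. The terms of degree 2 in zbar
    give less than [A, B] = 0: only that the middle block [Kmx] of [A, B] is the scalar [kap] and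
    that [uvec] is 0. A trace computation removes the scalar. Conversely, the admissibility
    equations are the vanishing of [Kmx] and [uvec] alone; the remaining entries of [A, B] vanish
    because [H, X] and [H, X] X have trace 0. *)

Section ComplexValuedCurves.
Variable R : realType.
Local Notation C := R[i].
Local Notation rRe := (@complex.Re R).
Local Notation rIm := (@complex.Im R).
Implicit Types (x y : C) (f g : R -> C).

Lemma complexP x y : rRe x = rRe y -> rIm x = rIm y -> x = y.
Proof. by case: x => a b; case: y => c d /= -> ->. Qed.

Lemma ReD x y : rRe (x + y) = rRe x + rRe y.
Proof. by case: x; case: y. Qed.
Lemma ImD x y : rIm (x + y) = rIm x + rIm y.
Proof. by case: x; case: y. Qed.
Lemma ReN x : rRe (- x) = - rRe x.
Proof. by case: x. Qed.
Lemma ImN x : rIm (- x) = - rIm x.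
Proof. by case: x. Qed.
Lemma ReM x y : rRe (x * y) = rRe x * rRe y - rIm x * rIm y.
Proof. by case: x; case: y. Qed.
Lemma ImM x y : rIm (x * y) = rRe x * rIm y + rIm x * rRe y.
Proof. by case: x => a b; case: y => c d /=. Qed.
Lemma ReJ x : rRe x^* = rRe x.
Proof. by case: x. Qed.
Lemma ImJ x : rIm x^* = - rIm x.
Proof. by case: x. Qed.

Definition ReImE := (ReD, ImD, ReN, ImN, ReM, ImM, ReJ, ImJ).

Lemma ler_norm_Re x : (`|rRe x|)%:C <= `|x|.
Proof. exact: normc_ge_Re. Qed.

Lemma ler_norm_Im x : (`|rIm x|)%:C <= `|x|.
Proof.
have -> : rIm x = - rRe (x * 'i) by rewrite ReM /= mulr0 mulr1 sub0r opprK.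
rewrite normrN (le_trans (ler_norm_Re _))// normrM.
by rewrite (_ : `|'i : C| = 1) ?mulr1// normCi.
Qed.

Lemma norm_real_complex (a : R) : `|a%:C| = `|a|%:C.
Proof. by rewrite normc_def /= expr0n addr0 sqrtr_sqr. Qed.

Lemma ler_norm_ReIm x : `|x| <= (`|rRe x| + `|rIm x|)%:C.
Proof.
rewrite {1}[x]complexE (le_trans (ler_normD _ _))// normrM normCi mul1r.
by rewrite !norm_real_complex -rmorphD.
Qed.

Lemma gtC0_real x : 0 < x -> exists2 e : R, 0 < e & x = e%:C.
Proof.
case: x => a b; rewrite ltcE /= => /andP[/eqP -> a0]; exists a => //.
Qed.

Section Limits.
Context {T : Type} {F : set_system T} {FF : Filter F}.

Lemma cvg_ReIm (f : T -> C) (l : C) :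
  (f x @[x --> F] --> l) <->
  (rRe (f x) @[x --> F] --> rRe l /\ rIm (f x) @[x --> F] --> rIm l).
Proof.
split=> [/cvgrPdist_lt fl|[/cvgrPdist_lt rl /cvgrPdist_lt il]].
  split; apply/cvgrPdist_lt => e e0.
    have /fl : 0 < e%:C by rewrite ltcR.
    apply: filterS => x; rewrite -ltcR -ReN -ReD; apply: le_lt_trans.
    exact: ler_norm_Re.
  have /fl : 0 < e%:C by rewrite ltcR.
  apply: filterS => x; rewrite -ltcR -ImN -ImD; apply: le_lt_trans.
  exact: ler_norm_Im.
apply/cvgrPdist_lt => _ /gtC0_real[e e0 ->].
have e20 : 0 < e / 2 by rewrite divr_gt0.
near=> x; rewrite (le_lt_trans (ler_norm_ReIm _))// ltcR [ltRHS]splitr ltrD//.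
  by rewrite ReD ReN; near: x; exact: rl.
by rewrite ImD ImN; near: x; exact: il.
Unshelve. all: by end_near. Qed.
End Limits.

Lemma continuous_ReIm (T : topologicalType) (f : T -> C) (t : T) :
  {for t, continuous f} <->
  {for t, continuous (fun u => rRe (f u))} /\
  {for t, continuous (fun u => rIm (f u))}.
Proof. exact: cvg_ReIm. Qed.

(** The derivative in a real parameter is taken componentwise, as in [rderiv]; no complex
    differentiability is meant. *)
Definition is_cder f (t : R) (d : C) : Prop :=
  is_derive t 1 (fun s => rRe (f s)) (rRe d) /\
  is_derive t 1 (fun s => rIm (f s)) (rIm d).

Lemma is_cder_eq f t d d' : is_cder f t d -> d = d' -> is_cder f t d'.
Proof. by move=> + <-. Qed.

Lemma is_cder_unique f t d d' : is_cder f t d -> is_cder f t d' -> d = d'.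
Proof.
move=> [a b] [c e]; apply: complexP.
  by rewrite -(@derive_val _ _ _ _ _ _ _ a) (@derive_val _ _ _ _ _ _ _ c).
by rewrite -(@derive_val _ _ _ _ _ _ _ b) (@derive_val _ _ _ _ _ _ _ e).
Qed.

Lemma near_eq_is_cder f g t d :
  (\forall s \near t, f s = g s) -> is_cder f t d -> is_cder g t d.
Proof.
by move=> fg [a b]; split;
  [apply: near_eq_is_derive a|apply: near_eq_is_derive b];
  apply: filterS fg => s ->.
Qed.

Lemma is_cder_cst (c : C) t : is_cder (fun=> c) t 0.
Proof. by split; exact: is_derive_cst. Qed.

Lemma is_cder_id t : is_cder (fun s => s%:C) t 1.
Proof. by split; [exact: is_derive_id|exact: is_derive_cst]. Qed.

Lemma is_cderD f g t d e :
  is_cder f t d -> is_cder g t e -> is_cder (fun s => f s + g s) t (d + e).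
Proof.
move=> [a b] [c h]; split.
  rewrite (_ : (fun s => _) = (fun s => rRe (f s)) + (fun s => rRe (g s))).
    by rewrite ReD; exact: (is_deriveD a c).
  by apply/funext => s; rewrite ReD.
rewrite (_ : (fun s => _) = (fun s => rIm (f s)) + (fun s => rIm (g s))).
  by rewrite ImD; exact: (is_deriveD b h).
by apply/funext => s; rewrite ImD.
Qed.

Lemma is_cderN f t d : is_cder f t d -> is_cder (fun s => - f s) t (- d).
Proof.
move=> [a b]; split.
  rewrite (_ : (fun s => _) = - (fun s => rRe (f s))).
    by rewrite ReN; exact: (is_deriveN a).
  by apply/funext => s; rewrite ReN.
rewrite (_ : (fun s => _) = - (fun s => rIm (f s))).
  by rewrite ImN; exact: (is_deriveN b).
by apply/funext => s; rewrite ImN.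
Qed.

Lemma is_cderJ f t d : is_cder f t d -> is_cder (fun s => (f s)^*) t d^*.
Proof.
move=> [a b]; split.
  rewrite (_ : (fun s => _) = (fun s => rRe (f s))); first by rewrite ReJ.
  by apply/funext => s; rewrite ReJ.
rewrite (_ : (fun s => _) = - (fun s => rIm (f s))).
  by rewrite ImJ; exact: (is_deriveN b).
by apply/funext => s; rewrite ImJ.
Qed.

Lemma is_cderM f g t d e : is_cder f t d -> is_cder g t e ->
  is_cder (fun s => f s * g s) t (d * g t + f t * e).
Proof.
move=> [a b] [c h].
have key (p q p' q' : R -> R) (u v u' v' : R) :
    is_derive t 1 p u -> is_derive t 1 q v ->
    is_derive t 1 p' u' -> is_derive t 1 q' v' ->
    is_derive t 1 (fun s => p s * q s + p' s * q' s)
      (u * q t + p t * v + (u' * q' t + p' t * v')).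
  move=> pu qv pu' qv'.
  apply: (is_derive_eq (is_deriveD (is_deriveM pu qv) (is_deriveM pu' qv'))).
  by rewrite /= /GRing.scale /=; ring.
split.
  rewrite (_ : (fun s => _) = (fun s => rRe (f s) * rRe (g s)
     + (- (fun s => rIm (f s))) s * rIm (g s))); last first.
    by apply/funext => s; rewrite ReM /= mulNr.
  have := key _ _ _ _ _ _ _ _ a c (is_deriveN b) h.
  move/is_derive_eq; apply; rewrite !ReImE /=.
  rewrite (_ : (- (fun s => rIm (f s))) t = - rIm (f t))//; ring.
rewrite (_ : (fun s => _) = (fun s => rRe (f s) * rIm (g s)
   + rIm (f s) * rRe (g s))); last by apply/funext => s; rewrite ImM.
have := key _ _ _ _ _ _ _ _ a h b c.
by move/is_derive_eq; apply; rewrite !ReImE /=; ring.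
Qed.

Lemma is_cder_sum (I : Type) (r : seq I) (P : pred I) (f : I -> R -> C) t
    (d : I -> C) : (forall i, P i -> is_cder (f i) t (d i)) ->
  is_cder (fun s => \sum_(i <- r | P i) f i s) t (\sum_(i <- r | P i) d i).
Proof.
move=> fd; elim: r => [|i r IH].
  rewrite big_nil (_ : (fun s => _) = fun=> 0); first exact: is_cder_cst.
  by apply/funext => s; rewrite big_nil.
rewrite big_cons (_ : (fun s => _) = fun s => (if P i then
   f i s + \sum_(j <- r | P j) f j s else \sum_(j <- r | P j) f j s)).
  by case: ifP => // Pi; apply: is_cderD => //; exact: fd.
by apply/funext => s; rewrite big_cons.
Qed.

Lemma is_cder_derivable f t d : is_cder f t d ->
  derivable (fun s => rRe (f s)) t 1 /\ derivable (fun s => rIm (f s)) t 1.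
Proof. by move=> [[a _] [b _]]; split; [exact: a|exact: b]. Qed.

Lemma derivable_is_cder f t :
  derivable (fun s => rRe (f s)) t 1 -> derivable (fun s => rIm (f s)) t 1 ->
  is_cder f t (derive1 (fun s => rRe (f s)) t
               +i* derive1 (fun s => rIm (f s)) t)%C.
Proof.
by move=> a b; split; rewrite /= derive1E;
  [exact: (derivableP a)|exact: (derivableP b)].
Qed.

Lemma is_derive_continuous (f : R -> R) (t d : R) :
  is_derive t 1 f d -> {for t, continuous f}.
Proof. by case=> /derivable1_diffP/differentiable_continuous. Qed.

Lemma is_cder_continuous f t d : is_cder f t d -> {for t, continuous f}.
Proof.
by move=> [a b]; apply/continuous_ReIm; split; apply: is_derive_continuous.
Qed.

Lemma is_cder_shift f t u d :
  is_cder (fun s => f (u + s)) t d <-> is_cder f (u + t) d.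
Proof.
have key (p : R -> R) (v w e : R) :
    is_derive (v + w) 1 p e -> is_derive w 1 (fun s => p (v + s)) e.
  move=> pe; have h : is_derive w (1 : R) (fun s : R => v + s) 1.
    rewrite -[X in is_derive _ _ _ X]add0r.
    exact: (@is_deriveD _ _ _ (cst v) id).
  by have := @is_derive1_comp _ p (fun s => v + s) w _ _ pe h; rewrite mulr1.
split=> -[a b]; last by split; apply: key.
rewrite (_ : f = fun s => f (u + (- u + s))); last first.
  by apply/funext => s; rewrite addNKr.
by split; apply: (key (fun s => _ (f (u + s)))); rewrite addKr.
Qed.

Lemma is_cder_comp_real f (s : R -> R) (t e : R) d :
  is_cder f (s t) d -> is_derive t 1 s e ->
  is_cder (fun u => f (s u)) t (e%:C * d).
Proof.
move=> [a b] se; split; rewrite ?ReM ?ImM /= mul0r ?subr0 ?addr0 mulrC.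
  exact: (@is_derive1_comp _ (fun s => rRe (f s)) s).
exact: (@is_derive1_comp _ (fun s => rIm (f s)) s).
Qed.

Lemma mean_value (p dp : R -> R) (a b : R) : a <= b ->
  (forall t, t \in `[a, b] -> is_derive t 1 p (dp t)) ->
  exists2 c, c \in `[a, b] & p b - p a = dp c * (b - a).
Proof.
move=> ab pd; have h := @MVT_segment R p dp a b ab.
have h1 : forall x : R, x \in `]a, b[ -> is_derive x 1 p (dp x).
  by move=> x xab; apply: pd; exact: subset_itv_oo_cc xab.
have h2 : {within `[a, b], continuous p}.
  apply: continuous_in_subspaceT => x /set_mem xab.
  exact: is_derive_continuous (pd _ xab).
exact: h h1 h2.
Qed.

Lemma mean_value0 (p dp : R -> R) (x : R) :
  (forall t : R, `|t| <= `|x| -> is_derive t 1 p (dp t)) ->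
  exists2 c, `|c| <= `|x| & p x - p 0 = dp c * x.
Proof.
move=> pd; case: (lerP 0 x) => x0.
  have abs t : t \in `[0, x] -> `|t| <= `|x|.
    by rewrite in_itv /= => /andP[a b]; rewrite !ger0_norm.
  have [t /abs tx|c /abs cx] := @mean_value p dp 0 x x0; first exact: pd.
  by rewrite subr0 => E; exists c.
have abs t : t \in `[x, 0] -> `|t| <= `|x|.
  by rewrite in_itv /= => /andP[a b]; rewrite !ler0_norm ?lerN2// ltW.
have [t /abs tx|c /abs cx] := @mean_value p dp x 0 (ltW x0); first exact: pd.
by rewrite sub0r => E; exists c => //; rewrite -opprB E mulrN opprK.
Qed.

Lemma is_cder0_cst f (a b : R) : a <= b ->
  (forall t, t \in `[a, b] -> is_cder f t 0) -> f a = f b.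
Proof.
move=> ab f0.
have key (p : R -> R) : (forall t, t \in `[a, b] -> is_derive t 1 p 0) ->
    p a = p b.
  move=> p0; have [c _] := @mean_value p (fun=> 0) a b ab p0.
  by rewrite mul0r => /eqP; rewrite subr_eq0 => /eqP.
apply: complexP; [apply: (key (fun s => rRe (f s)))
                 |apply: (key (fun s => rIm (f s)))] => t /f0[] //.
Qed.

End ComplexValuedCurves.

(** * Real directional derivatives and the chain rule for C^1 functions *)

Section DirectionalDerivatives.
Variables (R : realType) (m : nat).
Local Notation C := R[i].
Local Notation V := 'cV[C]_m.
Local Notation rRe := (@complex.Re R).
Local Notation rIm := (@complex.Im R).
Implicit Types (f g : V -> C) (e z : V) (U : set V).

Definition rderivable e f z : Prop :=
  derivable (fun t : R => rRe (f (z + t%:C *: e))) 0 1 /\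
  derivable (fun t : R => rIm (f (z + t%:C *: e))) 0 1.

Lemma rderivP e f z : rderivable e f z ->
  is_cder (fun t => f (z + t%:C *: e)) 0 (rderiv e f z).
Proof. by move=> [a b]; exact: derivable_is_cder. Qed.

Lemma is_cder_rderivable e f z d :
  is_cder (fun t => f (z + t%:C *: e)) 0 d -> rderivable e f z.
Proof. exact: is_cder_derivable. Qed.

Lemma is_cder_rderiv e f z d :
  is_cder (fun t => f (z + t%:C *: e)) 0 d -> rderiv e f z = d.
Proof.
by move=> fd; apply: is_cder_unique (rderivP (is_cder_rderivable fd)) fd.
Qed.

Definition C1_on U f := forall z, U z ->
  {for z, continuous f} /\
  forall e, rderivable e f z /\ {for z, continuous (rderiv e f)}.

Lemma rderiv_line e f z t : rderivable e f (z + t%:C *: e) ->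
  is_cder (fun s => f (z + s%:C *: e)) t (rderiv e f (z + t%:C *: e)).
Proof.
move=> /rderivP h; rewrite -[t]addr0.
apply/(is_cder_shift (fun s => f (z + s%:C *: e))); rewrite addr0.
by under eq_fun do rewrite rmorphD/= scalerDl addrA.
Qed.

Lemma line_continuous e z : continuous (fun s : R => z + s%:C *: e).
Proof.
move=> t; apply: cvgD; first exact: cvg_cst.
apply: cvgZr_tmp; apply/cvg_ReIm; split => /=; [exact: cvg_id|exact: cvg_cst].
Qed.

(** The increment at [u] is split at the point [gam u]. The part along [d] is, by the mean value
    theorem, [s u] times a derivative in the direction [d] at an intermediate point, and continuity
    of [rderiv d f] sends that derivative to its value at [gam t]. *)
Lemma is_cder_add_dir U f (gam : R -> V) (s : R -> R) d (t s' : R) (D : C) :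
  open U -> C1_on U f -> U (gam t) -> {for t, continuous gam} ->
  is_cder (fun u => f (gam u)) t D -> is_derive t 1 s s' -> s t = 0 ->
  is_cder (fun u => f (gam u + (s u)%:C *: d)) t
    (D + s'%:C * rderiv d f (gam t)).
Proof.
move=> oU fC1 Ugt gc [DR DI] ss st.
have key (pr : C -> R) :
    (forall z, U z -> {for z, continuous (fun y => pr (rderiv d f y))}) ->
    (forall z c, U (z + c%:C *: d) ->
      is_derive c 1 (fun x : R => pr (f (z + x%:C *: d)))
        (pr (rderiv d f (z + c%:C *: d)))) ->
    is_derive t 1 (fun u => pr (f (gam u))) (pr D) ->
    is_derive t 1 (fun u => pr (f (gam u + (s u)%:C *: d)))
      (pr D + s' * pr (rderiv d f (gam t))).
  move=> prc prd prD.
  have [gs [gsE gsc gst]] := (is_derive1_caratheodory s t s').1 ss.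
  have [gD [gDE gDc gDt]] := (is_derive1_caratheodory _ _ _).1 prD.
  (* The Caratheodory slope in the direction [d]. Where [s u] = 0 the quotient is replaced by its
     limit, so that [k] is continuous at [t]. *)
  pose k u := if s u == 0 then pr (rderiv d f (gam t))
    else (pr (f (gam u + (s u)%:C *: d)) - pr (f (gam u))) / s u.
  apply/(is_derive1_caratheodory _ _ _); exists (fun u => gD u + gs u * k u).
  have kt : k t = pr (rderiv d f (gam t)) by rewrite /k st eqxx.
  split; last by rewrite gDt gst kt.
    move=> u; rewrite st scale0r addr0 mulrDl -gDE mulrAC -gsE st subr0 /k.
    case: ifPn => [/eqP su|su]; first by rewrite su mul0r addr0 scale0r addr0.
    by rewrite mulrC divfK//; ring.
  apply: cvgD => //; apply: cvgM => //; rewrite kt.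
  apply/cvgrPdist_lt => eps eps0.
  have [rho rho0 rhoW] : exists2 rho : C, 0 < rho & forall y, `|gam t - y| < rho ->
      U y /\ `|pr (rderiv d f (gam t)) - pr (rderiv d f y)| < eps.
    have : nbhs (gam t) [set y | U y /\
        `|pr (rderiv d f (gam t)) - pr (rderiv d f y)| < eps].
      apply: filterI; first exact: open_nbhs_nbhs.
      by have /cvgrPdist_lt/(_ _ eps0) := prc _ Ugt.
    rewrite -nbhs_ballE => -[rho /= rho0 rhoW]; exists rho => // y yr.
    by apply: rhoW; rewrite mx_norm_ball.
  have rho20 : 0 < rho / 2 by rewrite divr_gt0.
  have sc : s u @[u --> t] --> (0 : R).
    by rewrite -st; exact: is_derive_continuous ss.
  have d10 : 0 < `|d| + 1 by rewrite ltr_wpDl.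
  have [r r0 rE] : exists2 r : R, 0 < r & r%:C = (rho / 2) / (`|d| + 1).
    have /gtC0_real[r r0 rE] : 0 < (rho / 2) / (`|d| + 1) by rewrite divr_gt0.
    by exists r.
  near=> u; rewrite /k; case: ifPn => [_|su]; first by rewrite subrr normr0.
  have gu : `|gam t - gam u| < rho / 2.
    by near: u; have /cvgrPdist_lt/(_ _ rho20) := gc.
  have sr : `|s u| < r.
    near: u; have /cvgrPdist_lt/(_ _ r0) := sc.
    by apply: filterS => u; rewrite sub0r normrN.
  have near_line (x : R) : `|x| <= `|s u| -> `|gam t - (gam u + x%:C *: d)| < rho.
    move=> xs; rewrite opprD addrA [ltRHS]splitr (le_lt_trans (ler_normB _ _))//.
    rewrite ltr_leD// normrZ norm_real_complex.
    rewrite (@le_trans _ _ (r%:C * `|d|))//.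
      by rewrite ler_wpM2r// lecR (le_trans xs)// ltW.
    rewrite rE -mulrA ler_piMr ?(ltW rho20)// mulrC ler_pdivrMr// mul1r.
    by rewrite lerDl.
  have der (x : R) : `|x| <= `|s u| ->
      is_derive x 1 (fun y : R => pr (f (gam u + y%:C *: d)))
        (pr (rderiv d f (gam u + x%:C *: d))).
    by move=> /near_line /rhoW[Ux _]; exact: prd.
  suff [c cs ->] : exists2 c : R, `|c| <= `|s u| &
      (pr (f (gam u + (s u)%:C *: d)) - pr (f (gam u))) / s u =
      pr (rderiv d f (gam u + c%:C *: d)).
    by have [] := rhoW _ (near_line _ cs).
  pose h y := pr (f (gam u + y%:C *: d)).
  have h0 : h 0 = pr (f (gam u)) by rewrite /h scale0r addr0.
  rewrite -h0 -/(h (s u)).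
  have [c cs] := mean_value0 (fun t => @der t).
  by rewrite -/h => hE; exists c; rewrite // hE mulfK.
have rc z : U z -> {for z, continuous (rderiv d f)}.
  by move=> /fC1[_ /(_ d)[]].
have rd z c : U (z + c%:C *: d) -> is_cder (fun x : R => f (z + x%:C *: d)) c
    (rderiv d f (z + c%:C *: d)).
  by move=> /fC1[_ /(_ d)[? _]]; exact: rderiv_line.
split; rewrite ?ReD ?ImD ?ReM ?ImM /= mul0r ?subr0 ?addr0.
  apply: (key rRe _ _ DR) => [z Uz|z c Uz].
    by have [+ _] := (continuous_ReIm _ _).1 (rc z Uz).
  by have [+ _] := rd z c Uz.
apply: (key rIm _ _ DI) => [z Uz|z c Uz].
  by have [_ +] := (continuous_ReIm _ _).1 (rc z Uz).
by have [_ +] := rd z c Uz.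
Unshelve. all: by end_near. Qed.

End DirectionalDerivatives.

Section ChainRule.
Variables (R : realType) (m : nat).
Local Notation C := R[i].
Local Notation V := 'cV[C]_m.
Local Notation rRe := (@complex.Re R).
Local Notation rIm := (@complex.Im R).
Implicit Types (f g : V -> C) (e z : V) (U : set V).

(** Directions are added one at a time, each to the curve already obtained; [s i t] = 0 keeps all
    these curves at [z] at time [t]. *)
Lemma is_cder_add_dirs U f z (t : R) (I : Type) (l : seq I) (s : I -> R -> R)
    (s' : I -> R) (d : I -> V) : open U -> C1_on U f -> U z ->
  (forall i, is_derive t 1 (s i) (s' i)) -> (forall i, s i t = 0) ->
  is_cder (fun u => f (z + \sum_(i <- l) (s i u)%:C *: d i)) t
    (\sum_(i <- l) (s' i)%:C * rderiv (d i) f z).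
Proof.
move=> oU fC Uz sd st.
have sc i : {for t, continuous (fun u => (s i u)%:C *: d i)}.
  apply: cvgZr_tmp; apply/cvg_ReIm; split; last exact: cvg_cst.
  exact: is_derive_continuous (sd i).
have gt (r : seq I) : z + \sum_(i <- r) (s i t)%:C *: d i = z.
  by rewrite big1 ?addr0// => i _; rewrite st scale0r.
have gc (r : seq I) :
    {for t, continuous (fun u => z + \sum_(i <- r) (s i u)%:C *: d i)}.
  apply: cvgD; first exact: cvg_cst.
  elim: r => [|i r IH].
    by under eq_fun do rewrite big_nil; rewrite big_nil; exact: cvg_cst.
  by under eq_fun do rewrite big_cons; rewrite big_cons; exact: (continuousD (sc i) IH).
elim: l => [|i l IH].
  rewrite big_nil; under eq_fun do rewrite big_nil addr0.
  exact: is_cder_cst.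
rewrite big_cons addrC.
under eq_fun do rewrite big_cons [_ *: _ + _]addrC addrA.
have := @is_cder_add_dir R m U f _ _ (d i) t (s' i) _ oU fC _ (gc l) IH
   (sd i) (st i).
by rewrite gt; exact.
Qed.

(** The real differential of f at z, evaluated on e, in Wirtinger form. *)
Definition cdiff f z e : C :=
  \sum_j (e j 0 * dz j f z + (e j 0)^* * dzbar j f z).

Lemma is_cder_chain U f (gam : R -> V) t e : open U -> C1_on U f ->
  U (gam t) -> (forall j, is_cder (fun u => gam u j 0) t (e j 0)) ->
  is_cder (fun u => f (gam u)) t (cdiff f (gam t) e).
Proof.
move=> oU fC Ug gd.
(* The curve is written in the 2m real coordinates; the boolean selects the real or the imaginary
   part. *)
pose s (p : 'I_m * bool) u := (if p.2 then rRe (gam u p.1 0) - rRe (gam t p.1 0)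
  else rIm (gam u p.1 0) - rIm (gam t p.1 0)).
pose s' (p : 'I_m * bool) := if p.2 then rRe (e p.1 0) else rIm (e p.1 0).
pose d (p : 'I_m * bool) : V :=
  if p.2 then delta_mx p.1 0 else 'i *: delta_mx p.1 0.
have sd p : is_derive t 1 (s p) (s' p).
  have key (h : R -> R) (c a : R) : is_derive t 1 h a ->
      is_derive t 1 (fun u => h u - c) a.
    move=> ha; rewrite -[a]subr0.
    exact: (is_deriveB ha (is_derive_cst c _ _)).
  by case: p => j [] /=; apply: key; have [] := gd j.
have st p : s p t = 0 by rewrite /s !subrr; case: ifP.
have := is_cder_add_dirs (index_enum _) d oU fC Ug sd st.
set D := (X in is_cder _ _ X) => h.
have gE u : gam u = gam t + \sum_p (s p u)%:C *: d p.
  have -> : \sum_p (s p u)%:C *: d p =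
      \sum_j ((s (j, true) u)%:C *: d (j, true) +
              (s (j, false) u)%:C *: d (j, false)).
    rewrite -(pair_bigA _ (fun j b => (s (j, b) u)%:C *: d (j, b))) /=.
    by apply: eq_bigr => j _; rewrite big_bool.
  apply/matrixP => k i; rewrite ord1 !mxE summxE (bigD1 k)//= big1; last first.
    move=> j jk; rewrite !mxE /= eq_sym (negPf jk) /=.
    by rewrite !mulr0 addr0.
  rewrite addr0 /s /d /= !mxE !eqxx !mulr1.
  by apply: complexP; rewrite !ReImE /=; ring.
have -> : cdiff f (gam t) e = D.
  rewrite /D /cdiff.
  rewrite -(pair_bigA _ (fun j b => (s' (j, b))%:C * rderiv (d (j, b)) f (gam t))).
  apply: eq_bigr => j _; rewrite big_bool /= /s' /d /= /dz /dzbar.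
  set A := rderiv _ _ _; set B := rderiv _ _ _.
  have -> : (e j 0)^* = (rRe (e j 0))%:C - 'i * (rIm (e j 0))%:C.
    by apply: complexP; rewrite !ReImE /=; ring.
  rewrite [in e j 0 * _](_ : e j 0 = (rRe (e j 0))%:C + 'i * (rIm (e j 0))%:C).
    have i2 : ('i : C) ^+ 2 = -1 by exact: sqr_i.
    have n2 : (2 : C) != 0 by rewrite pnatr_eq0.
    apply: (mulfI n2); field : i2.
    by [].
  by apply: complexP; rewrite !ReImE /=; ring.
by apply: near_eq_is_cder h; near=> u; rewrite -gE.
Unshelve. all: by end_near. Qed.

Lemma rderivE U f e z : open U -> C1_on U f -> U z -> rderiv e f z = cdiff f z e.
Proof.
move=> oU fC Uz; apply: is_cder_rderiv.
have := @is_cder_chain U f (fun t => z + t%:C *: e) 0 e oU fC.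
rewrite scale0r addr0 => /(_ Uz); apply=> j.
under eq_fun do rewrite !mxE.
apply: (@is_cder_eq _ _ _ (0 + (1 * e j 0 + 0%:C * 0))).
  exact: (is_cderD (is_cder_cst _ _) (is_cderM (is_cder_id _) (is_cder_cst _ _))).
by rewrite mulr0 addr0 add0r mul1r.
Qed.

Lemma is_cder_comp U f (gam : R -> V) t e : open U -> C1_on U f ->
  U (gam t) -> (forall j, is_cder (fun u => gam u j 0) t (e j 0)) ->
  is_cder (fun u => f (gam u)) t (rderiv e f (gam t)).
Proof.
by move=> oU fC Ug gd; rewrite (rderivE _ oU fC Ug); exact: (is_cder_chain oU fC Ug gd).
Qed.

End ChainRule.

(** * Smooth and holomorphic functions *)

Lemma eq_continuous_at (S T : topologicalType) (f g : S -> T) (x : S) :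
  f =1 g -> {for x, continuous f} -> {for x, continuous g}.
Proof. by move=> /funext ->. Qed.

Section SmoothFunctions.
Variables (R : realType) (m : nat).
Local Notation C := R[i].
Local Notation V := 'cV[C]_m.
Local Notation rRe := (@complex.Re R).
Local Notation rIm := (@complex.Im R).
Variable U : set V.
Hypothesis oU : open U.
Implicit Types (f g : V -> C) (e z : V).

Definition eq_on (T : Type) (f g : V -> T) := forall z, U z -> f z = g z.

(** The order is kept as an explicit bound so that closure properties can be proved by induction on
    it. *)
Fixpoint Ck (k : nat) (f : V -> C) : Prop :=
  (forall z, U z -> {for z, continuous f}) /\
  if k is k'.+1 then
    (forall z e, U z -> rderivable e f z) /\ forall e, Ck k' (rderiv e f)
  else True.

Definition smooth_on f := forall k, Ck k f.

Lemma Ck_continuous k f z : Ck k f -> U z -> {for z, continuous f}.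
Proof. by case: k => [|k] [fc _]; exact: fc. Qed.

Lemma CkW k f : Ck k.+1 f -> Ck k f.
Proof.
elim: k f => [|k IH] f [fc [fd fk]]; first by split.
by split; [exact: fc|split; [exact: fd|move=> e; exact: IH (fk e)]].
Qed.

Lemma Ck_C1 k f : Ck k.+1 f -> C1_on U f.
Proof.
move=> [fc [fd fk]] z Uz; split; first exact: fc.
by move=> e; split; [exact: fd|exact: Ck_continuous (fk e) Uz].
Qed.

Lemma smooth_C1 f : smooth_on f -> C1_on U f.
Proof. by move=> fs; exact: Ck_C1 (fs 1%N). Qed.

Lemma smooth_rderiv e f : smooth_on f -> smooth_on (rderiv e f).
Proof. by move=> fs k; have [_ [_ fk]] := fs k.+1; exact: fk. Qed.

Lemma smooth_rderivable e f z : smooth_on f -> U z -> rderivable e f z.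
Proof. by move=> fs; have [_ [h _]] := fs 1%N; exact: h. Qed.

Lemma smooth_continuous f z : smooth_on f -> U z -> {for z, continuous f}.
Proof. by move=> fs; exact: Ck_continuous (fs 0%N). Qed.

Lemma is_cder_smooth e f z : smooth_on f -> U z ->
  is_cder (fun t => f (z + t%:C *: e)) 0 (rderiv e f z).
Proof. by move=> fs Uz; exact: rderivP (smooth_rderivable e fs Uz). Qed.

Lemma near_line e z : U z -> \forall t \near (0 : R), U (z + t%:C *: e).
Proof.
move=> Uz; apply: (@line_continuous R m e z 0 U).
by rewrite /= scale0r addr0; exact: open_nbhs_nbhs.
Qed.

Lemma rderiv_eq_on e f g z : U z -> eq_on f g -> rderivable e f z ->
  rderivable e g z /\ rderiv e g z = rderiv e f z.
Proof.
move=> Uz fg /rderivP fd.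
have gd : is_cder (fun t => g (z + t%:C *: e)) 0 (rderiv e f z).
  apply: near_eq_is_cder fd; have zU := near_line e Uz.
  by near=> t; apply: fg; near: t.
by split; [exact: is_cder_rderivable gd|exact: is_cder_rderiv].
Unshelve. all: by end_near. Qed.

Lemma continuous_eq_on f g z : U z -> eq_on f g ->
  {for z, continuous f} -> {for z, continuous g}.
Proof.
move=> Uz fg fc; rewrite /prop_for /continuous_at -(fg z Uz).
have zU := open_nbhs_nbhs (conj oU Uz).
have fgz : \forall y \near z, f y = g y by near=> y; apply: fg; near: y.
exact: cvg_trans (near_eq_cvg fgz) fc.
Unshelve. all: by end_near. Qed.

Lemma Ck_eq k f g : eq_on f g -> Ck k f -> Ck k g.
Proof.
elim: k f g => [|k IH] f g fg.
  by move=> [fc _]; split; [move=> z Uz; exact: continuous_eq_on (fc z Uz)|].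
move=> [fc [fd fk]]; split.
  by move=> z Uz; exact: continuous_eq_on (fc z Uz).
split=> [z e Uz|e]; first by have [] := rderiv_eq_on Uz fg (fd z e Uz).
by apply: IH (fk e) => z Uz; have [] := rderiv_eq_on Uz fg (fd z e Uz).
Qed.

Lemma smooth_eq f g : eq_on f g -> smooth_on f -> smooth_on g.
Proof. by move=> fg fs k; exact: Ck_eq (fs k). Qed.

Lemma Ck_S k f (d : V -> V -> C) : (forall z, U z -> {for z, continuous f}) ->
  (forall z e, U z -> is_cder (fun t => f (z + t%:C *: e)) 0 (d e z)) ->
  (forall e, Ck k (d e)) -> Ck k.+1 f.
Proof.
move=> fc fd dk; split; [exact: fc|split=> [z e Uz|e]].
  exact: is_cder_rderivable (fd z e Uz).
by apply: Ck_eq (dk e) => z Uz; rewrite (is_cder_rderiv (fd z e Uz)).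
Qed.

Lemma Ck_cst k (c : C) : Ck k (fun=> c).
Proof.
elim: k c => [|k IH] c; first by split; [move=> z _; exact: cst_continuous|].
apply: (@Ck_S _ _ (fun _ _ => 0)) => [z _|z e _|e]; first exact: cst_continuous.
  exact: is_cder_cst.
exact: IH.
Qed.

Lemma smooth_cst (c : C) : smooth_on (fun=> c).
Proof. by move=> k; exact: Ck_cst. Qed.

Lemma is_cder_coord j z e (t : R) :
  is_cder (fun t => (z + t%:C *: e) j 0) t (e j 0).
Proof.
under eq_fun do rewrite !mxE.
apply: (@is_cder_eq _ _ _ (0 + (1 * e j 0 + t%:C * 0))).
  exact: (is_cderD (is_cder_cst _ _) (is_cderM (is_cder_id _) (is_cder_cst _ _))).
by rewrite mulr0 addr0 add0r mul1r.
Qed.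

Lemma smooth_coord j : smooth_on (fun z => z j 0).
Proof.
case=> [|k]; first by split; [move=> z _; exact: coord_continuous|].
apply: (@Ck_S _ _ (fun e _ => e j 0)) => [z _|z e _|e].
- exact: coord_continuous.
- exact: is_cder_coord.
- exact: Ck_cst.
Qed.

Lemma is_cder_Ck k e f z : Ck k.+1 f -> U z ->
  is_cder (fun t => f (z + t%:C *: e)) 0 (rderiv e f z).
Proof. by move=> [_ [fd _]] Uz; exact: rderivP (fd z e Uz). Qed.

Lemma CkD k f g : Ck k f -> Ck k g -> Ck k (fun z => f z + g z).
Proof.
elim: k f g => [|k IH] f g fs gs.
  split; [move=> z Uz|by []].
  exact: continuousD (Ck_continuous fs Uz) (Ck_continuous gs Uz).
apply: (@Ck_S _ _ (fun e z => rderiv e f z + rderiv e g z)) => [z Uz|z e Uz|e].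
- exact: continuousD (Ck_continuous fs Uz) (Ck_continuous gs Uz).
- exact: (is_cderD (is_cder_Ck e fs Uz) (is_cder_Ck e gs Uz)).
- by have [_ [_ fe]] := fs; have [_ [_ ge]] := gs; exact: (IH _ _ (fe e) (ge e)).
Qed.

Lemma CkM k f g : Ck k f -> Ck k g -> Ck k (fun z => f z * g z).
Proof.
elim: k f g => [|k IH] f g fs gs.
  split; [move=> z Uz|by []].
  exact: continuousM (Ck_continuous fs Uz) (Ck_continuous gs Uz).
apply: (@Ck_S _ _ (fun e z => rderiv e f z * g z + f z * rderiv e g z))
    => [z Uz|z e Uz|e].
- exact: continuousM (Ck_continuous fs Uz) (Ck_continuous gs Uz).
- have := is_cderM (is_cder_Ck e fs Uz) (is_cder_Ck e gs Uz).
  by rewrite scale0r addr0.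
- have [_ [_ fe]] := fs; have [_ [_ ge]] := gs.
  exact: (CkD (IH _ _ (fe e) (CkW gs)) (IH _ _ (CkW fs) (ge e))).
Qed.

Lemma CkJ k f : Ck k f -> Ck k (fun z => (f z)^*).
Proof.
have cJ g z : {for z, continuous g} -> {for z, continuous (fun z => (g z)^*)}.
  move=> gz; have [a b] := (continuous_ReIm g z).1 gz.
  apply/continuous_ReIm; split.
    by apply: (eq_continuous_at _ a) => u; rewrite ReJ.
  by apply: (eq_continuous_at _ (continuousN b)) => u; rewrite ImJ.
elim: k f => [|k IH] f fs.
  by split; [move=> z Uz; exact: cJ (Ck_continuous fs Uz)|].
apply: (@Ck_S _ _ (fun e z => (rderiv e f z)^*)) => [z Uz|z e Uz|e].
- exact: cJ (Ck_continuous fs Uz).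
- exact: is_cderJ (is_cder_Ck e fs Uz).
- by have [_ [_ fe]] := fs; exact: (IH _ (fe e)).
Qed.

Lemma smoothD f g : smooth_on f -> smooth_on g -> smooth_on (fun z => f z + g z).
Proof. by move=> fs gs k; exact: CkD. Qed.

Lemma smoothM f g : smooth_on f -> smooth_on g -> smooth_on (fun z => f z * g z).
Proof. by move=> fs gs k; exact: CkM. Qed.

Lemma smoothJ f : smooth_on f -> smooth_on (fun z => (f z)^*).
Proof. by move=> fs k; exact: CkJ. Qed.

Lemma smoothN f : smooth_on f -> smooth_on (fun z => - f z).
Proof.
move=> fs; under eq_fun do rewrite -mulN1r.
by apply: smoothM => //; exact: smooth_cst.
Qed.

Lemma smoothB f g : smooth_on f -> smooth_on g -> smooth_on (fun z => f z - g z).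
Proof. by move=> fs gs; apply: smoothD => //; exact: smoothN. Qed.

Lemma smooth_sum (I : Type) (l : seq I) (P : pred I) (F : I -> V -> C) :
  (forall i, smooth_on (F i)) -> smooth_on (fun z => \sum_(i <- l | P i) F i z).
Proof.
move=> Fs; elim: l => [|i l IH].
  by under eq_fun do rewrite big_nil; exact: smooth_cst.
under eq_fun do rewrite big_cons.
by case: (P i) => //; apply: smoothD.
Qed.

(** The mean value theorem is applied twice: to the difference over a step along [e'], as a function
    of the position along [e], and then to [rderiv e f] along [e']. *)
Lemma second_difference (pr : C -> R) f z e e' (s : R) :
  pr =1 (@complex.Re R) \/ pr =1 (@complex.Im R) -> Ck 2 f -> 0 < s ->
  (forall a b : R, `|a| <= s -> `|b| <= s -> U (z + a%:C *: e + b%:C *: e')) ->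
  exists c c', [/\ `|c| <= s, `|c'| <= s &
    pr (f (z + s%:C *: e + s%:C *: e')) - pr (f (z + s%:C *: e))
    - (pr (f (z + s%:C *: e')) - pr (f z)) =
    s ^+ 2 * pr (rderiv e' (rderiv e f) (z + c%:C *: e + c'%:C *: e'))].
Proof.
move=> pr_ReIm f2 s0 sU.
have prd g y d t : Ck 1 g -> U (y + t%:C *: d) ->
    is_derive t (1 : R) (fun x : R => pr (g (y + x%:C *: d)))
      (pr (rderiv d g (y + t%:C *: d))).
  move=> [_ [gd _]] /gd/rderiv_line[gR gI].
  case: pr_ReIm => prE; rewrite prE; under eq_fun do rewrite prE.
    exact: gR.
  exact: gI.
have f1 := CkW f2.
pose p x := pr (f (z + s%:C *: e' + x%:C *: e)) - pr (f (z + x%:C *: e)).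
pose dp x := pr (rderiv e f (z + s%:C *: e' + x%:C *: e))
  - pr (rderiv e f (z + x%:C *: e)).
have sabs : `|s| = s by rewrite ger0_norm// ltW.
have [t ts|c] := @mean_value0 R p dp s.
  have U1 : U (z + s%:C *: e' + t%:C *: e).
    by rewrite addrAC; apply: sU; rewrite ?sabs// -sabs.
  have U2 : U (z + t%:C *: e).
    have := sU t 0; rewrite scale0r addr0; apply; first by rewrite -sabs.
    by rewrite normr0 ltW.
  exact: (is_deriveB (prd _ _ _ _ f1 U1) (prd _ _ _ _ f1 U2)).
rewrite sabs => cs; rewrite /p !scale0r !addr0 => pE.
have [_ [_ /(_ e) fe1]] := f2.
have [t ts|c'] := @mean_value0 R
  (fun x => pr (rderiv e f (z + c%:C *: e + x%:C *: e')))
  (fun x => pr (rderiv e' (rderiv e f) (z + c%:C *: e + x%:C *: e'))) s.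
  by apply: (prd _ _ _ _ fe1); apply: sU; rewrite // -sabs.
rewrite sabs scale0r addr0 => c's E; exists c, c'; split=> //.
move: pE; rewrite /dp [z + _ + c%:C *: e]addrAC E mulrAC -mulrA -expr2 mulrC => <-.
by rewrite [z + _ + s%:C *: e]addrAC; ring.
Qed.

(** The second difference is symmetric in [e] and [e'], so the two mixed derivatives take a common
    value at two points near [z]; their continuity at [z] does the rest. *)
Lemma Schwarz f z e e' : Ck 2 f -> U z ->
  rderiv e (rderiv e' f) z = rderiv e' (rderiv e f) z.
Proof.
move=> f2 Uz.
have key (pr : C -> R) : pr =1 (@complex.Re R) \/ pr =1 (@complex.Im R) ->
    pr (rderiv e (rderiv e' f) z) = pr (rderiv e' (rderiv e f) z).
  move=> prE.
  have prc (g : V -> C) : {for z, continuous g} ->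
      {for z, continuous (fun y => pr (g y))}.
    move=> gz; have [gR gI] := (continuous_ReIm g z).1 gz.
    case: prE => prE'; [apply: (eq_continuous_at _ gR) => y
                       |apply: (eq_continuous_at _ gI) => y];
    by rewrite prE'.
  have cc d d' : {for z, continuous (rderiv d (rderiv d' f))}.
    have [_ [_ /(_ d')[_ [_ /(_ d)]]]] := f2.
    by move=> h; exact: (@Ck_continuous 0 _ _ h Uz).
  have close (eps P Q W : R) : `|P - Q| < eps / 2 -> `|W - Q| < eps / 2 ->
      `|P - W| <= eps.
    move=> h1 h2; have -> : P - W = (P - Q) - (W - Q) by ring.
    by rewrite ltW// [ltRHS]splitr (le_lt_trans (ler_normB _ _))// ltrD.
  apply/eqP; rewrite -subr_eq0 -normr_le0; apply/ler_addgt0Pr => eps eps0; rewrite add0r.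
  have [rho rho0 rhoW] : exists2 rho : C, 0 < rho & forall y, `|z - y| < rho ->
      [/\ U y, `|pr (rderiv e (rderiv e' f) z) - pr (rderiv e (rderiv e' f) y)|
         < eps / 2 &
        `|pr (rderiv e' (rderiv e f) z) - pr (rderiv e' (rderiv e f) y)|
         < eps / 2].
    have e20 : 0 < eps / 2 by rewrite divr_gt0.
    have : nbhs z [set y | [/\ U y,
         `|pr (rderiv e (rderiv e' f) z) - pr (rderiv e (rderiv e' f) y)|
         < eps / 2 &
        `|pr (rderiv e' (rderiv e f) z) - pr (rderiv e' (rderiv e f) y)|
         < eps / 2]].
      have h1 := open_nbhs_nbhs (conj oU Uz).
      have /cvgrPdist_lt/(_ _ e20) h2 := prc _ (cc e e').
      have /cvgrPdist_lt/(_ _ e20) h3 := prc _ (cc e' e).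
      apply: filterS (filterI h1 (filterI h2 h3)) => y [a [b c]].
      exact: And3 a b c.
    rewrite -nbhs_ballE => -[rho /= rho0 rhoW]; exists rho; first exact: rho0.
    by move=> y yr; apply: rhoW; rewrite mx_norm_ball; exact: yr.
  have d0 : 0 < `|e| + `|e'| + 1 by rewrite ltr_wpDl// addr_ge0.
  (* This step size keeps the whole parallelogram within distance [rho] of [z]. *)
  have [s s0 sE] : exists2 s : R, 0 < s & s%:C = rho / (`|e| + `|e'| + 1).
    have /gtC0_real[r r0 rE] : 0 < rho / (`|e| + `|e'| + 1) by rewrite divr_gt0.
    by exists r.
  have sU (a b : R) : `|a| <= s -> `|b| <= s ->
      `|z - (z + a%:C *: e + b%:C *: e')| < rho.
    move=> as_ bs; rewrite -addrA opprD addNKr normrN.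
    rewrite (le_lt_trans (ler_normD _ _))// !normrZ !norm_real_complex.
    rewrite (@le_lt_trans _ _ (s%:C * (`|e| + `|e'|)))//.
      by rewrite mulrDr lerD// ler_wpM2r// lecR.
    rewrite sE mulrAC ltr_pdivrMr// ltr_pM2l//.
    by rewrite ltrDl.
  have [|c [c' [cs c's E]]] := @second_difference pr f z e e' s prE f2 s0.
    by move=> a b as_ bs; have [] := rhoW _ (sU _ _ as_ bs).
  have sU' (a b : R) : `|a| <= s -> `|b| <= s ->
      `|z - (z + a%:C *: e' + b%:C *: e)| < rho.
    by move=> as_ bs; rewrite -addrA [_ *: e' + _]addrC addrA; exact: sU.
  have [|d [d' [ds d's E']]] := @second_difference pr f z e' e s prE f2 s0.
    by move=> a b as_ bs; have [] := rhoW _ (sU' _ _ as_ bs).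
  have [_ _ h2] := rhoW _ (sU _ _ cs c's).
  have [_ h1 _] := rhoW _ (sU' _ _ ds d's).
  have EE : pr (rderiv e (rderiv e' f) (z + d%:C *: e' + d'%:C *: e)) =
      pr (rderiv e' (rderiv e f) (z + c%:C *: e + c'%:C *: e')).
    have s2 : s ^+ 2 != 0 by rewrite expf_neq0// gt_eqF.
    have sd (w x y v : R) : w - x - (y - v) = w - y - (x - v) by ring.
    apply: (mulfI s2); apply: etrans E; apply: etrans (esym E') _.
    by rewrite [z + _ + s%:C *: e]addrAC sd.
  have h1' := eq_ind _
    (fun A => `|pr (rderiv e (rderiv e' f) z) - A| < eps / 2) h1 _ EE.
  exact: close h1' h2.
by apply: complexP; [apply: (key (@complex.Re R)); left|apply: (key (@complex.Im R)); right].
Qed.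

End SmoothFunctions.

(** * Wirtinger calculus and holomorphic functions *)

Section Derivations.
Variables (R : realType) (m : nat).
Local Notation C := R[i].
Local Notation V := 'cV[C]_m.
Variable U : set V.
Hypothesis oU : open U.
Implicit Types (f g : V -> C) (e z : V) (D : (V -> C) -> V -> C).
Local Notation smooth := (smooth_on U).

(** The rules shared by [rderiv e], [dz j] and [dzbar j]. The field [der_eq] is locality on U; it
    permits rewriting under D with identities that hold on U only. *)
Record derivation D : Prop := Derivation {
  der_eq : forall f g, smooth f -> eq_on U f g -> eq_on U (D f) (D g);
  der_smooth : forall f, smooth f -> smooth (D f);
  der_cst : forall c z, U z -> D (fun=> c) z = 0;
  derD : forall f g z, smooth f -> smooth g -> U z ->
    D (fun z => f z + g z) z = D f z + D g z;
  derM : forall f g z, smooth f -> smooth g -> U z ->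
    D (fun z => f z * g z) z = D f z * g z + f z * D g z }.

Lemma derivation_rderiv e : derivation (rderiv e).
Proof.
split=> [f g fs fg z Uz|f fs|c z Uz|f g z fs gs Uz|f g z fs gs Uz].
- by have [] := rderiv_eq_on oU Uz fg (smooth_rderivable e fs Uz).
- exact: (smooth_rderiv e fs).
- by apply: is_cder_rderiv; exact: (is_cder_cst c 0).
- apply: is_cder_rderiv.
  exact: is_cderD (is_cder_smooth e fs Uz) (is_cder_smooth e gs Uz).
- apply: is_cder_rderiv.
  have := is_cderM (is_cder_smooth e fs Uz) (is_cder_smooth e gs Uz).
  by rewrite scale0r addr0.
Qed.

Lemma derivation_lin D1 D2 (c1 c2 : C) : derivation D1 -> derivation D2 ->
  derivation (fun f z => c1 * D1 f z + c2 * D2 f z).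
Proof.
move=> d1 d2; split=> [f g fs fg z Uz|f fs|c z Uz|f g z fs gs Uz|f g z fs gs Uz].
- by rewrite (der_eq d1 fs fg Uz) (der_eq d2 fs fg Uz).
- exact: (smoothD oU (smoothM oU (smooth_cst oU c1) (der_smooth d1 fs))
                     (smoothM oU (smooth_cst oU c2) (der_smooth d2 fs))).
- by rewrite (der_cst d1 c Uz) (der_cst d2 c Uz) !mulr0 addr0.
- have E (x x' y y' : C) :
    c1 * (x + x') + c2 * (y + y') = c1 * x + c2 * y + (c1 * x' + c2 * y') by ring.
  by rewrite (derD d1 fs gs Uz) (derD d2 fs gs Uz) E.
- have E (x x' y y' p q : C) : c1 * (x * q + p * x') + c2 * (y * q + p * y') =
    (c1 * x + c2 * y) * q + p * (c1 * x' + c2 * y') by ring.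
  by rewrite (derM d1 fs gs Uz) (derM d2 fs gs Uz) E.
Qed.

Lemma dz_lin j : @dz R m j = fun f z =>
  2^-1 * rderiv (delta_mx j 0) f z + (- 'i / 2) * rderiv ('i *: delta_mx j 0) f z.
Proof.
apply/funext => f; apply/funext => z; rewrite /dz.
have E (A B : C) : (A - 'i * B) / 2 = 2^-1 * A + (- 'i / 2) * B by ring.
exact: E.
Qed.

Lemma dzbar_lin j : @dzbar R m j = fun f z =>
  2^-1 * rderiv (delta_mx j 0) f z + ('i / 2) * rderiv ('i *: delta_mx j 0) f z.
Proof.
apply/funext => f; apply/funext => z; rewrite /dzbar.
have E (A B : C) : (A + 'i * B) / 2 = 2^-1 * A + ('i / 2) * B by ring.
exact: E.
Qed.

Lemma derivation_dz j : derivation (dz j).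
Proof. by rewrite dz_lin; exact: (derivation_lin _ _ (derivation_rderiv _) (derivation_rderiv _)). Qed.

Lemma derivation_dzbar j : derivation (dzbar j).
Proof. by rewrite dzbar_lin; exact: (derivation_lin _ _ (derivation_rderiv _) (derivation_rderiv _)). Qed.

Section Rules.
Variable D : (V -> C) -> V -> C.
Hypothesis dD : derivation D.

Lemma derN f z : smooth f -> U z -> D (fun z => - f z) z = - D f z.
Proof.
move=> fs Uz; under eq_fun do rewrite -mulN1r.
rewrite (derM dD (smooth_cst oU _) fs Uz) (der_cst dD _ Uz).
by rewrite mul0r add0r mulN1r.
Qed.

Lemma derB f g z : smooth f -> smooth g -> U z ->
  D (fun z => f z - g z) z = D f z - D g z.
Proof.
by move=> fs gs Uz; rewrite (derD dD fs (smoothN oU gs) Uz) (derN gs Uz).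
Qed.

Lemma derZ (c : C) f z : smooth f -> U z -> D (fun z => c * f z) z = c * D f z.
Proof.
move=> fs Uz.
by rewrite (derM dD (smooth_cst oU _) fs Uz) (der_cst dD _ Uz) mul0r add0r.
Qed.

Lemma der_sum (I : Type) (l : seq I) (P : pred I) (F : I -> V -> C) z :
  (forall i, smooth (F i)) -> U z ->
  D (fun z => \sum_(i <- l | P i) F i z) z = \sum_(i <- l | P i) D (F i) z.
Proof.
move=> Fs Uz; elim: l => [|i l IH].
  by under eq_fun do rewrite big_nil; rewrite (der_cst dD _ Uz) big_nil.
under eq_fun do rewrite big_cons; rewrite big_cons.
case: (P i); last exact: IH.
by rewrite (derD dD (Fs i) (smooth_sum oU l P Fs) Uz) IH.
Qed.

End Rules.

Lemma rderivJ e f z : smooth f -> U z ->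
  rderiv e (fun z => (f z)^*) z = (rderiv e f z)^*.
Proof.
move=> fs Uz; apply: is_cder_rderiv.
exact: is_cderJ (is_cder_smooth e fs Uz).
Qed.

Lemma conj_half : (2^-1 : C)^* = 2^-1.
Proof. by rewrite fmorphV rmorph_nat. Qed.

Lemma dzJ j f z : smooth f -> U z -> dz j (fun z => (f z)^*) z = (dzbar j f z)^*.
Proof.
move=> fs Uz; rewrite dz_lin dzbar_lin (rderivJ _ fs Uz) (rderivJ _ fs Uz).
have E (A B : C) : 2^-1 * A^* + (- 'i / 2) * B^* = (2^-1 * A + 'i / 2 * B)^*.
  by rewrite rmorphD !rmorphM /= conjCi conj_half.
exact: E.
Qed.

Lemma dzbarJ j f z : smooth f -> U z -> dzbar j (fun z => (f z)^*) z = (dz j f z)^*.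
Proof.
move=> fs Uz; rewrite dz_lin dzbar_lin (rderivJ _ fs Uz) (rderivJ _ fs Uz).
have E (A B : C) : 2^-1 * A^* + ('i / 2) * B^* = (2^-1 * A + - 'i / 2 * B)^*.
  by rewrite rmorphD !rmorphM rmorphN /= conjCi opprK conj_half.
exact: E.
Qed.

Definition commuting D1 D2 :=
  forall f z, smooth f -> U z -> D1 (D2 f) z = D2 (D1 f) z.

Lemma commutingC D1 D2 : commuting D1 D2 -> commuting D2 D1.
Proof. by move=> c f z fs Uz; exact: esym (c f z fs Uz). Qed.

Lemma commuting_rderiv e e' : commuting (rderiv e) (rderiv e').
Proof. by move=> f z fs Uz; apply: (Schwarz oU _ _ (fs 2%N) Uz). Qed.

Lemma commuting_lin D D1 D2 (c1 c2 : C) :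
  derivation D -> derivation D1 -> derivation D2 ->
  commuting D D1 -> commuting D D2 ->
  commuting D (fun f z => c1 * D1 f z + c2 * D2 f z).
Proof.
move=> d d1 d2 k1 k2 f z fs Uz.
have s1 := der_smooth d1 fs; have s2 := der_smooth d2 fs.
rewrite (derD d (smoothM oU (smooth_cst oU _) s1) (smoothM oU (smooth_cst oU _) s2) Uz).
by rewrite (derZ d _ s1 Uz) (derZ d _ s2 Uz) (k1 _ _ fs Uz) (k2 _ _ fs Uz).
Qed.

Lemma commuting_rdz e j : commuting (rderiv e) (dz j).
Proof.
rewrite dz_lin.
exact: (commuting_lin _ _ (derivation_rderiv _) (derivation_rderiv _)
  (derivation_rderiv _) (commuting_rderiv _ _) (commuting_rderiv _ _)).
Qed.

Lemma commuting_rdzbar e j : commuting (rderiv e) (dzbar j).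
Proof.
rewrite dzbar_lin.
exact: (commuting_lin _ _ (derivation_rderiv _) (derivation_rderiv _)
  (derivation_rderiv _) (commuting_rderiv _ _) (commuting_rderiv _ _)).
Qed.

Lemma commuting_dz j k : commuting (dz j) (dz k).
Proof.
rewrite (dz_lin k).
exact: (commuting_lin _ _ (derivation_dz j) (derivation_rderiv _) (derivation_rderiv _)
  (commutingC (commuting_rdz _ _)) (commutingC (commuting_rdz _ _))).
Qed.

Lemma commuting_dz_dzbar j k : commuting (dz j) (dzbar k).
Proof.
rewrite dzbar_lin.
exact: (commuting_lin _ _ (derivation_dz j) (derivation_rderiv _) (derivation_rderiv _)
  (commutingC (commuting_rdz _ _)) (commutingC (commuting_rdz _ _))).
Qed.

Lemma commuting_dzbar j k : commuting (dzbar j) (dzbar k).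
Proof.
rewrite (dzbar_lin k).
exact: (commuting_lin _ _ (derivation_dzbar j) (derivation_rderiv _) (derivation_rderiv _)
  (commutingC (commuting_rdzbar _ _)) (commutingC (commuting_rdzbar _ _))).
Qed.

Lemma rderiv_coord e j z : rderiv e (fun z => z j 0) z = e j 0.
Proof. by apply: is_cder_rderiv; exact: is_cder_coord. Qed.

Lemma dz_coord j k z : dz k (fun z => z j 0) z = (j == k)%:R.
Proof.
rewrite /dz !rderiv_coord !mxE andbT mulrA.
have -> : 'i * 'i = -1 :> C by rewrite -expr2 sqrCi.
by rewrite mulN1r opprK -mulr2n -[_ *+ 2]mulr_natr mulfK// pnatr_eq0.
Qed.

Lemma dzbar_coord j k z : dzbar k (fun z => z j 0) z = 0.
Proof.
rewrite /dzbar !rderiv_coord !mxE andbT mulrA.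
have -> : 'i * 'i = -1 :> C by rewrite -expr2 sqrCi.
by rewrite mulN1r subrr mul0r.
Qed.

Definition hol f := smooth f /\ forall k z, U z -> dzbar k f z = 0.

Lemma hol_cst c : hol (fun=> c).
Proof.
split=> [|k z Uz]; first exact: smooth_cst.
exact: (der_cst (derivation_dzbar k) _ Uz).
Qed.

Lemma hol_coord j : hol (fun z => z j 0).
Proof. by split=> [|k z Uz]; [exact: smooth_coord|exact: dzbar_coord]. Qed.

Lemma holD f g : hol f -> hol g -> hol (fun z => f z + g z).
Proof.
move=> [fs fh] [gs gh]; split=> [|k z Uz]; first exact: (smoothD oU fs gs).
by rewrite (derD (derivation_dzbar k) fs gs Uz) (fh k z Uz) (gh k z Uz) addr0.
Qed.

Lemma holM f g : hol f -> hol g -> hol (fun z => f z * g z).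
Proof.
move=> [fs fh] [gs gh]; split=> [|k z Uz]; first exact: (smoothM oU fs gs).
rewrite (derM (derivation_dzbar k) fs gs Uz) (fh k z Uz) (gh k z Uz).
by rewrite mul0r mulr0 addr0.
Qed.

Lemma holN f : hol f -> hol (fun z => - f z).
Proof.
move=> [fs fh]; split=> [|k z Uz]; first exact: (smoothN oU fs).
by rewrite (derN (derivation_dzbar k) fs Uz) (fh k z Uz) oppr0.
Qed.

Lemma holB f g : hol f -> hol g -> hol (fun z => f z - g z).
Proof. by move=> fh gh; exact: (holD fh (holN gh)). Qed.

Lemma hol_sum (I : Type) (l : seq I) (P : pred I) (F : I -> V -> C) :
  (forall i, hol (F i)) -> hol (fun z => \sum_(i <- l | P i) F i z).
Proof.
move=> Fh; elim: l => [|i l IH].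
  by under eq_fun do rewrite big_nil; exact: hol_cst.
under eq_fun do rewrite big_cons.
by case: (P i); [exact: (holD (Fh i) IH)|exact: IH].
Qed.

Lemma hol_eq f g : eq_on U f g -> hol f -> hol g.
Proof.
move=> fg [fs fh]; split=> [|k z Uz]; first exact: (smooth_eq oU fg fs).
by rewrite -(der_eq (derivation_dzbar k) fs fg Uz) (fh k z Uz).
Qed.

Lemma hol_dz j f : hol f -> hol (dz j f).
Proof.
move=> [fs fh]; split=> [|k z Uz]; first exact: (der_smooth (derivation_dz j) fs).
apply: etrans (esym (commuting_dz_dzbar j k fs Uz)) _.
have fE : eq_on U (dzbar k f) (fun=> 0) by move=> y Uy; exact: fh.
apply: etrans (der_eq (derivation_dz j) (der_smooth (derivation_dzbar k) fs) fE Uz) _.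
exact: (der_cst (derivation_dz j) _ Uz).
Qed.

End Derivations.

(** * Flatness and jets *)

Section Vanishing.
Variables (R : realType) (m : nat).
Local Notation C := R[i].
Local Notation V := 'cV[C]_m.
Variables U Z : set V.
Hypotheses (oU : open U) (ZU : Z `<=` U).
Implicit Types (f g : V -> C) (e z : V).
Local Notation smooth := (smooth_on U).

(* Vanishing along Z of f and of its iterated holomorphic derivatives up to
   order k; antiholomorphic derivatives are not constrained. *)
Fixpoint flat (k : nat) (f : V -> C) : Prop :=
  (forall z, Z z -> f z = 0) /\
  if k is k'.+1 then forall j, flat k' (dz j f) else True.

Lemma flat_val k f z : flat k f -> Z z -> f z = 0.
Proof. by case: k => [|k] [f0 _]; exact: f0. Qed.

Lemma flat_dz k j f : flat k.+1 f -> flat k (dz j f).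
Proof. by move=> [_ h]; exact: h. Qed.

Lemma flatW k f : flat k.+1 f -> flat k f.
Proof.
elim: k f => [|k IH] f [f0 fj]; first by split; [exact: f0|].
by split; [exact: f0|move=> j; exact: IH (fj j)].
Qed.

Lemma flat_eq k f g : smooth f -> eq_on U f g -> flat k f -> flat k g.
Proof.
elim: k f g => [|k IH] f g fs fg [f0 fj].
  by split; [move=> z Zz; rewrite -(fg z (ZU Zz)); exact: f0|].
split; first by move=> z Zz; rewrite -(fg z (ZU Zz)); exact: f0.
move=> j; have dj := derivation_dz oU j.
exact: IH (der_smooth dj fs) (der_eq dj fs fg) (fj j).
Qed.

Lemma flat0 k : flat k (fun=> 0).
Proof.
elim: k => [|k IH]; first by [].
split=> [//|j]; apply: flat_eq IH; first exact: smooth_cst.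
by move=> z Uz; rewrite (der_cst (derivation_dz oU j) 0 Uz).
Qed.

Lemma flatD k f g : smooth f -> smooth g -> flat k f -> flat k g ->
  flat k (fun z => f z + g z).
Proof.
elim: k f g => [|k IH] f g fs gs [f0 fj] [g0 gj].
  by split; [move=> z Zz; rewrite (f0 z Zz) (g0 z Zz) addr0|].
split=> [z Zz|j]; first by rewrite (f0 z Zz) (g0 z Zz) addr0.
have dj := derivation_dz oU j.
have fs' := der_smooth dj fs; have gs' := der_smooth dj gs.
apply: (flat_eq (smoothD oU fs' gs') _ (IH _ _ fs' gs' (fj j) (gj j))).
by move=> z Uz; rewrite (derD dj fs gs Uz).
Qed.

Lemma flatM k f g : smooth f -> smooth g -> flat k f ->
  flat k (fun z => f z * g z).
Proof.
elim: k f g => [|k IH] f g fs gs ff.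
  by case: ff => f0 _; split; [move=> z Zz; rewrite (f0 z Zz) mul0r|].
have [f0 fj] := ff; split=> [z Zz|j]; first by rewrite (f0 z Zz) mul0r.
have dj := derivation_dz oU j.
have fs' := der_smooth dj fs; have gs' := der_smooth dj gs.
apply: (flat_eq (smoothD oU (smoothM oU fs' gs) (smoothM oU fs gs')) _
  (flatD (smoothM oU fs' gs) (smoothM oU fs gs')
    (IH _ _ fs' gs (fj j)) (IH _ _ fs gs' (flatW ff)))).
by move=> z Uz; rewrite (derM dj fs gs Uz).
Qed.

Lemma flatMl k f g : smooth f -> smooth g -> flat k f ->
  flat k (fun z => g z * f z).
Proof.
move=> fs gs ff; under eq_fun do rewrite mulrC; exact: flatM.
Qed.

Lemma flatN k f : smooth f -> flat k f -> flat k (fun z => - f z).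
Proof.
move=> fs ff; under eq_fun do rewrite -mulN1r.
exact: (flatMl fs (smooth_cst oU _) ff).
Qed.

Lemma flatB k f g : smooth f -> smooth g -> flat k f -> flat k g ->
  flat k (fun z => f z - g z).
Proof.
by move=> fs gs ff fg; exact: (flatD fs (smoothN oU gs) ff (flatN gs fg)).
Qed.

Lemma flat_sum k (I : Type) (l : seq I) (P : pred I) (F : I -> V -> C) :
  (forall i, smooth (F i)) -> (forall i, P i -> flat k (F i)) ->
  flat k (fun z => \sum_(i <- l | P i) F i z).
Proof.
move=> Fs Ff; elim: l => [|i l IH].
  by under eq_fun do rewrite big_nil; exact: flat0.
under eq_fun do rewrite big_cons.
case: (boolP (P i)) => [/Ff Fi|_]; last exact: IH.
exact: (flatD (Fs i) (smooth_sum oU l P Fs) Fi IH).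
Qed.

(** By the product rule, (dz_j f) g is dz_j (f g) minus f dz_j g. As f is already flat to order [k]
    by induction, so is this difference, and the induction hypothesis applies once more, to dz_j
    f. *)
Lemma flat_cancel k f g : smooth f -> smooth g -> (forall z, Z z -> g z != 0) ->
  flat k (fun z => f z * g z) -> flat k f.
Proof.
move=> + gs gN0.
have f0 h : (forall z, Z z -> h z * g z = 0) -> forall z, Z z -> h z = 0.
  move=> hg z Zz; have /eqP := hg z Zz.
  by rewrite mulf_eq0 (negPf (gN0 z Zz)) orbF => /eqP.
elim: k f => [|k IH] f fs ffg; first by case: ffg => /f0; split.
have ff := IH f fs (flatW ffg); have [fg0 _] := ffg.
split=> [|j]; first exact: f0.
have dj := derivation_dz oU j.
have fs' := der_smooth dj fs; have gs' := der_smooth dj gs.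
have h1 := flatM fs gs' ff.
have h2 := flat_dz j ffg.
have s2 := der_smooth dj (smoothM oU fs gs).
apply: IH; first exact: fs'.
apply: (flat_eq (smoothB oU s2 (smoothM oU fs gs')) _
  (flatB s2 (smoothM oU fs gs') h2 h1)).
by move=> z Uz; rewrite (derM dj fs gs Uz) addrK.
Qed.

End Vanishing.

(** * Congruence of jets modulo the conjugate coordinates *)

Section Congruence.
Variables (R : realType) (m : nat).
Local Notation C := R[i].
Local Notation V := 'cV[C]_m.
Variable U : set V.
Hypotheses (oU : open U) (U0 : U 0).
Implicit Types (f g h : V -> C) (e z : V).
Local Notation smooth := (smooth_on U).
Local Notation Z0 := [set (0 : V)].

Let Z0U : Z0 `<=` U. Proof. by move=> z ->. Qed.

(* Equality of the Taylor coefficients at 0 in z alone up to order k, that is,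
   congruence modulo the conjugate coordinates. *)
Definition cong k f g := flat Z0 k (fun z => f z - g z).

Lemma cong_eq_on k f g : smooth f -> eq_on U f g -> cong k f g.
Proof.
move=> fs fg.
apply: (flat_eq oU Z0U (smooth_cst oU 0) _ (flat0 oU Z0U k)) => z Uz.
by rewrite (fg z Uz) subrr.
Qed.

Lemma cong_refl k f : smooth f -> cong k f f.
Proof. by move=> fs; exact: cong_eq_on. Qed.

Lemma cong_sym k f g : smooth f -> smooth g -> cong k f g -> cong k g f.
Proof.
move=> fs gs fg; apply: (flat_eq oU Z0U (smoothN oU (smoothB oU fs gs)) _
  (flatN oU Z0U (smoothB oU fs gs) fg)) => z Uz.
by rewrite opprB.
Qed.

Lemma cong_trans k f g h : smooth f -> smooth g -> smooth h ->
  cong k f g -> cong k g h -> cong k f h.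
Proof.
move=> fs gs hs fg gh.
have s1 := smoothB oU fs gs; have s2 := smoothB oU gs hs.
apply: (flat_eq oU Z0U (smoothD oU s1 s2) _ (flatD oU Z0U s1 s2 fg gh)) => z Uz.
by rewrite addrA subrK.
Qed.

Lemma congD k f g f' g' : smooth f -> smooth g -> smooth f' -> smooth g' ->
  cong k f f' -> cong k g g' ->
  cong k (fun z => f z + g z) (fun z => f' z + g' z).
Proof.
move=> fs gs fs' gs' ff gg.
have s1 := smoothB oU fs fs'; have s2 := smoothB oU gs gs'.
apply: (flat_eq oU Z0U (smoothD oU s1 s2) _ (flatD oU Z0U s1 s2 ff gg)) => z Uz.
by rewrite opprD addrACA.
Qed.

Lemma congN k f f' : smooth f -> smooth f' -> cong k f f' ->
  cong k (fun z => - f z) (fun z => - f' z).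
Proof.
move=> fs fs' ff; have s1 := smoothB oU fs fs'.
apply: (flat_eq oU Z0U (smoothN oU s1) _ (flatN oU Z0U s1 ff)) => z Uz.
by rewrite opprD.
Qed.

Lemma congM k f g f' g' : smooth f -> smooth g -> smooth f' -> smooth g' ->
  cong k f f' -> cong k g g' ->
  cong k (fun z => f z * g z) (fun z => f' z * g' z).
Proof.
move=> fs gs fs' gs' ff gg.
have s1 := smoothB oU fs fs'; have s2 := smoothB oU gs gs'.
apply: (flat_eq oU Z0U (smoothD oU (smoothM oU s1 gs) (smoothM oU fs' s2)) _
  (flatD oU Z0U (smoothM oU s1 gs) (smoothM oU fs' s2)
    (flatM oU Z0U s1 gs ff) (flatMl oU Z0U s2 fs' gg))) => z Uz.
by rewrite mulrBl mulrBr addrA subrK.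
Qed.

Lemma cong_sum k (I : Type) (l : seq I) (P : pred I) (F G : I -> V -> C) :
  (forall i, smooth (F i)) -> (forall i, smooth (G i)) ->
  (forall i, P i -> cong k (F i) (G i)) ->
  cong k (fun z => \sum_(i <- l | P i) F i z) (fun z => \sum_(i <- l | P i) G i z).
Proof.
move=> Fs Gs FG; have s i := smoothB oU (Fs i) (Gs i).
apply: (flat_eq oU Z0U (smooth_sum oU l P s) _ (flat_sum oU Z0U l s FG)) => z Uz.
by rewrite sumrB.
Qed.

Lemma cong_dz k j f g : smooth f -> smooth g -> cong k.+1 f g ->
  cong k (dz j f) (dz j g).
Proof.
move=> fs gs fg; have dj := derivation_dz oU j.
apply: (flat_eq oU Z0U (der_smooth dj (smoothB oU fs gs)) _ (flat_dz j fg)).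
by move=> z Uz; rewrite (derB oU dj fs gs Uz).
Qed.

Lemma cong_val k f g : cong k f g -> f 0 = g 0.
Proof. by move=> /flat_val/(_ (erefl (0 : V)))/eqP; rewrite subr_eq0 => /eqP. Qed.

Lemma cong_S k f g : smooth f -> smooth g -> f 0 = g 0 ->
  (forall j, cong k (dz j f) (dz j g)) -> cong k.+1 f g.
Proof.
move=> fs gs fg0 fg; split=> [z ->|j]; first by rewrite fg0 subrr.
have dj := derivation_dz oU j.
apply: (flat_eq oU Z0U _ _ (fg j)).
  exact: (smoothB oU (der_smooth dj fs) (der_smooth dj gs)).
by move=> z Uz; rewrite (derB oU dj fs gs Uz).
Qed.

Lemma cong_cst k f : smooth f -> (forall j, eq_on U (dz j f) (fun=> 0)) ->
  cong k f (fun=> f 0).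
Proof.
move=> fs f0; case: k => [|k].
  by split=> // z ->; rewrite subrr.
apply: (cong_S fs (smooth_cst oU _) (erefl _)) => j.
have dj := derivation_dz oU j.
apply: cong_eq_on; first exact: (der_smooth dj fs).
by move=> z Uz; rewrite (f0 j z Uz) (der_cst dj _ Uz).
Qed.

(** Every dz_j of the conjugate of a holomorphic function vanishes identically. *)
Lemma cong_conj_hol k f : hol U f -> cong k (fun z => (f z)^*) (fun=> (f 0)^*).
Proof.
move=> [fs fh]; apply: (@cong_cst k (fun z => (f z)^*)).
  exact: (smoothJ oU fs).
by move=> j z Uz; rewrite (dzJ j fs Uz) (fh j z Uz) conjC0.
Qed.

End Congruence.

Section MatrixValued.
Variables (R : realType) (m : nat).
Local Notation C := R[i].
Local Notation V := 'cV[C]_m.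
Variable U : set V.
Hypotheses (oU : open U) (U0 : U 0).
Local Notation smooth := (smooth_on U).

Definition smooth_mx p q (M : V -> 'M[C]_(p, q)) :=
  forall i j, smooth (fun z => M z i j).

Definition cong_mx k p q (M N : V -> 'M[C]_(p, q)) :=
  forall i j, cong k (fun z => M z i j) (fun z => N z i j).

Definition mxder (D : (V -> C) -> V -> C) p q (M : V -> 'M[C]_(p, q)) z :
    'M[C]_(p, q) :=
  \matrix_(i, j) D (fun z => M z i j) z.

Lemma smooth_mx_cst p q (M : 'M[C]_(p, q)) : smooth_mx (fun=> M).
Proof. by move=> i j; exact: (smooth_cst oU (M i j)). Qed.

Lemma smooth_mx_id : smooth_mx (fun z : V => z).
Proof. by move=> i j; rewrite ord1; exact: smooth_coord. Qed.

Lemma smooth_mxM p q s (M : V -> 'M[C]_(p, q)) (N : V -> 'M[C]_(q, s)) :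
  smooth_mx M -> smooth_mx N -> smooth_mx (fun z => M z *m N z).
Proof.
move=> Ms Ns i j; under eq_fun do rewrite mxE.
exact: (smooth_sum oU _ _ (fun k => smoothM oU (Ms i k) (Ns k j))).
Qed.

Lemma smooth_mxD p q (M N : V -> 'M[C]_(p, q)) :
  smooth_mx M -> smooth_mx N -> smooth_mx (fun z => M z + N z).
Proof.
by move=> Ms Ns i j; under eq_fun do rewrite mxE; exact: (smoothD oU (Ms i j) (Ns i j)).
Qed.

Lemma smooth_mxN p q (M : V -> 'M[C]_(p, q)) :
  smooth_mx M -> smooth_mx (fun z => - M z).
Proof.
by move=> Ms i j; under eq_fun do rewrite mxE; exact: (smoothN oU (Ms i j)).
Qed.

Lemma smooth_mxZ p q (f : V -> C) (M : V -> 'M[C]_(p, q)) :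
  smooth f -> smooth_mx M -> smooth_mx (fun z => f z *: M z).
Proof.
by move=> fs Ms i j; under eq_fun do rewrite mxE; exact: (smoothM oU fs (Ms i j)).
Qed.

Lemma smooth_adjmx p q (M : V -> 'M[C]_(p, q)) :
  smooth_mx M -> smooth_mx (fun z => adjmx (M z)).
Proof.
by move=> Ms i j; under eq_fun do rewrite !mxE; exact: (smoothJ oU (Ms j i)).
Qed.

Section MatrixDerivation.
Variable D : (V -> C) -> V -> C.
Hypothesis dD : derivation U D.

Lemma mxder_cst p q (M : 'M[C]_(p, q)) z : U z -> mxder D (fun=> M) z = 0.
Proof. by move=> Uz; apply/matrixP => i j; rewrite !mxE (der_cst dD _ Uz). Qed.

Lemma mxder_eq p q (M N : V -> 'M[C]_(p, q)) z : smooth_mx M ->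
  (forall z, U z -> M z = N z) -> U z -> mxder D M z = mxder D N z.
Proof.
move=> Ms MN Uz; apply/matrixP => i j; rewrite !mxE.
apply: (der_eq dD (Ms i j) _ Uz) => y Uy.
by rewrite (MN y Uy).
Qed.

Lemma mxderM p q s (M : V -> 'M[C]_(p, q)) (N : V -> 'M[C]_(q, s)) z :
  smooth_mx M -> smooth_mx N -> U z ->
  mxder D (fun z => M z *m N z) z = mxder D M z *m N z + M z *m mxder D N z.
Proof.
move=> Ms Ns Uz; apply/matrixP => i j; rewrite !mxE.
under eq_fun do rewrite mxE.
rewrite (der_sum oU dD _ _ (fun k => smoothM oU (Ms i k) (Ns k j)) Uz).
rewrite -big_split /=; apply: eq_bigr => k _.
by rewrite (derM dD (Ms i k) (Ns k j) Uz) !mxE.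
Qed.

Lemma mxderD p q (M N : V -> 'M[C]_(p, q)) z :
  smooth_mx M -> smooth_mx N -> U z ->
  mxder D (fun z => M z + N z) z = mxder D M z + mxder D N z.
Proof.
move=> Ms Ns Uz; apply/matrixP => i j; rewrite !mxE.
under eq_fun do rewrite mxE.
exact: (derD dD (Ms i j) (Ns i j) Uz).
Qed.

Lemma mxderN p q (M : V -> 'M[C]_(p, q)) z :
  smooth_mx M -> U z -> mxder D (fun z => - M z) z = - mxder D M z.
Proof.
move=> Ms Uz; apply/matrixP => i j; rewrite !mxE.
under eq_fun do rewrite mxE.
exact: (derN oU dD (Ms i j) Uz).
Qed.

Lemma mxderZ p q (f : V -> C) (M : V -> 'M[C]_(p, q)) z :
  smooth f -> smooth_mx M -> U z ->
  mxder D (fun z => f z *: M z) z = D f z *: M z + f z *: mxder D M z.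
Proof.
move=> fs Ms Uz; apply/matrixP => i j; rewrite !mxE.
under eq_fun do rewrite mxE.
exact: (derM dD fs (Ms i j) Uz).
Qed.

End MatrixDerivation.

Lemma cong_mx_refl k p q (M : V -> 'M[C]_(p, q)) : smooth_mx M -> cong_mx k M M.
Proof. by move=> Ms i j; exact: (cong_refl oU U0 k (Ms i j)). Qed.

Lemma cong_mxM k p q s (M M' : V -> 'M[C]_(p, q)) (N N' : V -> 'M[C]_(q, s)) :
  smooth_mx M -> smooth_mx N -> smooth_mx M' -> smooth_mx N' ->
  cong_mx k M M' -> cong_mx k N N' ->
  cong_mx k (fun z => M z *m N z) (fun z => M' z *m N' z).
Proof.
move=> Ms Ns Ms' Ns' MM NN i j.
under eq_fun do rewrite mxE; under [X in cong _ _ X]eq_fun do rewrite mxE.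
apply: (cong_sum oU U0) => l; first exact: (smoothM oU (Ms i l) (Ns l j)).
  exact: (smoothM oU (Ms' i l) (Ns' l j)).
by move=> _; exact: (congM oU U0 (Ms i l) (Ns l j) (Ms' i l) (Ns' l j)).
Qed.

Lemma cong_mxD k p q (M M' N N' : V -> 'M[C]_(p, q)) :
  smooth_mx M -> smooth_mx N -> smooth_mx M' -> smooth_mx N' ->
  cong_mx k M M' -> cong_mx k N N' ->
  cong_mx k (fun z => M z + N z) (fun z => M' z + N' z).
Proof.
move=> Ms Ns Ms' Ns' MM NN i j.
under eq_fun do rewrite mxE; under [X in cong _ _ X]eq_fun do rewrite mxE.
exact: (congD oU U0 (Ms i j) (Ns i j) (Ms' i j) (Ns' i j)).
Qed.

Lemma cong_mxZ k p q (f f' : V -> C) (M M' : V -> 'M[C]_(p, q)) :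
  smooth f -> smooth_mx M -> smooth f' -> smooth_mx M' ->
  cong k f f' -> cong_mx k M M' ->
  cong_mx k (fun z => f z *: M z) (fun z => f' z *: M' z).
Proof.
move=> fs Ms fs' Ms' ff MM i j.
under eq_fun do rewrite mxE; under [X in cong _ _ X]eq_fun do rewrite mxE.
exact: (congM oU U0 fs (Ms i j) fs' (Ms' i j)).
Qed.

End MatrixValued.

(** * The matrix exponential *)

(* Locked because conversion would otherwise unfold the limit in expmx. *)
HB.lock Definition mexp (R : realType) (n : nat) (M : 'M[R[i]]_n) (x : R) :
  'M[R[i]]_n := expmx (x%:C *: M).

Section MatrixExponential.
Variables (R : realType) (n : nat).
Local Notation C := R[i].
Local Notation rRe := (@complex.Re R).
Local Notation rIm := (@complex.Im R).
Implicit Types (M P : 'M[C]_n) (x : R).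

Definition expsum M x : nat -> 'M[C]_n :=
  series (fun k => (k`!%:R : C)^-1 *: (x%:C *: M) ^+ k).

(** The left factor [P] makes the family closed under termwise differentiation, which replaces [P]
    by [P *m M]. *)
Definition expcoef (pr : C -> R) P M i j (k : nat) : R :=
  pr ((P *m M ^+ k) i j) / k`!%:R.

Lemma scalemx_exp (c : C) M k : (c *: M) ^+ k = c ^+ k *: M ^+ k.
Proof.
elim: k => [|k IH]; first by rewrite !expr0 scale1r.
rewrite !exprS IH -[LHS]/((c *: M) *m (c ^+ k *: M ^+ k)).
by rewrite -scalemxAl -scalemxAr scalerA.
Qed.

Lemma norm_mulmx_exp P M : exists K B : R, [/\ 0 <= K, 0 <= B &
  forall k i j, `|(P *m M ^+ k) i j| <= (K * B ^+ k)%:C].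
Proof.
(* The sum of the norms of all entries bounds every entry of [P] and every column sum of [M], which
   is what the induction on the power uses. *)
have bound (N : 'M[C]_n) : exists2 b : R, 0 <= b &
    \sum_(p : 'I_n * 'I_n) `|N p.1 p.2| <= b%:C.
  have /gtC0_real[b b0 bE] : 0 < \sum_(p : 'I_n * 'I_n) `|N p.1 p.2| + 1.
    by rewrite ltr_wpDl// sumr_ge0.
  by exists b; [exact: ltW|rewrite -bE lerDl].
have [K K0 KP] := bound P; have [B B0 BM] := bound M.
exists K, B; split=> //; elim=> [|k IH] i j.
  rewrite !expr0 mulmx1 mulr1; apply: le_trans KP.
  by rewrite (bigD1 (i, j))//= lerDl sumr_ge0.
rewrite exprSr mulmxA mxE (le_trans (ler_norm_sum _ _ _))//.
rewrite exprSr mulrA rmorphM /=.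
apply: (@le_trans _ _ (\sum_l (K * B ^+ k)%:C * `|M l j|)).
  by apply: ler_sum => l _; rewrite normrM ler_wpM2r.
rewrite -mulr_sumr ler_wpM2l//.
  by rewrite lecR mulr_ge0// exprn_ge0.
apply: le_trans BM; rewrite -(pair_bigA _ (fun l k => `|M l k|)) /=.
by apply: ler_sum => l _; rewrite (bigD1 j)//= lerDl sumr_ge0.
Qed.

Lemma pseries_expcoef (pr : C -> R) P M i j x :
  pr =1 rRe \/ pr =1 rIm -> cvgn (pseries (expcoef pr P M i j) x).
Proof.
move=> prE; apply: normed_cvg.
have [K [B [K0 B0 KB]]] := norm_mulmx_exp P M.
have key : cvgn (series (K \*: exp_coeff (B * `|x|))).
  exact/is_cvg_seriesZ/is_cvg_series_exp_coeff.
apply: series_le_cvg key => k /=; first exact: normr_ge0.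
  rewrite /exp_coeff /= /GRing.scale /=.
  by rewrite mulr_ge0// divr_ge0// exprn_ge0// mulr_ge0.
rewrite /expcoef !normrM normfV normrX [`|k`!%:R|]ger0_norm//.
rewrite /exp_coeff /= /GRing.scale /= exprMn.
have : `|pr ((P *m M ^+ k) i j)| <= K * B ^+ k.
  rewrite -lecR; apply: le_trans (KB k i j).
  by case: prE => ->; [exact: ler_norm_Re|exact: ler_norm_Im].
move=> h; rewrite -!mulrA.
rewrite [leRHS](_ : _ = (K * B ^+ k) * (k`!%:R^-1 * `|x| ^+ k)); last by ring.
by rewrite ler_wpM2r// mulr_ge0// ?invr_ge0// exprn_ge0.
Qed.

Lemma pseries_diffs_expcoef (pr : C -> R) P M i j :
  pseries_diffs (expcoef pr P M i j) = expcoef pr (P *m M) M i j.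
Proof.
apply/funext => k; rewrite /pseries_diffs /expcoef exprS mulmxA factS natrM.
by rewrite invfM mulrCA mulVKf// pnatr_eq0.
Qed.

Lemma pseries_expcoefE (pr : C -> R) P M i j x : pr =1 rRe \/ pr =1 rIm ->
  pseries (expcoef pr P M i j) x = fun N => pr ((P *m expsum M x N) i j).
Proof.
move=> prE.
have prD a b : pr (a + b) = pr a + pr b by case: prE => h; rewrite !h ?ReD ?ImD.
have pr0 : pr 0 = 0 by case: prE => ->.
have prZ (c : R) a : pr (c%:C * a) = c * pr a.
  by case: prE => h; rewrite !h ?ReM ?ImM /= mul0r ?subr0 ?addr0.
apply/funext => N; rewrite /pseries /expsum /series /=.
rewrite mulmx_sumr summxE (big_morph pr prD pr0).
apply: eq_bigr => k _; rewrite scalemx_exp scalerA -scalemxAr mxE.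
have -> : (k`!%:R : C)^-1 * x%:C ^+ k = (k`!%:R^-1 * x ^+ k)%:C.
  by rewrite rmorphM fmorphV rmorph_nat rmorphXn.
by rewrite prZ /expcoef; ring.
Qed.

Lemma mexpE M x : mexp M x = expmx (x%:C *: M).
Proof. by rewrite mexp.unlock. Qed.

Lemma cvg_mx_entries (T : Type) (F : set_system T) (FF : Filter F) p q
    (M : T -> 'M[C]_(p, q)) (L : 'M[C]_(p, q)) :
  (forall i j, M t i j @[t --> F] --> L i j) -> M t @[t --> F] --> L.
Proof.
move=> ML; apply/cvg_ballP => e e0.
have h : \forall t \near F, forall i j, `|L i j - M t i j| < e.
  apply: filter_forall => i; apply: filter_forall => j.
  by have /cvgrPdist_lt/(_ _ e0) := ML i j.
by apply: filterS h => t h; split.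
Qed.

Lemma cvg_expsum M x : expsum M x @ \oo --> mexp M x.
Proof.
have cvR i j : rRe (expsum M x N i j) @[N --> \oo] -->
    limn (pseries (expcoef rRe 1%:M M i j) x).
  have := @pseries_expcoef rRe 1%:M M i j x (or_introl (frefl _)).
  rewrite (pseries_expcoefE _ _ _ _ _ (or_introl (frefl _))).
  by under eq_fun do rewrite mul1mx.
have cvI i j : rIm (expsum M x N i j) @[N --> \oo] -->
    limn (pseries (expcoef rIm 1%:M M i j) x).
  have := @pseries_expcoef rIm 1%:M M i j x (or_intror (frefl _)).
  rewrite (pseries_expcoefE _ _ _ _ _ (or_intror (frefl _))).
  by under eq_fun do rewrite mul1mx.
pose L : 'M[C]_n := \matrix_(i, j) (limn (pseries (expcoef rRe 1%:M M i j) x)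
  +i* limn (pseries (expcoef rIm 1%:M M i j) x))%C.
have cL : expsum M x @ \oo --> L.
  apply: cvg_mx_entries => i j; rewrite mxE; apply/cvg_ReIm; split.
    exact: cvR.
  exact: cvI.
by rewrite mexpE /expmx -/(expsum M x) (cvg_lim (@norm_hausdorff _ _) cL).
Qed.

Lemma cvg_sumC (T : Type) (F : set_system T) (FF : Filter F) (I : Type)
    (l : seq I) (f : I -> T -> C) (c : I -> C) :
  (forall i, f i t @[t --> F] --> c i) ->
  \sum_(i <- l) f i t @[t --> F] --> \sum_(i <- l) c i.
Proof.
move=> fc; elim: l => [|i l IH].
  by under eq_fun do rewrite big_nil; rewrite big_nil; exact: cvg_cst.
under eq_fun do rewrite big_cons.
by rewrite big_cons; exact: cvgD (fc i) IH.
Qed.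

Lemma cvg_expsum_entry P M x i j :
  (P *m expsum M x N) i j @[N --> \oo] --> (P *m mexp M x) i j.
Proof.
rewrite mxE; under eq_fun do rewrite mxE.
apply: cvg_sumC => k; apply: cvgM; first exact: cvg_cst.
have kc : {for mexp M x, continuous (fun N : 'M[C]_n => N k j)}.
  exact: coord_continuous.
exact: (continuous_cvg _ kc (@cvg_expsum M x)).
Qed.

(** The real and imaginary parts of each entry are everywhere convergent real power series in [x];
    differentiating them termwise puts [M] in place of the left factor [1%:M]. *)
Lemma is_cder_mexp M x i j :
  is_cder (fun x => mexp M x i j) x ((M *m mexp M x) i j).
Proof.
have key (pr : C -> R) : pr =1 rRe \/ pr =1 rIm ->
    is_derive x (1 : R) (fun x => pr (mexp M x i j)) (pr ((M *m mexp M x) i j)).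
  move=> prE.
  have limE P k l y : limn (pseries (expcoef pr P M k l) y) = pr ((P *m mexp M y) k l).
    apply: (cvg_lim (@Rhausdorff R)); rewrite pseries_expcoefE//.
    have /cvg_ReIm[a b] := @cvg_expsum_entry P M y k l.
    by case: prE => /funext ->.
  have h := @pseries_snd_diffs R (expcoef pr 1%:M M i j) (`|x| + 1) x.
  rewrite !pseries_diffs_expcoef mul1mx in h.
  have {}h := h (@pseries_expcoef pr _ _ _ _ _ prE) (@pseries_expcoef pr _ _ _ _ _ prE)
    (@pseries_expcoef pr _ _ _ _ _ prE).
  have xlt : `|x| < `| `|x| + 1 |.
    by rewrite [ltRHS]ger0_norm ?ltrDl// addr_ge0.
  have {h xlt} := h xlt; rewrite limE.
  rewrite (_ : (fun y : R => limn (pseries (expcoef pr 1%:M M i j) y)) =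
    (fun y => pr (mexp M y i j))) //.
  by apply/funext => y; rewrite limE mul1mx.
by split; apply: key; [left|right].
Qed.

Lemma mexp0 M : mexp M 0 = 1%:M.
Proof.
rewrite mexpE /expmx; apply: lim_near_cst; first exact: norm_hausdorff.
exists 1%N => // -[//|N] _ /=; rewrite /series /= big_nat_recl// big1 => [|k _].
  by rewrite addr0 expr0 fact0 invr1 scale1r.
by rewrite scale0r exprS mul0r scaler0.
Qed.

End MatrixExponential.

Section MatrixExponentialAlgebra.
Variables (R : realType) (n : nat).
Local Notation C := R[i].
Implicit Types (M P Q : 'M[C]_n) (x y t : R).

Definition is_mxcder p q (f : R -> 'M[C]_(p, q)) t (d : 'M[C]_(p, q)) :=
  forall i j, is_cder (fun s => f s i j) t (d i j).

Lemma is_mxcder_cst p q (M : 'M[C]_(p, q)) t : is_mxcder (fun=> M) t 0.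
Proof. by move=> i j; rewrite mxE; exact: is_cder_cst. Qed.

Lemma is_mxcderM p q s (f : R -> 'M[C]_(p, q)) (g : R -> 'M[C]_(q, s)) t d e :
  is_mxcder f t d -> is_mxcder g t e ->
  is_mxcder (fun u => f u *m g u) t (d *m g t + f t *m e).
Proof.
move=> fd ge i j; under eq_fun do rewrite mxE.
rewrite !mxE -big_split /=; apply: is_cder_sum => k _.
exact: is_cderM (fd i k) (ge k j).
Qed.

Lemma is_mxcderZ p q (f : R -> C) (g : R -> 'M[C]_(p, q)) t d e :
  is_cder f t d -> is_mxcder g t e ->
  is_mxcder (fun u => f u *: g u) t (d *: g t + f t *: e).
Proof.
move=> fd ge i j; under eq_fun do rewrite mxE.
rewrite !mxE; exact: is_cderM fd (ge i j).
Qed.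

Lemma is_mxcder_adj p q (f : R -> 'M[C]_(p, q)) t d :
  is_mxcder f t d -> is_mxcder (fun u => adjmx (f u)) t (adjmx d).
Proof.
move=> fd i j; under eq_fun do rewrite !mxE.
rewrite !mxE; exact: is_cderJ (fd j i).
Qed.

Lemma is_cder0_constant (f : R -> C) x : (forall t, is_cder f t 0) -> f x = f 0.
Proof.
move=> f0; case: (lerP 0 x) => x0.
  by apply/esym/is_cder0_cst => // t _.
by apply: is_cder0_cst => [|t _]; [exact: ltW|].
Qed.

Lemma is_mxcder0_constant p q (f : R -> 'M[C]_(p, q)) x :
  (forall t, is_mxcder f t 0) -> f x = f 0.
Proof.
move=> f0; apply/matrixP => i j.
apply: (is_cder0_constant (f := fun s => f s i j)) => t.
by have := f0 t i j; rewrite mxE.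
Qed.

Lemma is_mxcder_mexp M t : is_mxcder (mexp M) t (M *m mexp M t).
Proof. by move=> i j; exact: is_cder_mexp. Qed.

Lemma is_mxcder_comp p q (f : R -> 'M[C]_(p, q)) (s : R -> R) t (s' : R) d :
  is_mxcder f (s t) d -> is_derive t 1 s s' ->
  is_mxcder (fun u => f (s u)) t (s'%:C *: d).
Proof.
move=> fd ss i j; rewrite mxE.
exact: (is_cder_comp_real (fd i j) ss).
Qed.

Lemma is_mxcder_mexpN M t :
  is_mxcder (fun u => mexp M (- u)) t (- (M *m mexp M (- t))).
Proof.
have h : is_derive t (1 : R) (fun u : R => - u) (-1) by exact: is_deriveNid.
have := is_mxcder_comp (is_mxcder_mexp M (- t)) h.
by rewrite rmorphN scaleN1r.
Qed.

Lemma expsum_comm P M x N : P *m M = M *m P ->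
  P *m expsum M x N = expsum M x N *m P.
Proof.
move=> PM; rewrite /expsum /series /= mulmx_sumr mulmx_suml.
apply: eq_bigr => k _.
rewrite scalemx_exp -!scalemxAr -!scalemxAl; congr (_ *: (_ *: _)).
elim: k => [|k IH]; first by rewrite expr0 mulmx1 mul1mx.
rewrite exprS -[M * M ^+ k]/(M *m M ^+ k).
by rewrite (mulmxA P) PM -(mulmxA M P) IH mulmxA.
Qed.

(** [P] commutes with every partial sum of the series, and the entries converge. *)
Lemma mexp_commute P M x : P *m M = M *m P -> P *m mexp M x = mexp M x *m P.
Proof.
move=> PM; apply/matrixP => i j.
have h1 := @cvg_expsum_entry R n P M x i j.
have h2 : (expsum M x N *m P) i j @[N --> \oo] --> (mexp M x *m P) i j.
  rewrite mxE; under eq_fun do rewrite mxE.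
  apply: cvg_sumC => k; apply: cvgM; last exact: cvg_cst.
  have := @cvg_expsum_entry R n 1%:M M x i k.
  by under eq_fun do rewrite mul1mx; rewrite mul1mx.
have E : (fun N => (P *m expsum M x N) i j) =
    (fun N => (expsum M x N *m P) i j).
  by apply/funext => N; rewrite (expsum_comm x N PM).
rewrite E in h1.
exact: (cvg_unique (@norm_hausdorff _ _) h1 h2).
Qed.

Lemma mexp_comm M x : M *m mexp M x = mexp M x *m M.
Proof. exact: mexp_commute. Qed.

(** The derivative of the product vanishes, so the product keeps its value at [x] = 0. The addition
    formula and the adjoint formula below rest on the same device. *)
Lemma mexpNK M x : mexp M (- x) *m mexp M x = 1%:M.
Proof.
rewrite (@is_mxcder0_constant _ _ (fun x => mexp M (- x) *m mexp M x)).
  by rewrite oppr0 mexp0 mulmx1.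
move=> t.
have := is_mxcderM (is_mxcder_mexpN M t) (is_mxcder_mexp M t).
by rewrite mulNmx (mexp_comm M (- t)) mulmxA addNr; exact.
Qed.

Lemma mexpKN M x : mexp M x *m mexp M (- x) = 1%:M.
Proof. by rewrite -{1}[x]opprK mexpNK. Qed.

Lemma mexpD M x y : mexp M (x + y) = mexp M x *m mexp M y.
Proof.
have E : mexp M (- x) *m mexp M (x + y) = mexp M y.
  rewrite (@is_mxcder0_constant _ _ (fun x => mexp M (- x) *m mexp M (x + y))).
    by rewrite oppr0 mexp0 mul1mx add0r.
  move=> t; have h : is_derive t (1 : R) (fun u : R => u + y) 1.
    rewrite -[X in is_derive _ _ _ X]addr0.
    exact: (is_deriveD (is_derive_id t (1 : R)) (is_derive_cst y t (1 : R))).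
  have := is_mxcderM (is_mxcder_mexpN M t)
    (@is_mxcder_comp _ _ (mexp M) (fun u => u + y) t 1 _
      (is_mxcder_mexp M (t + y)) h).
  by rewrite scale1r mulNmx (mexp_comm M (- t)) mulmxA addNr; exact.
by rewrite -E mulmxA mexpKN mul1mx.
Qed.

Lemma adjmxM p q s (A : 'M[C]_(p, q)) (B : 'M[C]_(q, s)) :
  adjmx (A *m B) = adjmx B *m adjmx A.
Proof. by rewrite /adjmx trmx_mul map_mxM. Qed.

Lemma adjmxN p q (A : 'M[C]_(p, q)) : adjmx (- A) = - adjmx A.
Proof. by apply/matrixP => i j; rewrite !mxE rmorphN. Qed.

Lemma adjmx1 : adjmx (1%:M : 'M[C]_n) = 1%:M.
Proof. by rewrite /adjmx trmx1 map_mx1. Qed.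

(** The hypothesis says that [M] is self-adjoint with respect to [P]; then adj (exp (- x M)) P exp
    (x M) is constant in [x]. *)
Lemma adjmx_mexp M P x : adjmx M *m P = P *m M ->
  adjmx (mexp M x) *m P = P *m mexp M x.
Proof.
move=> MP.
have E : adjmx (mexp M (- x)) *m P *m mexp M x = P.
  rewrite (@is_mxcder0_constant _ _ (fun x => adjmx (mexp M (- x)) *m P *m mexp M x)).
    by rewrite oppr0 mexp0 adjmx1 mul1mx mulmx1.
  move=> t.
  have := is_mxcderM (is_mxcderM (is_mxcder_adj (is_mxcder_mexpN M t))
    (is_mxcder_cst P t)) (is_mxcder_mexp M t).
  rewrite mulmx0 addr0 adjmxN adjmxM !mulNmx.
  rewrite -!mulmxA (mulmxA P M) -MP -!mulmxA addNr; exact.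
by rewrite -[in LHS]E !mulmxA -adjmxM mexpNK adjmx1 mul1mx.
Qed.

End MatrixExponentialAlgebra.

Section ExponentialOfAFunction.
Variables (R : realType) (m n : nat).
Local Notation C := R[i].
Local Notation V := 'cV[C]_m.
Variable U : set V.
Hypothesis oU : open U.
Variables (M : 'M[C]_n) (F : V -> R).
Local Notation FC := (fun z => (F z)%:C).
Hypothesis Fs : smooth_on U FC.

Lemma is_cder_mexp_fun e z i j : U z ->
  is_cder (fun t => mexp M (F (z + t%:C *: e)) i j) 0
    (rderiv e FC z * (M *m mexp M (F z)) i j).
Proof.
move=> Uz; have [/= a b] := is_cder_smooth e Fs Uz.
(* As F is real-valued, its derivative is real, and the chain rule with a real inner function
   applies. *)
have /= ImE : 0 = complex.Im (rderiv e FC z) :> R.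
  apply: etrans (@derive_val _ _ _ _ _ _ _ b).
  by rewrite (@derive_val _ _ _ _ _ _ _ (is_derive_cst (0 : R) (0 : R) (1 : R))).
have -> : rderiv e FC z = (complex.Re (rderiv e FC z))%:C.
  by apply: complexP; rewrite //= -ImE.
have := @is_cder_comp_real R (fun x => mexp M x i j)
  (fun t => F (z + t%:C *: e)) 0 _ _ _ a.
by rewrite scale0r addr0; apply; exact: is_cder_mexp.
Qed.

(** A derivative of an entry is a derivative of F times a linear combination of entries, so the
    order of differentiability is raised for all entries at once. *)
Lemma smooth_mexp : smooth_mx U (fun z => mexp M (F z)).
Proof.
move=> i j k; elim: k i j => [|k IH] i j.
  split; [move=> z Uz|by []].
  have [a _] := (continuous_ReIm _ _).1 (smooth_continuous Fs Uz).
  have b := is_cder_continuous (is_cder_mexp M (F z) i j).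
  exact: (continuous_comp a b).
apply: (@Ck_S _ _ _ oU k _ (fun e z => rderiv e FC z * (M *m mexp M (F z)) i j)).
- move=> z Uz.
  have [a _] := (continuous_ReIm _ _).1 (smooth_continuous Fs Uz).
  have b := is_cder_continuous (is_cder_mexp M (F z) i j).
  exact: (continuous_comp a b).
- by move=> z e Uz; exact: is_cder_mexp_fun.
- move=> e; apply: (CkM oU (smooth_rderiv e Fs k)).
  under eq_fun do rewrite mxE.
  elim: (index_enum _) => [|l r IHr].
    by under eq_fun do rewrite big_nil; exact: (Ck_cst oU).
  under eq_fun do rewrite big_cons.
  exact: (CkD oU (CkM oU (Ck_cst oU k (M i l)) (IH l j)) IHr).
Qed.

Lemma mxder_mexp_rderiv e z : U z ->
  mxder (rderiv e) (fun z => mexp M (F z)) z =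
  rderiv e FC z *: (M *m mexp M (F z)).
Proof.
move=> Uz; apply/matrixP => i j; rewrite !mxE.
by apply: is_cder_rderiv; have := is_cder_mexp_fun e i j Uz; rewrite mxE.
Qed.

Lemma mxder_mexp_lin (c1 c2 : C) e1 e2 z : U z ->
  mxder (fun f z => c1 * rderiv e1 f z + c2 * rderiv e2 f z)
    (fun z => mexp M (F z)) z =
  (c1 * rderiv e1 FC z + c2 * rderiv e2 FC z) *: (M *m mexp M (F z)).
Proof.
move=> Uz; rewrite scalerDl -!scalerA -!mxder_mexp_rderiv//.
by apply/matrixP => i j; rewrite !mxE.
Qed.

Lemma mxder_mexp_dz j z : U z ->
  mxder (dz j) (fun z => mexp M (F z)) z = dz j FC z *: (M *m mexp M (F z)).
Proof. by rewrite dz_lin; exact: mxder_mexp_lin. Qed.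

Lemma mxder_mexp_dzbar j z : U z ->
  mxder (dzbar j) (fun z => mexp M (F z)) z =
  dzbar j FC z *: (M *m mexp M (F z)).
Proof. by rewrite dzbar_lin; exact: mxder_mexp_lin. Qed.

End ExponentialOfAFunction.

(** * Identity principle for holomorphic functions *)

Section MaximumPrinciple.
Variable R : realType.
Local Notation C := R[i].
Local Notation rRe := (@complex.Re R).
Local Notation rIm := (@complex.Im R).
Implicit Types (x y d t : C) (g h : C -> C) (W : set C).

Definition normsq x : R := rRe x ^+ 2 + rIm x ^+ 2.

Lemma normsqE x : normsq x = rRe (x * x^*).
Proof. by rewrite /normsq !ReImE; ring. Qed.

Lemma normsqM x y : normsq (x * y) = normsq x * normsq y.
Proof. by rewrite /normsq !ReImE; ring. Qed.

Lemma normsq_ge0 x : 0 <= normsq x.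
Proof. by rewrite addr_ge0// sqr_ge0. Qed.

Lemma normsq_eq0 x : (normsq x == 0) = (x == 0).
Proof.
rewrite paddr_eq0 ?sqr_ge0// !expf_eq0 /=.
by rewrite eq_complex.
Qed.

Lemma normsqV x : normsq x^-1 = (normsq x)^-1.
Proof.
have [->|x0] := eqVneq x 0; first by rewrite invr0 /normsq /= expr0n addr0 invr0.
have n0 : normsq x != 0 by rewrite normsq_eq0.
apply: (mulfI n0); rewrite -normsqM !mulfV//.
by rewrite /normsq /= expr0n expr1n addr0.
Qed.

Lemma normsqX x k : normsq (x ^+ k) = normsq x ^+ k.
Proof.
elim: k => [|k IH]; last by rewrite !exprS normsqM IH.
by rewrite !expr0 /normsq /= expr0n expr1n addr0.
Qed.

Lemma complex_invE x : x^-1 = x^* * ((normsq x)^-1)%:C.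
Proof.
have [->|x0] := eqVneq x 0; first by rewrite invr0 conjC0 mul0r.
apply: (mulfI x0); rewrite mulfV// mulrA.
have -> : x * x^* = (normsq x)%:C.
  by apply: complexP; rewrite /normsq !ReImE /=; ring.
by rewrite -rmorphM mulfV ?normsq_eq0.
Qed.

(** A derivative exists because the inverse of g is its conjugate divided by the real function
    |g|^2; its value is then forced by differentiating the constant product of g and its inverse. *)
Lemma is_cderV (g : R -> C) (t : R) d : is_cder g t d -> g t != 0 ->
  is_cder (fun s => (g s)^-1) t (- d / g t ^+ 2).
Proof.
move=> gd g0.
have [e ge] : exists e, is_cder (fun s => (g s)^-1) t e.
  have [a b] := gd.
  have n0 : normsq (g t) != 0 by rewrite normsq_eq0.
  have nd : derivable (fun s => normsq (g s)) t (1 : R).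
    have := is_deriveD (is_deriveX 2 a) (is_deriveX 2 b).
    by move=> [].
  have nV : is_derive t (1 : R) (fun s => (normsq (g s))^-1)
      (derive (fun s => (normsq (g s))^-1) t (1 : R)).
    exact/derivableP/derivableV.
  have h : is_cder (fun s => ((normsq (g s))^-1)%:C) t
      (derive (fun s => (normsq (g s))^-1) t (1 : R))%:C.
    by split; [exact: nV|exact: is_derive_cst].
  eexists; under eq_fun do rewrite complex_invE.
  exact: (is_cderM (is_cderJ gd) h).
apply: (is_cder_eq ge).
have h1 := is_cderM gd ge.
have h2 : is_cder (fun s => g s * (g s)^-1) t 0.
  apply: (near_eq_is_cder _ (is_cder_cst 1 t)).
  have gc := is_cder_continuous gd.
  have : \forall s \near t, g s != 0.
    have gn : 0 < `|g t| by rewrite normr_gt0.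
    have /cvgrPdist_lt/(_ _ gn) := gc; apply: filterS => s.
    by apply: contraTneq => ->; rewrite subr0 ltxx.
  by apply: filterS => s s0; rewrite mulfV.
have E := is_cder_unique h1 h2.
apply: (mulfI g0).
have -> : g t * e = - (d * (g t)^-1) by apply/eqP; rewrite -addr_eq0 addrC E.
by field.
Qed.

(** At a maximum [dp 0] = 0; if [k] were positive, [dp] would be positive just to the right of 0,
    and by the mean value theorem p would exceed [p 0] there. *)
Lemma second_derivative_le0 (p dp : R -> R) (k : R) :
  (\forall s \near (0 : R), is_derive s (1 : R) p (dp s)) ->
  is_derive (0 : R) (1 : R) dp k ->
  (\forall s \near (0 : R), p s <= p 0) -> k <= 0.
Proof.
move=> pd dpk pmax; rewrite leNgt; apply/negP => k0.
have [g [gE gc g0]] := (is_derive1_caratheodory _ _ _).1 dpk.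
have gpos : \forall s \near (0 : R), 0 < g s.
  have /cvgrPdist_lt/(_ _ k0) := gc; rewrite g0; apply: filterS => s.
  by rewrite ltr_norml => /andP[_ h]; lra.
have : \forall s \near (0 : R),
    [/\ is_derive s (1 : R) p (dp s), p s <= p 0 & 0 < g s].
  near=> s; split; by near: s.
move=> /nbhs_ballP[r /= r0 rP].
have rP' s : `|s| < r -> [/\ is_derive s (1 : R) p (dp s), p s <= p 0 & 0 < g s].
  by move=> sr; apply: rP; rewrite -ball_normE /ball_ /= sub0r normrN.
have dp0 : dp 0 = 0.
  have h : is_derive (0 : R) (1 : R) p 0.
    apply: (@derive1_at_max R p (- r) r 0).
    - by rewrite ge0_cp// ltW.
    - move=> s; rewrite in_itv /= -ltr_norml => /rP'[h _ _].
      by case: h => h _; exact: h.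
    - by rewrite in_itv /= oppr_lt0 r0.
    - by move=> s; rewrite in_itv /= -ltr_norml => /rP'[_ h _].
  have r00 : `|0 : R| < r by rewrite normr0.
  have [h' _ _] := rP' 0 r00.
  exact: etrans (esym (@derive_val _ _ _ _ _ _ _ h')) (@derive_val _ _ _ _ _ _ _ h).
have r20 : 0 < r / 2 by rewrite divr_gt0.
have rr : r / 2 < r by rewrite ltr_pdivrMr// ltr_pMr// ltr1n.
have inr s : s \in `[0, r / 2] -> `|s| < r.
  by rewrite in_itv /= => /andP[s0 sr]; rewrite ger0_norm// (le_lt_trans sr).
have MV := @MVT R p dp 0 (r / 2) r20.
have h1 : forall s : R, s \in `]0, r / 2[ -> is_derive s 1 p (dp s).
  by move=> s /subset_itv_oo_cc/inr/rP'[].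
have h2 : {within `[0, r / 2], continuous p}.
  apply: continuous_in_subspaceT => s /set_mem /inr/rP'[h _ _].
  exact: is_derive_continuous h.
have [c cin] := MV h1 h2.
have [_ _ gc0] := rP' _ (inr _ (subset_itv_oo_cc cin)).
have dpc : dp c = g c * c by have := gE c; rewrite dp0 !subr0.
have c0 : 0 < c by move: cin; rewrite in_itv /= => /andP[].
have [_ pm _] : [/\ is_derive (r / 2) (1 : R) p (dp (r / 2)),
    p (r / 2) <= p 0 & 0 < g (r / 2)].
  by apply: rP'; rewrite ger0_norm// ltW.
rewrite subr0 => E.
have : 0 < p (r / 2) - p 0 by rewrite E dpc !mulr_gt0.
by rewrite subr_gt0 ltNge pm.
Unshelve. all: by end_near. Qed.

End MaximumPrinciple.

Section ComplexPlane.
Variable R : realType.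
Local Notation C := R[i].
Local Notation rRe := (@complex.Re R).
Local Notation rIm := (@complex.Im R).
Implicit Types (d t : C) (g h : C -> C) (W : set C).

Definition complex_derivative W g g' := forall t, W t -> forall d,
  is_cder (fun s => g (t + s%:C * d)) 0 (d * g' t).

Definition twice_holomorphic W g := exists g' g'',
  complex_derivative W g g' /\ complex_derivative W g' g''.

Lemma complex_derivative_line W g g' t d s : complex_derivative W g g' ->
  W (t + s%:C * d) ->
  is_cder (fun u => g (t + u%:C * d)) s (d * g' (t + s%:C * d)).
Proof.
move=> gg Wt; rewrite -[X in is_cder _ X]addr0.
apply/(is_cder_shift (fun u => g (t + u%:C * d))).
under eq_fun do rewrite rmorphD mulrDl addrA.
exact: gg.
Qed.

Lemma complex_derivativeM W g g' h h' :
  complex_derivative W g g' -> complex_derivative W h h' ->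
  complex_derivative W (fun t => g t * h t) (fun t => g' t * h t + g t * h' t).
Proof.
move=> gg hh t Wt d; have := is_cderM (gg t Wt d) (hh t Wt d).
by rewrite mul0r addr0 => /is_cder_eq; apply; ring.
Qed.

Lemma complex_derivativeD W g g' h h' :
  complex_derivative W g g' -> complex_derivative W h h' ->
  complex_derivative W (fun t => g t + h t) (fun t => g' t + h' t).
Proof.
move=> gg hh t Wt d; have := is_cderD (gg t Wt d) (hh t Wt d).
by move/is_cder_eq; apply; ring.
Qed.

Lemma complex_derivativeV W : (forall t, W t -> t != 0) ->
  complex_derivative W (fun t => t^-1) (fun t => - (t^-1 * t^-1)).
Proof.
move=> W0 t Wt d.
have h : is_cder (fun s : R => t + s%:C * d) 0 d.
  have := is_cderD (is_cder_cst t 0) (is_cderM (is_cder_id 0) (is_cder_cst d 0)).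
  by move/is_cder_eq; apply; rewrite mulr0 addr0 mul1r add0r.
have := is_cderV h; rewrite mul0r addr0 => /(_ (W0 t Wt)).
by move/is_cder_eq; apply; rewrite expr2 invfM mulNr mulrN.
Qed.

Lemma complex_derivativeN W g g' : complex_derivative W g g' ->
  complex_derivative W (fun t => - g t) (fun t => - g' t).
Proof.
move=> gg t Wt d; have := is_cderN (gg t Wt d).
by move/is_cder_eq; apply; rewrite mulrN.
Qed.

Lemma twice_holomorphicM W g h : twice_holomorphic W g ->
  twice_holomorphic W h -> twice_holomorphic W (fun t => g t * h t).
Proof.
move=> [g1 [g2 [G1 G2]]] [h1 [h2 [H1 H2]]].
exists (fun t => g1 t * h t + g t * h1 t).
exists (fun t => (g2 t * h t + g1 t * h1 t) + (g1 t * h1 t + g t * h2 t)).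
split; first exact: complex_derivativeM G1 H1.
exact: complex_derivativeD (complex_derivativeM G2 H1) (complex_derivativeM G1 H2).
Qed.

Lemma twice_holomorphicVX W k : (forall t, W t -> t != 0) ->
  twice_holomorphic W (fun t => t^-1 ^+ k).
Proof.
move=> W0; have V1 := complex_derivativeV W0.
have HV : twice_holomorphic W (fun t => t^-1).
  exists (fun t => - (t^-1 * t^-1)).
  exists (fun t => - (- (t^-1 * t^-1) * t^-1 + t^-1 * - (t^-1 * t^-1))).
  split; first exact: V1.
  exact: complex_derivativeN (complex_derivativeM V1 V1).
elim: k => [|k IH].
  exists (fun=> 0), (fun=> 0).
  split=> t Wt d; rewrite mulr0; last exact: is_cder_cst.
  under eq_fun do rewrite expr0; exact: is_cder_cst.
under eq_fun do rewrite exprS; exact: twice_holomorphicM.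
Qed.

(* |G|^2 + eta |t|^2 has Laplacian 4 (|G'|^2 + eta) > 0. *)
Lemma no_interior_max W g (eta : R) t : twice_holomorphic W g -> 0 < eta ->
  (forall d, \forall s \near (0 : R), W (t + s%:C * d)) ->
  (forall d, \forall s \near (0 : R),
    normsq (g (t + s%:C * d)) + eta * normsq (t + s%:C * d)
      <= normsq (g t) + eta * normsq t) -> False.
Proof.
move=> [g1 [g2 [G1 G2]]] eta0 tW tmax.
have Wt : W t by have := nbhs_singleton (tW 0); rewrite mulr0 addr0.
(* The second derivative in the direction [d]; in [K 1 + K 'i] the terms that contain [g2]
   cancel. *)
pose K d := rRe (d * (d * g2 t) * (g t)^* + d * g1 t * (d * g1 t)^*
  + (d * g1 t * (d * g1 t)^* + g t * (d * (d * g2 t))^*)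
  + eta%:C * (d * d^* + d * d^*)).
have K0 d : K d <= 0.
  pose p s := g (t + s%:C * d) * (g (t + s%:C * d))^* +
    eta%:C * ((t + s%:C * d) * (t + s%:C * d)^*).
  pose p' s := (d * g1 (t + s%:C * d)) * (g (t + s%:C * d))^*
    + g (t + s%:C * d) * (d * g1 (t + s%:C * d))^*
    + eta%:C * (d * (t + s%:C * d)^* + (t + s%:C * d) * d^*).
  have lin s : is_cder (fun s : R => t + s%:C * d) s d.
    have := is_cderD (is_cder_cst t s) (is_cderM (is_cder_id s) (is_cder_cst d s)).
    by move/is_cder_eq; apply; rewrite mulr0 addr0 mul1r add0r.
  have etaM f s e : is_cder f s e -> is_cder (fun s => eta%:C * f s) s (eta%:C * e).
    move=> fe; have := is_cderM (is_cder_cst eta%:C s) fe.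
    by move/is_cder_eq; apply; rewrite mul0r add0r.
  have pE s : rRe (p s) = normsq (g (t + s%:C * d)) + eta * normsq (t + s%:C * d).
    by rewrite /p ReD -normsqE ReM /= mul0r subr0 -normsqE.
  apply: (@second_derivative_le0 R (fun s => rRe (p s)) (fun s => rRe (p' s))).
  - apply: filterS (tW d) => s Ws.
    have a := complex_derivative_line G1 Ws.
    have [+ _] := is_cderD (is_cderM a (is_cderJ a))
      (etaM _ _ _ (is_cderM (lin s) (is_cderJ (lin s)))).
    exact.
  - have a := G1 t Wt d.
    have dM f e : is_cder f 0 e -> is_cder (fun s => d * f s) 0 (d * e).
      move=> fe; have := is_cderM (is_cder_cst d 0) fe.
      by move/is_cder_eq; apply; rewrite mul0r add0r.
    have b := dM _ _ (G2 t Wt d).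
    have l := is_cderD (dM _ _ (is_cderJ (lin 0))) (is_cderM (lin 0) (is_cder_cst d^* 0)).
    have := is_cderD (is_cderD (is_cderM b (is_cderJ a)) (is_cderM a (is_cderJ b)))
      (etaM _ _ _ l).
    rewrite mul0r addr0 mulr0 addr0.
    by move=> [+ _]; rewrite /K.
  - apply: filterS (tmax d) => s.
    by rewrite !pE mul0r addr0.
have := lerD (K0 1) (K0 'i).
rewrite addr0 leNgt => /negP; apply.
have -> : K 1 + K 'i = 4 * normsq (g1 t) + 4 * eta.
  by rewrite /K /normsq !ReImE /=; ring.
by rewrite ltr_wpDl ?mulr_ge0 ?normsq_ge0 ?mulr_gt0.
Qed.

End ComplexPlane.

(** * Vanishing of holomorphic functions that are flat at 0 *)

Section UniqueContinuation.
Variable R : realType.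
Local Notation C := R[i].
Local Notation rRe := (@complex.Re R).
Local Notation rIm := (@complex.Im R).

(** A square rather than a disc, as a product of two segments is compact. It has 1 in its interior,
    and |t|^2 is at least 4 on its boundary. *)
Definition square (t : C) := `|rRe t| <= 2 /\ `|rIm t| <= 2.

Lemma continuous_normsq (T : topologicalType) (g : T -> C) (x : T) :
  {for x, continuous g} -> {for x, continuous (fun y => normsq (g y))}.
Proof.
move=> gx; have [a b] := (continuous_ReIm g x).1 gx.
apply: (eq_continuous_at _ (continuousD (continuousM a a) (continuousM b b))).
by move=> y /=; rewrite /normsq !expr2.
Qed.

Lemma continuous_normsq_id (t : C) : {for t, continuous (@normsq R)}.
Proof. by apply: (@continuous_normsq C id); exact: cvg_id. Qed.

Lemma square_max (P : C -> R) : (forall t, square t -> {for t, continuous P}) ->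
  exists2 t0, square t0 & forall t, square t -> P t <= P t0.
Proof.
move=> Pc; pose iota (p : R * R) : C := (p.1 +i* p.2)%C.
pose A := (`[(-2), 2]%classic `*` `[(-2), 2]%classic : set (R * R)).
have AP p : A p <-> square (iota p).
  by rewrite /A /square /= !in_itv /= !ler_norml.
have iotac p : {for p, continuous iota}.
  by apply/continuous_ReIm; split; [exact: cvg_fst|exact: cvg_snd].
have [|||p /set_mem/AP Ap pmax] := @compact_EVT_max _ R (P \o iota) A.
- by exists (0, 0); apply/AP; rewrite /square /= normr0.
- by apply: compact_setX; exact: segment_compact.
- apply: continuous_in_subspaceT => p /set_mem/AP Sp.
  exact: (continuous_comp (iotac p) (Pc _ Sp)).
exists (iota p) => // t St.
have -> : t = iota (rRe t, rIm t) by case: t St.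
by apply: pmax; apply/mem_set/AP; case: t St.
Qed.

Lemma bounded_on_square (g : C -> C) :
  (forall t, square t -> {for t, continuous g}) ->
  exists2 K : R, 0 <= K & forall t, square t -> normsq (g t) <= K.
Proof.
move=> gc; have [t0 _ tmax] := square_max (fun t St => continuous_normsq (gc t St)).
by exists (normsq (g t0)); [exact: normsq_ge0|exact: tmax].
Qed.

Variable m : nat.
Local Notation V := 'cV[C]_m.
Variable U : set V.
Hypothesis oU : open U.
Variable z : V.
Hypothesis zU : forall t, square t -> U (t *: z).

Lemma rderiv_hol f e y : hol U f -> U y -> rderiv e f y = \sum_j e j 0 * dz j f y.
Proof.
move=> [fs fh] Uy; rewrite (rderivE _ oU (smooth_C1 fs) Uy) /cdiff.
by apply: eq_bigr => j _; rewrite (fh j y Uy) mulr0 addr0.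
Qed.

Lemma hol_rderiv f e : hol U f -> hol U (rderiv e f).
Proof.
move=> fh; apply: (@hol_eq _ _ _ oU (fun y => \sum_j e j 0 * dz j f y)).
  by move=> y Uy; rewrite (rderiv_hol _ fh Uy).
apply: (hol_sum oU) => j.
exact: (holM oU (hol_cst oU _) (hol_dz oU j fh)).
Qed.

Lemma complex_derivative_hol f : hol U f ->
  complex_derivative [set t | U (t *: z)] (fun t => f (t *: z))
    (fun t => rderiv z f (t *: z)).
Proof.
move=> fh t Ut d.
have := is_cder_smooth (d *: z) fh.1 Ut.
rewrite (rderiv_hol _ fh Ut) (rderiv_hol _ fh Ut).
have -> : \sum_j (d *: z) j 0 * dz j f (t *: z) = d * \sum_j z j 0 * dz j f (t *: z).
  by rewrite mulr_sumr; apply: eq_bigr => j _; rewrite mxE mulrA.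
by under eq_fun do rewrite scalerA -scalerDl.
Qed.

Lemma flat_rderiv k f e : U 0 -> hol U f -> flat [set 0] k.+1 f ->
  flat [set 0] k (rderiv e f).
Proof.
move=> U0 fh ff; have Z0U : [set 0] `<=` U by move=> y ->.
have ds j := der_smooth (derivation_dz oU j) fh.1.
have s j := smoothM oU (smooth_cst oU (e j 0)) (ds j).
apply: (flat_eq oU Z0U (smooth_sum oU (index_enum 'I_m) predT s)).
  by move=> y Uy; rewrite (rderiv_hol _ fh Uy).
apply: (flat_sum oU Z0U _ s) => j _.
exact: (flatMl oU Z0U (ds j) (smooth_cst oU _) (flat_dz j ff)).
Qed.

Lemma continuous_ray f t : hol U f -> square t ->
  {for t, continuous (fun t : C => f (t *: z))}.
Proof.
move=> fh St.
have fc := smooth_continuous fh.1 (zU St).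
have zc : {for t, continuous (fun t : C => t *: z)}.
  by have := @continuousZr_tmp _ _ _ (fun t : C => t) z t (@cvg_id _ (nbhs t)).
exact: (continuous_comp zc fc).
Qed.

Lemma square_scale (s : R) t : 0 <= s <= 1 -> square t -> square (s%:C * t).
Proof.
move=> /andP[s0 s1] [a b].
rewrite /square ReM ImM /= !mul0r subr0 addr0 !normrM !(ger0_norm s0).
have := ler_pM s0 (normr_ge0 _) s1 a; have := ler_pM s0 (normr_ge0 _) s1 b.
by rewrite mul1r.
Qed.

(** The derivative in the direction [z] is flat to one order less, and the mean value theorem on the
    segment from 0 to [t] gains a factor |t|^2. It is applied to the real and the imaginary part
    separately, whence the factor 2 in [step]. *)
Lemma flat_bound k f : U 0 -> hol U f -> flat [set 0] k f ->
  exists2 K : R, 0 <= K &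
    forall t, square t -> normsq (f (t *: z)) <= K * normsq t ^+ k.+1.
Proof.
move=> U0.
have step j g : hol U g -> g 0 = 0 ->
    (exists2 K : R, 0 <= K &
      forall t, square t -> normsq (rderiv z g (t *: z)) <= K * normsq t ^+ j) ->
    exists2 K : R, 0 <= K &
      forall t, square t -> normsq (g (t *: z)) <= K * normsq t ^+ j.+1.
  move=> gh g0 [K K0 KP]; exists (2 * K) => [|t St]; first by rewrite mulr_ge0.
  have der (s : R) : s \in `[0, 1] -> is_cder (fun s : R => g ((s%:C * t) *: z)) s
      (t * rderiv z g ((s%:C * t) *: z)).
    rewrite in_itv /= => s01; have := zU (square_scale s01 St).
    rewrite -[s%:C * t]add0r => Us.
    have := complex_derivative_line (complex_derivative_hol gh) Us.
    by under eq_fun do rewrite add0r.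
  have bound (s : R) : s \in `[0, 1] ->
      normsq (t * rderiv z g ((s%:C * t) *: z)) <= K * normsq t ^+ j.+1.
    rewrite in_itv /= => s01; rewrite normsqM exprS mulrCA.
    rewrite ler_wpM2l ?normsq_ge0//.
    apply: le_trans (KP _ (square_scale s01 St)) _.
    rewrite ler_wpM2l// lerXn2r ?nnegrE ?normsq_ge0//.
    rewrite normsqM ler_piMl ?normsq_ge0// /normsq /= expr0n addr0.
    by case/andP: s01 => s0 s1; rewrite exprn_ile1.
  have MV (pr : C -> R) : pr =1 rRe \/ pr =1 rIm ->
      pr (g (t *: z)) ^+ 2 <= K * normsq t ^+ j.+1.
    move=> prE.
    have [s /der/[dup] h|c cin] := @mean_value R (fun s : R => pr (g ((s%:C * t) *: z)))
      (fun s => pr (t * rderiv z g ((s%:C * t) *: z))) 0 1 ler01.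
      move=> _; case: prE => prE; rewrite prE; under eq_fun do rewrite prE.
        by case: h.
      by case: h.
    rewrite subr0 mulr1 mul1r mul0r scale0r g0.
    have -> : pr 0 = 0 by case: prE => ->.
    rewrite subr0 => ->; apply: le_trans (bound _ cin).
    by case: prE => ->; rewrite /normsq ?lerDl ?lerDr sqr_ge0.
  have a := MV rRe (or_introl (frefl _)); have b := MV rIm (or_intror (frefl _)).
  by rewrite -mulrA mulr_natl mulr2n {1}/normsq lerD.
elim: k f => [|k IH] f fh ff.
  apply: (step 0%N) => //; first by have [+ _] := ff; apply.
  have [K K0 KP] := bounded_on_square (fun t => continuous_ray (hol_rderiv z fh)).
  by exists K => // t St; rewrite expr0 mulr1; exact: KP.
apply: step => //; first by have [+ _] := ff; apply.
by apply: IH; [exact: hol_rderiv|exact: flat_rderiv].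
Qed.

(** The maximum principle is applied to G(t) = f (t z) / t^k on the square. Flatness makes G tend to
    0 at the origin, and |G|^2 is at most [K0] / 4^k on the boundary; hence |f z|^2 = |G(1)|^2 is of
    order 4^-k for every k. *)
Lemma flat_eq0 f : U 0 -> hol U f -> (forall k, flat [set 0] k f) -> f z = 0.
Proof.
move=> U0 fh ff.
have [K0 K00 K0P] := bounded_on_square (fun t => continuous_ray fh).
have f0 : f 0 = 0 by have [+ _] := ff 0%N; apply.
(* The maximum of [P] is at most K0 eta + 8 eta, with |t|^2 at most 8 on the square; as P(1) = |f
   z|^2 + eta, the bound K0 + 7 remains. *)
suff key (k : nat) : normsq (f z) <= (K0 + 7) * (4 ^+ k)^-1.
  apply/eqP; rewrite -normsq_eq0; apply/eqP/le_anti; rewrite normsq_ge0 andbT.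
  rewrite leNgt; apply/negP => fz.
  have kP k : k%:R * normsq (f z) <= K0 + 7.
    have p4 : (0 : R) < 4 ^+ k by rewrite exprn_gt0.
    have := key k; rewrite ler_pdivlMr// mulrC; apply: le_trans.
    rewrite ler_wpM2r ?normsq_ge0// -natrX ler_nat.
    exact/ltnW/ltn_expl.
  have h : 0 <= (K0 + 7) / normsq (f z) by apply: divr_ge0; [lra|exact: normsq_ge0].
  have := archi_boundP h; rewrite ltr_pdivrMr// => h'.
  by have := lt_le_trans h' (kP _); rewrite ltxx.
(* The term eta |t|^2 makes [P] strictly subharmonic away from 0; the value 4^-k keeps it of the
   size of the bound on the boundary. *)
pose eta : R := (4 ^+ k)^-1.
have eta0 : 0 < eta by rewrite invr_gt0 exprn_gt0.
pose G (t : C) := f (t *: z) * t^-1 ^+ k.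
pose P t := normsq (G t) + eta * normsq t.
have [K K_ge0 KP] := flat_bound U0 fh (ff k).
have GK t : square t -> normsq (G t) <= K * normsq t.
  move=> St; rewrite /G normsqM normsqX normsqV.
  have [->|t0] := eqVneq t 0.
    by rewrite scale0r f0 {1}/normsq /= expr0n addr0 mul0r mulr_ge0// normsq_ge0.
  have nt : 0 < normsq t by rewrite lt_neqAle eq_sym normsq_eq0 t0 normsq_ge0.
  rewrite exprVn ler_pdivrMr ?exprn_gt0// -mulrA -exprS.
  exact: KP.
have S0 : square 0 by rewrite /square /= normr0.
have Pc t : square t -> {for t, continuous P}.
  move=> St.
  have nc : {for t, continuous (fun t : C => eta * normsq t)}.
    apply: continuousM; first exact: cst_continuous.
    exact: continuous_normsq_id.
  (* At 0 the inverse takes the value 0 and [GK] forces G(0) = 0, so continuity of [P] there is a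
     squeeze. *)
  have [t0|t0] := eqVneq t 0.
    rewrite t0 /prop_for /continuous_at /P.
    have z0 : normsq (0 : C) = 0 by rewrite /normsq /= expr0n addr0.
    have G0 : normsq (G 0) = 0.
      apply/le_anti; rewrite normsq_ge0 andbT.
      by have := GK 0 S0; rewrite z0 mulr0.
    rewrite G0 z0 mulr0 addr0.
    have c0 : (fun=> (0 : R)) @ (0 : C) --> (0 : R).
      exact: (@cst_continuous C R 0 (0 : C)).
    have cK : (K + eta) * normsq x @[x --> (0 : C)] --> (0 : R).
      have := continuousM (@cst_continuous C R (K + eta) 0) (@continuous_normsq_id 0).
      by rewrite /prop_for /continuous_at /= z0 mulr0.
    apply: (squeeze_cvgr _ c0 cK).
    have : nbhs (0 : C) (ball (0 : C) 2%:C) by apply: nbhsx_ballx; rewrite ltcR.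
    apply: filterS => t'; rewrite -ball_normE /ball_ /= sub0r normrN => t'2.
    have St' : square t'.
      split; rewrite -lecR; apply: le_trans (ltW t'2).
        exact: ler_norm_Re.
      exact: ler_norm_Im.
    rewrite mulrDl lerD2r GK// andbT.
    by rewrite addr_ge0 ?normsq_ge0// mulr_ge0 ?normsq_ge0// ltW.
  apply: continuousD => //; apply: continuous_normsq.
  apply: continuousM; first exact: continuous_ray.
  have Vc : {for t, continuous (fun t : C => t^-1)} by apply: continuousV => //; exact: cvg_id.
  elim: (k) => [|j IH]; first exact: (@cst_continuous C C 1 t).
  apply: (eq_continuous_at _ (continuousM Vc IH)) => y.
  by rewrite exprS.
have [t0 St0 tmax] := square_max Pc.
have S1 : square 1 by rewrite /square /= normr1 normr0 ler1n.
have := tmax 1 S1; rewrite {1}/P /G scale1r invr1 expr1n mulr1 => tm.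
have n1 : normsq (1 : C) = 1 by rewrite /normsq /= expr1n expr0n addr0.
rewrite n1 mulr1 in tm.
have nt8 : normsq t0 <= 8.
  have sq (x : R) : `|x| <= 2 -> x ^+ 2 <= 4.
    by move=> x2; have := normr_ge0 x; rewrite -real_normK ?num_real//; nra.
  by case: St0 => /sq a /sq b; rewrite /normsq; lra.
suff PP : P t0 <= K0 * eta + 8 * eta by rewrite mulrDl -/eta; lra.
(* The maximum is at 0, where [P] vanishes, or at another interior point, which [no_interior_max]
   excludes, or on the boundary. *)
have [t00|t00] := eqVneq t0 0.
  have GG := GK _ St0; rewrite /P; move: GG; rewrite t00.
  have z0 : normsq (0 : C) = 0 by rewrite /normsq /= expr0n addr0.
  rewrite z0 !mulr0 addr0 => GG; apply: le_trans GG _.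
  by rewrite addr_ge0// mulr_ge0// ltW.
have near_int d : (`|rRe t0| < 2) && (`|rIm t0| < 2) ->
    \forall s \near (0 : R), square (t0 + s%:C * d) /\ t0 + s%:C * d != 0.
  move=> /andP[a b].
  have lc : (fun s : R => t0 + s%:C * d) @ (0 : R) --> t0.
    have h : is_cder (fun s : R => t0 + s%:C * d) 0 d.
      have := is_cderD (is_cder_cst t0 0) (is_cderM (is_cder_id 0) (is_cder_cst d 0)).
      by move/is_cder_eq; apply; rewrite mulr0 addr0 mul1r add0r.
    by have := is_cder_continuous h; rewrite /prop_for /continuous_at mul0r addr0.
  have [/cvgrPdist_lt lR /cvgrPdist_lt lI] := (cvg_ReIm _ _).1 lc.
  have /lR hR : 0 < 2 - `|rRe t0| by rewrite subr_gt0.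
  have /lI hI : 0 < 2 - `|rIm t0| by rewrite subr_gt0.
  have t0n : 0 < `|t0| by rewrite normr_gt0.
  have /cvgrPdist_lt/(_ _ t0n) h0 := lc.
  have tri (x y : R) : `|x - y| < 2 - `|x| -> `|y| <= 2.
    rewrite ltrBrDr => /ltW; apply: le_trans; rewrite distrC.
    by rewrite -{1}(subrK x y) ler_normD.
  near=> s; split; last first.
    have : `|t0 - (t0 + s%:C * d)| < `|t0| by near: s.
    by apply: contraTneq => ->; rewrite subr0 ltxx.
  by split; [apply: (tri (rRe t0))|apply: (tri (rIm t0))]; near: s.
have [int|bd] := boolP ((`|rRe t0| < 2) && (`|rIm t0| < 2)).
  exfalso; apply: (@no_interior_max R [set t | U (t *: z) /\ t != 0] G eta t0) => //.
  - apply: twice_holomorphicM; last by apply: twice_holomorphicVX => t [].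
    exists (fun t => rderiv z f (t *: z)), (fun t => rderiv z (rderiv z f) (t *: z)).
    split=> t [Ut _].
      exact: complex_derivative_hol.
    exact: (complex_derivative_hol (hol_rderiv z fh)).
  - by move=> d; apply: filterS (near_int d int) => s [Ss s0]; split; [exact: zU|].
  - by move=> d; apply: filterS (near_int d int) => s [Ss _]; exact: tmax.
have nt : 4 <= normsq t0.
  have sq (x : R) : 2 <= `|x| -> 4 <= x ^+ 2.
    by move=> x2; have := normr_ge0 x; rewrite -real_normK ?num_real//; nra.
  rewrite negb_and -!leNgt in bd; rewrite /normsq.
  by case/orP: bd => /sq h; [have := sqr_ge0 (rIm t0)|have := sqr_ge0 (rRe t0)]; lra.
rewrite /P lerD//; last by rewrite mulrC ler_wpM2r// ltW.
rewrite /G normsqM normsqX normsqV exprVn; apply: ler_pM.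
- exact: normsq_ge0.
- by rewrite invr_ge0 exprn_ge0// normsq_ge0.
- exact: K0P.
- by rewrite lef_pV2 ?posrE ?exprn_gt0 ?(lt_le_trans _ nt)// lerXn2r ?nnegrE ?normsq_ge0.
Unshelve. all: by end_near. Qed.

End UniqueContinuation.

(** * From germs at 0 to functions on open sets *)

Section Germs.
Variables (R : realType) (m : nat).
Local Notation C := R[i].
Local Notation V := 'cV[C]_m.
Implicit Types (f g : V -> C) (e z : V).

Definition smooth_at f z := forall (l : seq V),
  {for z, continuous (foldr (@rderiv R m) f l)} /\
  forall e, rderivable e (foldr (@rderiv R m) f l) z.

Lemma smooth_on_at (U : set V) f : (forall z, U z -> smooth_at f z) -> smooth_on U f.
Proof.
move=> fs k; elim: k f fs => [|k IH] f fs.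
  by split; [move=> z /fs/(_ [::])[]|].
split; first by move=> z /fs/(_ [::])[].
split=> [z e /fs/(_ [::])[_ h]|e]; first exact: h.
apply: IH => z Uz l; have := fs z Uz (rcons l e).
by rewrite foldr_rcons.
Qed.

Lemma smooth_on_smooth0 (U : set V) f : open U -> U 0 -> smooth_on U f -> smooth0 f.
Proof.
move=> oU U0 fs; have U0' : nbhs (0 : V) U by exact: open_nbhs_nbhs.
apply: filterS U0' => z Uz l.
have ls : smooth_on U (foldr (@rderiv R m) f l).
  by elim: l => // e l IH; exact: smooth_rderiv.
split; first exact: (smooth_continuous ls Uz).
by move=> e; exact: (smooth_rderivable e ls Uz).
Qed.

Lemma near0_open (P : V -> Prop) : (\forall z \near (0 : V), P z) ->
  exists U : set V, [/\ open U, U 0 & forall z, U z -> P z].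
Proof.
move=> h; have : nbhs (0 : V) P by exact: h.
by rewrite nbhsE => -[U [oU U0] UP]; exists U; split.
Qed.

Lemma smooth0P f : smooth0 f -> \forall z \near (0 : V), smooth_at f z.
Proof. exact. Qed.

Lemma holomorphic0P p (v : V -> 'cV[C]_p) : holomorphic0 v ->
  \forall z \near (0 : V), forall j, smooth_at (fun x => v x j 0) z /\
    forall k, dzbar k (fun x => v x j 0) z = 0.
Proof.
move=> vh.
have h j : \forall z \near (0 : V), smooth_at (fun x => v x j 0) z /\
    forall k, dzbar k (fun x => v x j 0) z = 0.
  by have [a b] := vh j; exact: (filterI a b).
exact: (@filter_forall V 'I_p _ (nbhs (0 : V)) _ h).
Qed.

Lemma hol_holomorphic0 (U : set V) p (v : V -> 'cV[C]_p) : open U -> U 0 ->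
  (forall j, hol U (fun x => v x j 0)) -> holomorphic0 v.
Proof.
move=> oU U0 vh j; have [vs vb] := vh j; split; first exact: (smooth_on_smooth0 oU U0 vs).
have U0' : nbhs (0 : V) U by exact: open_nbhs_nbhs.
by apply: filterS U0' => z Uz k; exact: vb.
Qed.

(** As |t| is at most 4 on the square, a ball with a quarter of the radius suffices. *)
Lemma near0_square_scale (U : set V) : open U -> U 0 ->
  \forall z \near (0 : V), forall t, square t -> U (t *: z).
Proof.
move=> oU U0; have : nbhs (0 : V) U by exact: open_nbhs_nbhs.
rewrite -nbhs_ballE => -[_ /= /gtC0_real[eps eps0 ->] eU].
have e40 : 0 < (eps / 4)%:C by rewrite ltcR divr_gt0.
have : nbhs (0 : V) (ball (0 : V) (eps / 4)%:C) by exact: nbhsx_ballx.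
apply: filterS => z; rewrite mx_norm_ball /ball_ /= sub0r normrN => zb t [a b].
apply: eU; rewrite mx_norm_ball /ball_ /= sub0r normrN normrZ.
have t4 : `|t| <= 4%:C.
  apply: le_trans (ler_norm_ReIm t) _; rewrite lecR.
  by rewrite (_ : 4 = 2 + 2 :> R) ?lerD//; ring.
apply: (@le_lt_trans _ _ (4%:C * `|z|)); first by rewrite ler_wpM2r.
rewrite mulrC -ltr_pdivlMr ?ltcR//.
suff <- : (eps / 4)%:C = eps%:C / 4%:C by [].
by rewrite rmorphM fmorphV.
Qed.

Lemma hol_flat_eq0 (U : set V) f : open U -> U 0 -> hol U f ->
  (forall k, flat [set 0] k f) -> \forall z \near (0 : V), f z = 0.
Proof.
move=> oU U0 fh ff; apply: filterS (near0_square_scale oU U0) => z zU.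
exact: (flat_eq0 oU zU U0 fh ff).
Qed.

Lemma hol_cong_eq (U : set V) f g : open U -> U 0 -> hol U f -> hol U g ->
  (forall k, cong k f g) -> \forall z \near (0 : V), f z = g z.
Proof.
move=> oU U0 fh gh fg.
apply: filterS (hol_flat_eq0 oU U0 (holB oU fh gh) fg) => z.
by move/eqP; rewrite subr_eq0 => /eqP.
Qed.

(** A small nonzero multiple of each basis vector lies in the neighbourhood. *)
Lemma near0_mulmx_inj p (A B : 'M[C]_(p, m)) :
  (\forall z \near (0 : V), A *m z = B *m z) -> A = B.
Proof.
move=> /near0_open[U [oU U0 AB]]; apply/matrixP => i j.
have := near_line oU (delta_mx j 0) U0.
move=> /nbhs_ballP[_ /posnumP[r] rU].
have r20 : 0 < r%:num / 2 :> R by rewrite divr_gt0.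
have : ball (0 : R) r%:num (r%:num / 2).
  by rewrite -ball_normE /ball_ /= sub0r normrN gtr0_norm// ltr_pdivrMr// ltr_pMr// ltr1n.
move=> /rU; rewrite add0r => /AB.
have c0 : (r%:num / 2)%:C != 0 :> C by rewrite gt_eqF// ltcR.
rewrite -!scalemxAr => h0.
have h : A *m delta_mx j 0 = B *m (delta_mx j 0 : V).
  by rewrite -[LHS](scalerK c0) h0 (scalerK c0).
have /matrixP/(_ i 0) := h.
have col_delta (M : 'M[C]_(p, m)) : (M *m (delta_mx j 0 : V)) i 0 = M i j.
  rewrite mxE (bigD1 j)//= big1 ?addr0 => [|k kj].
    by rewrite mxE !eqxx mulr1.
  by rewrite mxE (negPf kj) mulr0.
by rewrite !col_delta.
Qed.

End Germs.

(** * The sphere and its linear fields *)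

Section ComplexConstants.
Variable K : numClosedFieldType.
Implicit Types x y : K.

Lemma conjD x y : (x + y)^* = x^* + y^*. Proof. exact: rmorphD. Qed.
Lemma conjN x : (- x)^* = - x^*. Proof. exact: rmorphN. Qed.
Lemma conjM x y : (x * y)^* = x^* * y^*. Proof. exact: rmorphM. Qed.
Lemma conj2 : (2 : K)^* = 2. Proof. exact: rmorph_nat. Qed.
Lemma conjI : ('i : K)^* = - 'i. Proof. exact: conjCi. Qed.

Lemma mulii : 'i * 'i = -1 :> K.
Proof. by rewrite -expr2 sqrCi. Qed.

Lemma mul2i_halfi : 2 * 'i * ('i / 2) = -1 :> K.
Proof. by rewrite mulrA -[2 * 'i * 'i]mulrA mulii mulrN1 mulNr divff// pnatr_eq0. Qed.

Lemma half_i_2i : ('i / 2) * (2 * 'i) = -1 :> K.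
Proof. by rewrite mulrC mul2i_halfi. Qed.

Lemma half_i_N2i : ('i / 2) * - (2 * 'i) = 1 :> K.
Proof. by rewrite mulrN half_i_2i opprK. Qed.

Lemma Nhalf_i_2i : - ('i / 2) * (2 * 'i) = 1 :> K.
Proof. by rewrite mulNr half_i_2i opprK. Qed.

Lemma half_i_conj2i : ('i / 2) * (2 * 'i)^* = 1 :> K.
Proof. by rewrite conjM conj2 conjI mulrN half_i_N2i. Qed.

Lemma half_i_conjN2i : ('i / 2) * (- (2 * 'i))^* = -1 :> K.
Proof. by rewrite conjN mulrN half_i_conj2i. Qed.

Lemma oppr_conj2i : - (2 * 'i)^* = 2 * 'i :> K.
Proof. by rewrite conjM conj2 conjI mulrN opprK. Qed.

Lemma conj_Im x : ('Im x)^* = 'Im x.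
Proof. by rewrite conj_Creal ?Creal_Im. Qed.

Lemma double_ImE x : 2 * 'Im x = - 'i * (x - x^*).
Proof.
rewrite [in RHS](Crect x) conjD conjM conjI !conj_Creal ?Creal_Im ?Creal_Re//.
have -> : - 'i * ('Re x + 'i * 'Im x - ('Re x + - 'i * 'Im x)) =
  - ('i * 'i) * (2 * 'Im x) by ring.
by rewrite mulii opprK mul1r.
Qed.

End ComplexConstants.

Lemma conjR (R : realType) (c : R) : (c%:C)^* = c%:C.
Proof. exact: conjc_real. Qed.

Definition conjE := (conjD, conjN, conjM, conj2, conjR, conjI, conjC0, conjC1).

Section BlockMatrices.
Variables (R : realType) (n : nat).
Local Notation C := R[i].

Definition col3 p (x : 'M[C]_(1, p)) (y : 'M[C]_(n, p)) (w : 'M[C]_(1, p)) :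
  'M[C]_(1 + (n + 1), p) := col_mx x (col_mx y w).

Definition row3 p (x : 'M[C]_(p, 1)) (y : 'M[C]_(p, n)) (w : 'M[C]_(p, 1)) :
  'M[C]_(p, 1 + (n + 1)) := row_mx x (row_mx y w).

Definition blk3 (x00 : 'M[C]_1) (x01 : 'rV[C]_n) (x02 : 'M[C]_1)
    (x10 : 'cV[C]_n) (x11 : 'M[C]_n) (x12 : 'cV[C]_n)
    (x20 : 'M[C]_1) (x21 : 'rV[C]_n) (x22 : 'M[C]_1) : 'M[C]_(1 + (n + 1)) :=
  block_mx x00 (row_mx x01 x02) (col_mx x10 x20) (block_mx x11 x12 x21 x22).

Lemma row3_col3 p q (x : 'M[C]_(p, 1)) y w (x' : 'M[C]_(1, q)) y' w' :
  row3 x y w *m col3 x' y' w' = x *m x' + (y *m y' + w *m w').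
Proof. by rewrite /row3 /col3 !mul_row_col. Qed.

Lemma blk3_col3 q x00 x01 x02 x10 x11 x12 x20 x21 x22 (x : 'M[C]_(1, q)) y w :
  blk3 x00 x01 x02 x10 x11 x12 x20 x21 x22 *m col3 x y w =
  col3 (x00 *m x + (x01 *m y + x02 *m w)) (x10 *m x + (x11 *m y + x12 *m w))
    (x20 *m x + (x21 *m y + x22 *m w)).
Proof.
by rewrite /blk3 /col3 !mul_block_col mul_row_col mul_col_mx add_col_mx.
Qed.

Lemma row3_blk3 q x00 x01 x02 x10 x11 x12 x20 x21 x22 (x : 'M[C]_(q, 1)) y w :
  row3 x y w *m blk3 x00 x01 x02 x10 x11 x12 x20 x21 x22 =
  row3 (x *m x00 + (y *m x10 + w *m x20)) (x *m x01 + (y *m x11 + w *m x21))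
    (x *m x02 + (y *m x12 + w *m x22)).
Proof.
by rewrite /blk3 /row3 !mul_row_block mul_row_col mul_mx_row add_row_mx.
Qed.

Lemma blk3_mul x00 x01 x02 x10 x11 x12 x20 x21 x22
    y00 y01 y02 y10 y11 y12 y20 y21 y22 :
  blk3 x00 x01 x02 x10 x11 x12 x20 x21 x22 *m
  blk3 y00 y01 y02 y10 y11 y12 y20 y21 y22 =
  blk3
   (x00 *m y00 + (x01 *m y10 + x02 *m y20)) (x00 *m y01 + (x01 *m y11 + x02 *m y21))
   (x00 *m y02 + (x01 *m y12 + x02 *m y22))
   (x10 *m y00 + (x11 *m y10 + x12 *m y20)) (x10 *m y01 + (x11 *m y11 + x12 *m y21))
   (x10 *m y02 + (x11 *m y12 + x12 *m y22))
   (x20 *m y00 + (x21 *m y10 + x22 *m y20)) (x20 *m y01 + (x21 *m y11 + x22 *m y21))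
   (x20 *m y02 + (x21 *m y12 + x22 *m y22)).
Proof.
rewrite /blk3 !mulmx_block; congr block_mx.
- by rewrite mul_row_col.
- by rewrite mul_mx_row mul_row_block add_row_mx.
- by rewrite mul_col_mx mul_block_col add_col_mx.
- by rewrite mul_col_row add_block_mx.
Qed.

Lemma blk3D x00 x01 x02 x10 x11 x12 x20 x21 x22
    y00 y01 y02 y10 y11 y12 y20 y21 y22 :
  blk3 x00 x01 x02 x10 x11 x12 x20 x21 x22 +
  blk3 y00 y01 y02 y10 y11 y12 y20 y21 y22 =
  blk3 (x00 + y00) (x01 + y01) (x02 + y02) (x10 + y10) (x11 + y11) (x12 + y12)
    (x20 + y20) (x21 + y21) (x22 + y22).
Proof. by rewrite /blk3 !add_block_mx add_row_mx add_col_mx. Qed.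

Lemma blk3N x00 x01 x02 x10 x11 x12 x20 x21 x22 :
  - blk3 x00 x01 x02 x10 x11 x12 x20 x21 x22 =
  blk3 (- x00) (- x01) (- x02) (- x10) (- x11) (- x12) (- x20) (- x21) (- x22).
Proof. by rewrite /blk3 !opp_block_mx opp_row_mx opp_col_mx. Qed.

Lemma blk3_0 : blk3 0 0 0 0 0 0 0 0 0 = 0.
Proof. by rewrite /blk3 block_mx_const row_mx0 col_mx0 block_mx_const. Qed.

Lemma adjmx_blk3 x00 x01 x02 x10 x11 x12 x20 x21 x22 :
  adjmx (blk3 x00 x01 x02 x10 x11 x12 x20 x21 x22) =
  blk3 (adjmx x00) (adjmx x10) (adjmx x20) (adjmx x01) (adjmx x11) (adjmx x21)
    (adjmx x02) (adjmx x12) (adjmx x22).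
Proof.
by rewrite /blk3 /adjmx tr_block_mx map_block_mx tr_block_mx map_block_mx
  tr_row_mx tr_col_mx map_row_mx map_col_mx.
Qed.

Lemma adjmx_col3 p (x : 'M[C]_(1, p)) y w :
  adjmx (col3 x y w) = row3 (adjmx x) (adjmx y) (adjmx w).
Proof. by rewrite /col3 /row3 /adjmx !tr_col_mx !map_row_mx. Qed.

Lemma adjmxK p q (M : 'M[C]_(p, q)) : adjmx (adjmx M) = M.
Proof. by apply/matrixP => i j; rewrite !mxE conjCK. Qed.

Lemma adjmxD p q (M N : 'M[C]_(p, q)) : adjmx (M + N) = adjmx M + adjmx N.
Proof. by apply/matrixP => i j; rewrite !mxE rmorphD. Qed.

Lemma adjmxZ p q (c : C) (M : 'M[C]_(p, q)) : adjmx (c *: M) = c^* *: adjmx M.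
Proof. by apply/matrixP => i j; rewrite !mxE rmorphM. Qed.

Lemma adjmx0 p q : adjmx (0 : 'M[C]_(p, q)) = 0.
Proof. by apply/matrixP => i j; rewrite !mxE conjC0. Qed.

Lemma adjmx_scalar p (c : C) : adjmx (c%:M : 'M[C]_p) = (c^*)%:M.
Proof. by rewrite /adjmx tr_scalar_mx map_scalar_mx. Qed.

Lemma adjmx_cmx p q (M : 'M[R]_(p, q)) : adjmx (cmx M) = cmx M^T.
Proof. by apply/matrixP => i j; rewrite !mxE; exact: conjc_real. Qed.

Lemma hdotE p (x y : 'cV[C]_p) : hdot x y = (adjmx y *m x) 0 0.
Proof. by rewrite /hdot mxE; apply: eq_bigr => j _; rewrite !mxE mulrC. Qed.

Lemma mx11_scalarE (M : 'M[C]_1) : M = (M 0 0)%:M.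
Proof. exact: mx11_scalar. Qed.

Lemma blk3_commutator (p q t : 'rV[C]_n) (r s : 'M[C]_1) (b c al : 'cV[C]_n)
    (L Y : 'M[C]_n) :
  let A := blk3 0 p r 0 Y c 1%:M 0 0 in let B := blk3 0 q s b L al 0 t 0 in
  A *m B - B *m A =
  blk3 (p *m b - s) (p *m L + r *m t - q *m Y) (p *m al - q *m c)
    (Y *m b - al) (Y *m L + c *m t - (b *m p + L *m Y)) (Y *m al - (b *m r + L *m c))
    0 (q - t *m Y) (s - t *m c).
Proof.
move=> A B; rewrite /A /B !blk3_mul blk3N blk3D.
by rewrite !mul0mx !mulmx0 !mulmx1 !mul1mx !addr0 !add0r ?oppr0 ?addr0.
Qed.

End BlockMatrices.

Section SphereAlgebra.
Variables (R : realType) (n : nat).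
Local Notation C := R[i].
Variables (a : 'cV[R]_n) (X : 'M[R]_n) (r : R).
Hypothesis X_diag : is_diag_mx X.
Implicit Types (H : 'M[C]_n) (b z : 'cV[C]_n).
Local Notation ca := (cmx a).
Local Notation cX := (cmx X).
Local Notation A := (Amx a X r).

(* The Hermitian form |phi|^2 - Im (omega conj psi) of the sphere. *)
Definition Jmx : 'M[C]_(1 + (n + 1)) :=
  blk3 0 0 ('i / 2)%:M 0 1%:M 0 (- ('i / 2))%:M 0 0.

(** The rows are the psi-, phi- and omega-components. In the affine chart the psi-row is subtracted
    after multiplication by (z, w), which produces the quadratic terms of the claim. *)
Definition Bmx H b : 'M[C]_(1 + (n + 1)) :=
  let alpha := 'i *: (cX *m b) in
  blk3 0 (- (2 * 'i) *: adjmx alpha) (- (2 * 'Im (hdot ca b)))%:M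
    b ('i *: H) alpha
    0 ((2 * 'i) *: adjmx b) 0.

Lemma AmxE : A = blk3 0 (- (2 * 'i) *: adjmx ca) (r%:C)%:M 0 ('i *: cX) ca 1%:M 0 0.
Proof. by []. Qed.

Lemma adjmx_X : adjmx cX = cX.
Proof.
rewrite adjmx_cmx; congr cmx; apply/matrixP => i j; rewrite mxE.
have [->//|ij] := eqVneq i j.
by rewrite !(is_diag_mxP X_diag)// eq_sym.
Qed.

Lemma Jmx_mul x00 x01 x02 x10 x11 x12 x20 x21 x22 :
  Jmx *m @blk3 R n x00 x01 x02 x10 x11 x12 x20 x21 x22 =
  blk3 (('i / 2) *: x20) (('i / 2) *: x21) (('i / 2) *: x22) x10 x11 x12
    (- ('i / 2) *: x00) (- ('i / 2) *: x01) (- ('i / 2) *: x02).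
Proof.
by rewrite /Jmx blk3_mul !mul0mx !mul1mx !mul_scalar_mx !addr0 !add0r.
Qed.

Lemma mul_Jmx x00 x01 x02 x10 x11 x12 x20 x21 x22 :
  @blk3 R n x00 x01 x02 x10 x11 x12 x20 x21 x22 *m Jmx =
  blk3 (- ('i / 2) *: x02) x01 (('i / 2) *: x00) (- ('i / 2) *: x12) x11
    (('i / 2) *: x10) (- ('i / 2) *: x22) x21 (('i / 2) *: x20).
Proof.
by rewrite /Jmx blk3_mul !mulmx0 !mulmx1 !mul_mx_scalar !addr0 !add0r.
Qed.

Lemma adjmx_blk3_J x00 x01 x02 x10 x11 x12 x20 x21 x22 :
  let B := @blk3 R n x00 x01 x02 x10 x11 x12 x20 x21 x22 in
  adjmx x20 = x20 -> adjmx x11 = - x11 -> adjmx x02 = x02 ->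
  adjmx x00 = - x22 -> adjmx x22 = - x00 ->
  adjmx x10 = - ('i / 2) *: x21 -> ('i / 2) *: adjmx x21 = x10 ->
  adjmx x12 = ('i / 2) *: x01 -> ('i / 2) *: adjmx x01 = - x12 ->
  adjmx B *m Jmx = - (Jmx *m B).
Proof.
move=> B h20 h11 h02 h00 h22 h10 h21 h12 h01.
rewrite adjmx_blk3 mul_Jmx Jmx_mul blk3N.
rewrite h20 h11 h02 h00 h22 h10 h12 h01 !scaleNr h21 !opprK.
by rewrite !scalerN !opprK.
Qed.

Lemma adjmx_A_J : adjmx A *m Jmx = - (Jmx *m A).
Proof.
rewrite AmxE; apply: adjmx_blk3_J; rewrite ?adjmx0 ?oppr0 ?scaler0 ?adjmx_scalar ?conjE//.
- by rewrite adjmxZ adjmx_X conjI scaleNr.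
- by rewrite scalerA half_i_N2i scale1r.
- by rewrite adjmxZ adjmxK scalerA half_i_conjN2i scaleN1r.
Qed.

Lemma adjmx_B_J H b : adjmx H = H -> adjmx (Bmx H b) *m Jmx = - (Jmx *m Bmx H b).
Proof.
move=> hH; apply: adjmx_blk3_J; rewrite ?adjmx0 ?oppr0 ?adjmx_scalar//.
- by rewrite adjmxZ hH conjI scaleNr.
- by rewrite conjN conjM conj2 conj_Im.
- by rewrite scalerA Nhalf_i_2i scale1r.
- by rewrite adjmxZ adjmxK scalerA half_i_conj2i scale1r.
- by rewrite scalerA half_i_N2i scale1r.
- by rewrite adjmxZ adjmxK scalerA half_i_conjN2i scaleN1r.
Qed.

(** [Kmx] and [uvec] are the defects of the two admissibility equations; [kap] is an entry of [A, B]
    that these equations do not mention. *)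
Definition Kmx H b : 'M[C]_n :=
  H *m cX - cX *m H + (2 * 'i) *: (ca *m adjmx b + b *m adjmx ca).

Definition uvec H b : 'cV[C]_n :=
  - (cX *m cX *m b + r%:C *: b + 'i *: (H *m ca)).

Definition kap b : 'M[C]_1 := - 'i *: (adjmx ca *m b + adjmx b *m ca).

Lemma Im_hdot b :
  (- (2 * 'Im (hdot ca b)))%:M = 'i *: (adjmx b *m ca - adjmx ca *m b) :> 'M[C]_1.
Proof.
apply/matrixP => i j; rewrite !ord1 [LHS]mxE eqxx mulr1n hdotE.
have -> : adjmx ca *m b = adjmx (adjmx b *m ca) by rewrite adjmxM adjmxK.
set p := adjmx b *m ca; rewrite !mxE.
by rewrite double_ImE mulNr opprK.
Qed.

(** With alpha = 'i X b nothing is left below the diagonal. The repeated entries reflect that the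
    commutator of two matrices skew for [Jmx] is again skew. *)
Lemma commutator_AB H b : adjmx H = H ->
  A *m Bmx H b - Bmx H b *m A =
  blk3 (kap b) (- (2 * 'i) *: adjmx (uvec H b))
    (2 *: (adjmx ca *m cX *m b + adjmx b *m cX *m ca))
    0 (Kmx H b) (uvec H b) 0 0 (kap b).
Proof.
move=> hH; rewrite AmxE /Bmx blk3_commutator Im_hdot.
have i2 : ('i : C) * 'i = -1 by exact: mulii.
have adj_al : adjmx ('i *: (cX *m b)) = - 'i *: (adjmx b *m cX).
  by rewrite adjmxZ adjmxM adjmx_X conjI.
have adj_u : adjmx (uvec H b) =
    - (adjmx b *m cX *m cX + r%:C *: adjmx b - 'i *: (adjmx ca *m H)).
  rewrite adjmxN !adjmxD !adjmxZ !adjmxM adjmx_X hH conjI conjR mulmxA.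
  by rewrite scaleNr.
rewrite adj_al adj_u /kap /Kmx /uvec.
rewrite !mul_scalar_mx !mul_mx_scalar -!scalemxAl -!scalemxAr !scalerA.
rewrite ?mulmxA -?scalemxAl ?scalerA.
congr blk3.
- move: (adjmx ca *m b) (adjmx b *m ca) => p q.
  by apply/matrixP => i j; rewrite !mxE; ring.
- move: (adjmx ca *m H) (adjmx b *m cX *m cX) (adjmx b) => p q t.
  by apply/matrixP => i j; rewrite !mxE; ring : i2.
- move: (adjmx ca *m cX *m b) (adjmx b *m cX *m ca) => p q.
  by apply/matrixP => i j; rewrite !mxE; ring : i2.
- by rewrite subrr.
- move: (cX *m H) (H *m cX) (ca *m adjmx b) (b *m adjmx ca) => p q s t.
  by apply/matrixP => i j; rewrite !mxE; ring : i2.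
- move: (cX *m cX *m b) (H *m ca) => p s.
  by apply/matrixP => i j; rewrite !mxE; ring : i2.
- move: (adjmx b *m cX) => p.
  by apply/matrixP => i j; rewrite !mxE; ring : i2.
- move: (adjmx ca *m b) (adjmx b *m ca) => p q.
  by apply/matrixP => i j; rewrite !mxE; ring.
Qed.

Lemma admissible_uvec H b : adjmx H = H -> Kmx H b = 0 -> uvec H b = 0 ->
  admissible a X r (H, b).
Proof.
move=> hH hK hu; split=> //.
  by apply/eqP; rewrite scaleNr -addr_eq0; apply/eqP.
have /eqP := hu; rewrite oppr_eq0 addr_eq0 => /eqP hE.
by rewrite scaleNr mulmxDl mul_scalar_mx hE.
Qed.

Lemma admissibleP H b : admissible a X r (H, b) ->
  [/\ adjmx H = H, Kmx H b = 0 & uvec H b = 0].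
Proof.
move=> [hH hK hu]; split=> //.
  by apply/eqP; rewrite addr_eq0 hK scaleNr.
apply/eqP; rewrite oppr_eq0 addr_eq0 -mul_scalar_mx -mulmxDl -hu.
by rewrite scaleNr.
Qed.

Lemma kap_tr b : kap b = (- 'i * \tr (ca *m adjmx b + b *m adjmx ca))%:M.
Proof.
rewrite mxtraceD (mxtrace_mulC ca) (mxtrace_mulC b) /kap.
rewrite [adjmx ca *m b]mx11_scalarE [adjmx b *m ca]mx11_scalarE.
move: ((adjmx ca *m b) 0 0) ((adjmx b *m ca) 0 0) => p q.
by rewrite -raddfD scale_scalar_mx !mxtrace_scalar !mulr1n [q + p]addrC.
Qed.

(** By the first equation, [ca *m adjmx b + b *m adjmx ca] is a multiple of [H, X]. Its traces
    against 1 and against X vanish by cyclicity, and up to constants these traces are [kap] and the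
    top right corner of the commutator. *)
Lemma admissible_commute H b : admissible a X r (H, b) ->
  A *m Bmx H b = Bmx H b *m A.
Proof.
move=> /admissibleP[hH hK hu]; apply/eqP; rewrite -subr_eq0 commutator_AB//.
rewrite hK hu adjmx0 scaler0.
have n2i : (2 * 'i : C) != 0 by rewrite mulf_neq0 ?pnatr_eq0 ?neq0Ci.
have trK (Y : 'M[C]_n) : \tr ((ca *m adjmx b + b *m adjmx ca) *m Y) =
    (2 * 'i)^-1 * \tr (cX *m H *m Y - H *m cX *m Y).
  have hE : (2 * 'i) *: (ca *m adjmx b + b *m adjmx ca) = cX *m H - H *m cX.
    by have /eqP := hK; rewrite /Kmx addrC addr_eq0 opprB => /eqP.
  rewrite -mulmxBl -hE -scalemxAl mxtraceZ mulKf//.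
have mxtraceB (P Q : 'M[C]_n) : \tr (P - Q) = \tr P - \tr Q.
  by rewrite -scaleN1r mxtraceD mxtraceZ mulN1r.
have h1 := trK 1%:M; rewrite !mulmx1 mxtraceB mxtrace_mulC subrr mulr0 in h1.
have hk : kap b = 0 by rewrite kap_tr h1 mulr0 raddf0.
have h2 := trK cX.
have h3 : 2 *: (adjmx ca *m cX *m b + adjmx b *m cX *m ca) = 0.
  have hT : \tr (cX *m H *m cX) = \tr (H *m cX *m cX).
    by rewrite -[cX *m H *m cX]mulmxA mxtrace_mulC.
  rewrite mxtraceB hT subrr mulr0 mulmxDl mxtraceD in h2.
  rewrite -!(mulmxA _ _ cX) (mxtrace_mulC ca) (mxtrace_mulC b) in h2.
  move: h2; rewrite (mx11_scalarE (adjmx ca *m cX *m b)).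
  rewrite (mx11_scalarE (adjmx b *m cX *m ca)) !mxtrace_scalar !mulr1n.
  by rewrite -raddfD addrC => ->; rewrite raddf0 scaler0.
by rewrite hk h3 blk3_0.
Qed.

End SphereAlgebra.

Section MatrixDerivations.
Variables (R : realType) (m : nat).
Local Notation C := R[i].
Local Notation V := 'cV[C]_m.
Variable U : set V.
Hypothesis oU : open U.

Lemma mxder_rderivJ p q e (M : V -> 'M[C]_(p, q)) z : smooth_mx U M -> U z ->
  mxder (rderiv e) (fun z => adjmx (M z)) z = adjmx (mxder (rderiv e) M z).
Proof.
move=> Ms Uz; apply/matrixP => i j; rewrite !mxE.
under eq_fun do rewrite !mxE.
exact: (rderivJ e (Ms j i) Uz).
Qed.

Lemma mxder_dzbarJ p q j (M : V -> 'M[C]_(p, q)) z : smooth_mx U M -> U z ->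
  mxder (dzbar j) (fun z => adjmx (M z)) z = adjmx (mxder (dz j) M z).
Proof.
move=> Ms Uz; apply/matrixP => i k; rewrite !mxE.
under eq_fun do rewrite !mxE.
exact: (dzbarJ j (Ms k i) Uz).
Qed.

Lemma mxder_dzJ p q j (M : V -> 'M[C]_(p, q)) z : smooth_mx U M -> U z ->
  mxder (dz j) (fun z => adjmx (M z)) z = adjmx (mxder (dzbar j) M z).
Proof.
move=> Ms Uz; apply/matrixP => i k; rewrite !mxE.
under eq_fun do rewrite !mxE.
exact: (dzJ j (Ms k i) Uz).
Qed.

Lemma mxder_rderiv_id e z : mxder (rderiv e) (fun z : V => z) z = e.
Proof. by apply/matrixP => i j; rewrite ord1 mxE rderiv_coord. Qed.

Lemma mxder_dz_id j z : mxder (dz j) (fun z : V => z) z = delta_mx j 0.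
Proof. by apply/matrixP => i k; rewrite ord1 !mxE dz_coord andbT. Qed.

Definition hol_mx p q (M : V -> 'M[C]_(p, q)) :=
  forall i j, hol U (fun z => M z i j).

Lemma hol_mx_smooth p q (M : V -> 'M[C]_(p, q)) : hol_mx M -> smooth_mx U M.
Proof. by move=> Mh i j; have [] := Mh i j. Qed.

Lemma hol_mx_cst p q (M : 'M[C]_(p, q)) : hol_mx (fun=> M).
Proof. by move=> i j; exact: (hol_cst oU). Qed.

Lemma hol_mx_id : hol_mx (fun z : V => z).
Proof. by move=> i j; rewrite ord1; exact: (hol_coord oU). Qed.

Lemma hol_mxM p q s (M : V -> 'M[C]_(p, q)) (N : V -> 'M[C]_(q, s)) :
  hol_mx M -> hol_mx N -> hol_mx (fun z => M z *m N z).
Proof.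
move=> Mh Nh i j; under eq_fun do rewrite mxE.
exact: (hol_sum oU _ _ (fun k => holM oU (Mh i k) (Nh k j))).
Qed.

Lemma hol_mxD p q (M N : V -> 'M[C]_(p, q)) :
  hol_mx M -> hol_mx N -> hol_mx (fun z => M z + N z).
Proof.
by move=> Mh Nh i j; under eq_fun do rewrite mxE; exact: (holD oU (Mh i j) (Nh i j)).
Qed.

Lemma hol_mxN p q (M : V -> 'M[C]_(p, q)) : hol_mx M -> hol_mx (fun z => - M z).
Proof.
by move=> Mh i j; under eq_fun do rewrite mxE; exact: (holN oU (Mh i j)).
Qed.

Lemma hol_mxZ p q (f : V -> C) (M : V -> 'M[C]_(p, q)) :
  hol U f -> hol_mx M -> hol_mx (fun z => f z *: M z).
Proof.
by move=> fh Mh i j; under eq_fun do rewrite mxE; exact: (holM oU fh (Mh i j)).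
Qed.

Lemma mxder_dzbar_hol p q j (M : V -> 'M[C]_(p, q)) z : hol_mx M -> U z ->
  mxder (dzbar j) M z = 0.
Proof.
by move=> Mh Uz; apply/matrixP => i k; rewrite !mxE; have [_ h] := Mh i k; exact: h.
Qed.

Lemma bracketE (Y Z : V -> V) p : hol_mx Y -> hol_mx Z -> U p ->
  bracket Y Z p = mxder (rderiv (Y p)) Z p - mxder (rderiv (Z p)) Y p.
Proof.
move=> Yh Zh Up; apply/matrixP => i j; rewrite ord1 !mxE.
rewrite (rderiv_hol oU _ (Zh i 0) Up) (rderiv_hol oU _ (Yh i 0) Up).
by rewrite -sumrB.
Qed.

End MatrixDerivations.

(** * Linear fields in the affine chart *)

Section AffineFields.
Variables (R : realType) (n : nat).
Local Notation C := R[i].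
Local Notation V := 'cV[C]_(n + 1).
Local Notation N := (1 + (n + 1))%N.
Variable U : set V.
Hypothesis oU : open U.
Implicit Types (p e : V) (A B : 'M[C]_N).

(** [hom p] is the representative of p with psi = 1. A tangent vector at p is a homogeneous vector
    modulo [hom p], and [lift] selects the representative whose psi-component is 0. *)
Definition hom p : 'cV[C]_N := col_mx 1%:M p.
Definition lift e : 'cV[C]_N := col_mx 0 e.
Definition lowmx : 'M[C]_(n + 1, N) := row_mx 0 1%:M.
Definition upmx : 'M[C]_(1, N) := row_mx 1%:M 0.
Definition topc (q : 'cV[C]_N) : C := usubmx q 0 0.

Lemma lowmxE q : lowmx *m q = dsubmx q :> V.
Proof. by rewrite -{1}[q]vsubmxK mul_row_col mul0mx mul1mx add0r. Qed.

Lemma upmxE q : (upmx *m q) 0 0 = topc q.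
Proof. by rewrite -{1}[q]vsubmxK mul_row_col mul0mx mul1mx addr0. Qed.

Lemma topcD q q' : topc (q + q') = topc q + topc q'.
Proof. by rewrite /topc !mxE. Qed.

Lemma topcN q : topc (- q) = - topc q.
Proof. by rewrite /topc !mxE. Qed.

Lemma topcZ c q : topc (c *: q) = c * topc q.
Proof. by rewrite /topc !mxE. Qed.

Lemma topc_hom p : topc (hom p) = 1.
Proof. by rewrite /topc col_mxKu mxE. Qed.

Lemma hom_lift p : hom p = hom 0 + lift p.
Proof. by rewrite /hom /lift add_col_mx addr0 add0r. Qed.

Lemma lift_mulmx e : lift e = col_mx 0 1%:M *m e.
Proof. by rewrite mul_col_mx mul0mx mul1mx. Qed.

Lemma topc_col3 x y w : topc (@col3 R n 1 x y w) = x 0 0.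
Proof. by rewrite /topc col_mxKu. Qed.

Lemma liftD e e' : lift (e + e') = lift e + lift e'.
Proof. by rewrite /lift add_col_mx addr0. Qed.

Lemma liftN e : lift (- e) = - lift e.
Proof. by rewrite /lift opp_col_mx oppr0. Qed.

Lemma liftZ c e : lift (c *: e) = c *: lift e.
Proof. by rewrite /lift scale_col_mx scaler0. Qed.

Lemma lift0 : lift 0 = 0.
Proof. by rewrite /lift col_mx0. Qed.

Lemma liftB e e' : lift (e - e') = lift e - lift e'.
Proof. by rewrite liftD liftN. Qed.

Lemma lift_inj : injective lift.
Proof. by move=> e e' /eq_col_mx[]. Qed.

Lemma affine_fieldE A p :
  affine_field A p = lowmx *m (A *m hom p) - topc (A *m hom p) *: p.
Proof. by rewrite /affine_field lowmxE. Qed.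

Lemma lift_low q : lift (lowmx *m q) = q - topc q *: hom 0.
Proof.
rewrite lowmxE -{2}[q]vsubmxK /lift /hom scale_col_mx scaler0 opp_col_mx.
rewrite add_col_mx oppr0 addr0 scale_scalar_mx mulr1.
by rewrite {1}(mx11_scalarE (usubmx q)) subrr.
Qed.

(** The field in the chart is the linear field corrected by the multiple of the Euler field that
    keeps psi = 1. *)
Lemma lift_affine_field A p :
  lift (affine_field A p) = A *m hom p - topc (A *m hom p) *: hom p.
Proof.
rewrite affine_fieldE liftD liftN liftZ lift_low.
by rewrite -addrA -opprD -scalerDr -hom_lift.
Qed.

Lemma hol_hom : hol_mx U hom.
Proof.
move=> i j; apply: (hol_eq oU (f := fun p => (hom 0 + col_mx 0 1%:M *m p) i j)).
  by move=> p _; rewrite -lift_mulmx -hom_lift.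
move: i j; apply: (hol_mxD oU (hol_mx_cst oU _)).
exact: (hol_mxM oU (hol_mx_cst oU _) (hol_mx_id oU)).
Qed.

Lemma hol_topc (M : V -> 'cV[C]_N) : hol_mx U M -> hol U (fun p => topc (M p)).
Proof.
move=> Mh; apply: (hol_eq oU (f := fun p => (upmx *m M p) 0 0)).
  by move=> p _; rewrite upmxE.
exact: (hol_mxM oU (hol_mx_cst oU _) Mh).
Qed.

Lemma hol_affine_field A : hol_mx U (affine_field A).
Proof.
move=> i j; apply: (hol_eq oU (f := fun p =>
    (lowmx *m (A *m hom p) - topc (A *m hom p) *: p) i j)).
  by move=> p _; rewrite affine_fieldE.
have hA : hol_mx U (fun p => A *m hom p) by exact: (hol_mxM oU (hol_mx_cst oU _) hol_hom).
move: i j; apply: (hol_mxD oU (hol_mxM oU (hol_mx_cst oU _) hA)).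
exact: (hol_mxN oU (hol_mxZ oU (hol_topc hA) (hol_mx_id oU))).
Qed.

Lemma mxder_hom e p : U p -> mxder (rderiv e) hom p = lift e.
Proof.
move=> Up; have dr := derivation_rderiv oU e.
have E : forall z, U z -> hom z = hom 0 + col_mx 0 1%:M *m z.
  by move=> z _; rewrite -lift_mulmx -hom_lift.
rewrite (mxder_eq dr (hol_mx_smooth hol_hom) E Up).
have s1 := smooth_mxM oU (smooth_mx_cst oU (col_mx 0 1%:M : 'M[C]_(N, n + 1)))
  (smooth_mx_id oU).
rewrite (mxderD dr (smooth_mx_cst oU _) s1 Up) (mxder_cst dr _ Up) add0r.
rewrite (mxderM oU dr (smooth_mx_cst oU _) (smooth_mx_id oU) Up).
by rewrite (mxder_cst dr _ Up) mul0mx add0r mxder_rderiv_id -lift_mulmx.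
Qed.

Lemma lift_mxder_affine_field A e p : U p ->
  lift (mxder (rderiv e) (affine_field A) p) =
  A *m lift e - topc (A *m lift e) *: hom p - topc (A *m hom p) *: lift e.
Proof.
move=> Up; have dr := derivation_rderiv oU e.
have hA : hol_mx U (fun p => A *m hom p) by exact: (hol_mxM oU (hol_mx_cst oU _) hol_hom).
have sA := hol_mx_smooth hA; have sh := hol_mx_smooth hol_hom.
have sl := smooth_mxM oU (smooth_mx_cst oU lowmx) sA.
have [st _] := hol_topc hA.
have sz := smooth_mxZ oU st (smooth_mx_id oU).
have E z : U z -> affine_field A z = lowmx *m (A *m hom z) - topc (A *m hom z) *: z.
  by move=> _; exact: affine_fieldE.
have dA : mxder (rderiv e) (fun p => A *m hom p) p = A *m lift e.
  rewrite (mxderM oU dr (smooth_mx_cst oU _) sh Up) (mxder_cst dr _ Up).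
  by rewrite mul0mx add0r mxder_hom.
have dt : rderiv e (fun p => topc (A *m hom p)) p = topc (A *m lift e).
  rewrite -upmxE -dA.
  have -> : (fun p => topc (A *m hom p)) = (fun p => (upmx *m (A *m hom p)) 0 0).
    by apply/funext => z; rewrite upmxE.
  have := mxderM oU dr (smooth_mx_cst oU upmx) sA Up.
  rewrite (mxder_cst dr _ Up) mul0mx add0r => /matrixP/(_ 0 0).
  by rewrite mxE.
rewrite (mxder_eq dr (hol_mx_smooth (hol_affine_field A)) E Up).
rewrite (mxderD dr sl (smooth_mxN oU sz) Up) (mxderN oU dr sz Up).
rewrite (mxderM oU dr (smooth_mx_cst oU _) sA Up) (mxder_cst dr _ Up) mul0mx add0r.
rewrite dA (mxderZ dr st (smooth_mx_id oU) Up) dt mxder_rderiv_id.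
rewrite liftD liftN liftD !liftZ lift_low.
move: (topc (A *m lift e)) (topc (A *m hom p)) (A *m lift e) => t s q.
by rewrite (hom_lift p) scalerDr !opprD !addrA.
Qed.

(** The expression is the lift of the bracket of two affine fields. The corrections along [h] cancel
    and leave [A, B] h modulo [h], which is 0 here. *)
Lemma lift_bracket A B (h : 'cV[C]_N) : A *m B = B *m A ->
  let q := B *m h - topc (B *m h) *: h in
  let q' := A *m h - topc (A *m h) *: h in
  A *m q - topc (A *m q) *: h - topc (A *m h) *: q
  - (B *m q' - topc (B *m q') *: h - topc (B *m h) *: q') = 0.
Proof.
move=> AB q q'.
have Aq : A *m q = A *m B *m h - topc (B *m h) *: (A *m h).
  by rewrite /q mulmxBr -scalemxAr mulmxA.
have Bq' : B *m q' = A *m B *m h - topc (A *m h) *: (B *m h).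
  by rewrite /q' mulmxBr -scalemxAr mulmxA AB.
rewrite Aq Bq' {Aq Bq'} /q /q' {q q'}.
move: (A *m B *m h) (A *m h) (B *m h) => P u v.
rewrite !(topcD, topcN, topcZ).
by apply/matrixP => i j; rewrite !mxE; ring.
Qed.

Lemma bracket_affine_field A B p : U p -> A *m B = B *m A ->
  bracket (affine_field B) (affine_field A) p = 0.
Proof.
move=> Up AB; rewrite (bracketE oU (hol_affine_field B) (hol_affine_field A) Up).
apply: lift_inj; rewrite lift0 liftB.
have hA := lift_mxder_affine_field A (affine_field B p) Up.
have hB := lift_mxder_affine_field B (affine_field A p) Up.
apply: etrans (congr2 (fun x y => x - y) hA hB) _.
rewrite !lift_affine_field; exact: lift_bracket.
Qed.

Lemma hom_col3 p : hom p = col3 1%:M (zpart p) (wpart p)%:M.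
Proof.
rewrite /hom /col3 -{1}[p]vsubmxK; congr (col_mx _ (col_mx _ _)).
exact: mx11_scalarE.
Qed.

Lemma sphere_funE p :
  sphere_fun p = - (adjmx (hom p) *m Jmx R n *m hom p) 0 0.
Proof.
rewrite hom_col3 adjmx_col3 /Jmx row3_blk3 row3_col3 /sphere_fun.
rewrite adjmx1 adjmx_scalar !mulmx0 !mulmx1 !mul1mx !addr0 !add0r.
rewrite hdotE -!scalar_mxM.
move: (adjmx (zpart p) *m zpart p) => q.
have h (w : C) : 'Im w - q 0 0 =
    - (- (w^* * ('i / 2)) + (q 0 0 + 'i / 2 * w)).
  have n2 : (2 : C) != 0 by rewrite pnatr_eq0.
  have t2 : 2 * ('i / 2) = 'i :> C by rewrite mulrCA mulfV// mulr1.
  apply: (mulfI n2); rewrite mulrBr double_ImE.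
  by move: ('i / 2) t2 => t <-; ring.
by rewrite h !mxE !eqxx !mulr1n mulrN.
Qed.

Lemma rderiv_sphere_fun e p : U p -> rderiv e (@sphere_fun R n) p =
  - (adjmx (lift e) *m Jmx R n *m hom p + adjmx (hom p) *m Jmx R n *m lift e) 0 0.
Proof.
move=> Up; have dr := derivation_rderiv oU e.
have sh := hol_mx_smooth hol_hom; have sa := smooth_adjmx oU sh.
have sJ := smooth_mxM oU sa (smooth_mx_cst oU (Jmx R n)).
have sM := smooth_mxM oU sJ sh.
have -> : @sphere_fun R n =
    (fun p => - (adjmx (hom p) *m Jmx R n *m hom p) 0 0).
  by apply/funext => z; rewrite sphere_funE.
rewrite (derN oU dr (sM 0 0) Up).
have := mxderM oU dr sJ sh Up.
rewrite (mxderM oU dr sa (smooth_mx_cst oU _) Up) (mxder_cst dr _ Up).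
rewrite mulmx0 addr0 (mxder_rderivJ e sh Up) (mxder_hom e Up).
by move=> /matrixP/(_ 0 0); rewrite mxE => ->.
Qed.

Lemma affine_field_tangent B p : U p ->
  adjmx B *m Jmx R n = - (Jmx R n *m B) ->
  sphere_fun p = 0 -> rderiv (affine_field B p) (@sphere_fun R n) p = 0.
Proof.
move=> Up BJ; rewrite sphere_funE => /eqP; rewrite oppr_eq0 => /eqP q0.
rewrite (rderiv_sphere_fun _ Up) lift_affine_field.
set l := topc _; set h := hom p.
have hh : adjmx h *m Jmx R n *m h = 0.
  by apply/matrixP => i j; rewrite !ord1 q0 mxE.
rewrite adjmxD adjmxN adjmxZ adjmxM !mulmxDl !mulmxDr !mulNmx !mulmxN.
rewrite -!scalemxAl -!scalemxAr hh !scaler0 !subr0.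
rewrite -(mulmxA (adjmx h) (adjmx B)) BJ mulmxN mulNmx !mulmxA addNr.
by rewrite mxE oppr0.
Qed.

End AffineFields.

Lemma affine_field_blk3 (R : realType) (n : nat) (q t : 'rV[R[i]]_n) s b L al z
    (w : R[i]) :
  affine_field (blk3 0 q s b L al 0 t 0) (col_mx z w%:M) =
  col_mx (b + L *m z + w *: al - ((q *m z) 0 0 + s 0 0 * w) *: z)
    ((t *m z) 0 0 - ((q *m z) 0 0 + s 0 0 * w) * w)%:M.
Proof.
rewrite affine_fieldE lowmxE /hom -/(col3 _ _ _) blk3_col3 topc_col3 /col3 col_mxKd.
rewrite !mulmx1 !mul0mx !add0r !addr0 !mul_mx_scalar.
rewrite scale_col_mx opp_col_mx add_col_mx.
have sE : (q *m z + w *: s) 0 0 = (q *m z) 0 0 + s 0 0 * w.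
  by rewrite mxE [X in _ + X]mxE mulrC.
rewrite sE; congr col_mx; first by rewrite addrA.
move: (t *m z) (_ + _ * w) => y c; apply/matrixP => i j.
by rewrite !ord1 !mxE eqxx !mulr1n.
Qed.

Lemma affine_field_blk3_leaf (R : realType) (n : nat) (q t : 'rV[R[i]]_n) s b L al z :
  affine_field (blk3 0 q s b L al 0 t 0) (col_mx z 0) =
  col_mx (b + L *m z - (q *m z) 0 0 *: z) ((t *m z) 0 0)%:M.
Proof.
have E0 : (0 : 'M[R[i]]_1) = (0 : R[i])%:M by rewrite raddf0.
have := affine_field_blk3 q t s b L al z 0.
by rewrite -E0 !mulr0 subr0 scale0r !addr0.
Qed.

Section AutomorphismFields.
Variables (R : realType) (n : nat).
Local Notation C := R[i].
Variables (a : 'cV[R]_n) (X : 'M[R]_n) (r : R).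
Implicit Types (H : 'M[C]_n) (b z : 'cV[C]_n).

Lemma aut_fieldE H b : aut_field a X H b = affine_field (Bmx a X H b).
Proof.
apply/funext => p.
have pE : p = col_mx (zpart p) (wpart p)%:M.
  by rewrite /wpart -mx11_scalarE vsubmxK.
rewrite [in RHS]pE affine_field_blk3 /aut_field /=.
move: (zpart p) (wpart p) => z w; rewrite !hdotE.
move: ('i *: (cmx X *m b)) => al; rewrite -!scalemxAl.
have sE (c : C) : (c%:M : 'M[C]_1) 0 0 = c by rewrite mxE eqxx mulr1n.
have hE (c : C) (M : 'M[C]_1) : (c *: M) 0 0 = c * M 0 0 by rewrite mxE.
rewrite sE !hE; move: ('Im _) => rho; move: (H *m z) ((adjmx al *m z) 0 0) ((adjmx b *m z) 0 0) => Hz q s.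
congr col_mx; last by congr (_%:M); ring.
by apply/matrixP => i j; rewrite !ord1 !mxE; ring.
Qed.

(* The z-component of aut_field a X H b - 2i <z, b> reeb along {w = 0}. *)
Definition leaf_field H b z : 'cV[C]_n :=
  b + 'i *: (H *m z) + (2 * (adjmx b *m cmx X *m z) 0 0) *: z
  + (2 * (adjmx b *m z) 0 0) *: (cmx X *m z)
  + (4 * (adjmx b *m z) 0 0 * (adjmx (cmx a) *m z) 0 0) *: z.

End AutomorphismFields.

(** * The potential *)

Section LeafFields.
Variables (R : realType) (n : nat).
Local Notation C := R[i].
Variables (a : 'cV[R]_n) (X : 'M[R]_n) (r : R).
Hypothesis X_diag : is_diag_mx X.
Implicit Types (H : 'M[C]_n) (b z v : 'cV[C]_n).
Local Notation A := (Amx a X r).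

(** The w-component 1 is the transversality of the Reeb field to w = 0; it makes the decomposition
    in [descends_to] unique. *)
Lemma reeb_leaf z : reeb a X r (col_mx z 0) =
  col_mx ('i *: (cmx X *m z) + (2 * 'i * (adjmx (cmx a) *m z) 0 0) *: z) 1%:M.
Proof.
rewrite /reeb affine_fieldE lowmxE /hom -/(col3 _ _ _) AmxE blk3_col3 topc_col3.
rewrite /col3 col_mxKd !mulmx1 !mul0mx !mulmx0 !add0r !addr0.
rewrite scale_col_mx scaler0 opp_col_mx add_col_mx oppr0 addr0 -!scalemxAl.
have E (c : C) (P : 'M[C]_1) : (c *: P) 0 0 = c * P 0 0 by rewrite mxE.
by rewrite E mulNr scaleNr opprK.
Qed.

Lemma leaf_fieldP H b z : aut_field a X H b (col_mx z 0) =
  col_mx (leaf_field a X H b z) 0 +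
  (2 * 'i * (adjmx b *m z) 0 0) *: reeb a X r (col_mx z 0).
Proof.
have i2 : ('i : C) * 'i = -1 by exact: mulii.
rewrite aut_fieldE reeb_leaf affine_field_blk3_leaf scale_col_mx add_col_mx.
have E (c : C) (P : 'M[C]_1) : (c *: P) 0 0 = c * P 0 0 by rewrite mxE.
rewrite adjmxZ adjmxM (adjmx_X X_diag) conjI -!scalemxAl !E.
rewrite /leaf_field add0r scale_scalar_mx mulr1.
move: (H *m z) (cmx X *m z) ((adjmx b *m z) 0 0) ((adjmx (cmx a) *m z) 0 0)
  ((adjmx b *m cmx X *m z) 0 0) => Hz Xz s t q.
by congr col_mx; apply/matrixP => i j; rewrite !mxE; ring : i2.
Qed.

Lemma leaf_decomposition_unique z v v' (c c' : C) :
  col_mx v 0 + c *: reeb a X r (col_mx z 0) =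
  col_mx v' 0 + c' *: reeb a X r (col_mx z 0) -> v = v' /\ c = c'.
Proof.
rewrite reeb_leaf !scale_col_mx !add_col_mx !add0r => /eq_col_mx[h1 h2].
have cc : c = c'.
  by have /matrixP/(_ 0 0) := h2; rewrite !mxE eqxx !mulr1.
by split=> //; move: h1; rewrite cc => /addIr.
Qed.

Lemma descends_toP H b (v : 'cV[C]_n -> 'cV[C]_n) :
  descends_to a X r (aut_field a X H b) v <->
  \forall z \near (0 : 'cV[C]_n), v z = leaf_field a X H b z.
Proof.
split; apply: filterS => z.
  by move=> [c]; rewrite leaf_fieldP => /leaf_decomposition_unique[-> _].
by move=> ->; exists (2 * 'i * (adjmx b *m z) 0 0); rewrite leaf_fieldP.
Qed.

(** The value of [mu] is immaterial: it multiplies [hom (col_mx z 0)], whose contribution is 0 by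
    the equation of the potential. *)
Lemma lift_leaf_field H b z : exists mu : C,
  lift (col_mx (leaf_field a X H b z) 0) =
  Bmx a X H b *m hom (col_mx z 0) -
  (2 * 'i * (adjmx b *m z) 0 0) *: (A *m hom (col_mx z 0)) +
  mu *: hom (col_mx z 0).
Proof.
have hB := lift_affine_field (Bmx a X H b) (col_mx z 0).
have hA := lift_affine_field A (col_mx z 0).
have := congr1 (@lift R n) (leaf_fieldP H b z).
rewrite aut_fieldE hB liftD liftZ /reeb hA.
set h := hom _; set c := 2 * _ * _; set s := topc _; set t := topc _.
move: (Bmx a X H b *m h) (A *m h) => P Q E.
exists (c * t - s).
apply: (addIr (c *: (Q - t *: h))); rewrite -E.
by apply/matrixP => i j; rewrite !mxE; ring.
Qed.

End LeafFields.

Section Potential.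
Variables (R : realType) (n : nat).
Local Notation C := R[i].
Local Notation V := 'cV[C]_n.
Local Notation N := (1 + (n + 1))%N.
Variables (a : 'cV[R]_n) (X : 'M[R]_n) (r : R) (F : V -> R).
Hypothesis X_diag : is_diag_mx X.
Local Notation A := (Amx a X r).
Local Notation J := (Jmx R n).
Local Notation FC := (fun z => (F z)%:C).
Implicit Types (z e v : V).

(* In these terms the equation of the potential is eta z * expF z * zeta z = 0;
   uF is the derivative of its left-hand side with respect to F. *)
Definition zeta z : 'cV[C]_N := hom (col_mx z 0).
Definition incl : 'M[C]_(N, n) := col_mx 0 (col_mx 1%:M 0).
Definition eta z : 'rV[C]_N := adjmx (zeta z) *m J.
Definition gen : 'M[C]_N := (2 * 'i) *: A.
Definition expF z : 'M[C]_N := mexp gen (F z).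
Definition uF z : C := (eta z *m gen *m expF z *m zeta z) 0 0.

Lemma inclE v : incl *m v = lift (col_mx v 0).
Proof. by rewrite /incl /lift !mul_col_mx !mul0mx mul1mx. Qed.

Lemma zetaE z : zeta z = zeta 0 + incl *m z.
Proof. by rewrite inclE /zeta hom_lift [in RHS]hom_lift col_mx0 lift0 addr0. Qed.

Lemma etaE z : eta z = row_mx 0 (row_mx (adjmx z) ('i / 2)%:M).
Proof.
rewrite /eta /zeta /hom -/(col3 _ _ _) adjmx_col3 /Jmx row3_blk3.
rewrite adjmx1 adjmx0 !mulmx0 !mul0mx !mulmx1 !mul1mx !addr0 !add0r.
by [].
Qed.

(** A is skew for J, and the factor 2 'i turns skew into self-adjoint. *)
Lemma adjmx_gen_J : adjmx gen *m J = J *m gen.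
Proof.
rewrite /gen adjmxZ -scalemxAl (adjmx_A_J a r X_diag) scalerN -scaleNr.
by rewrite oppr_conj2i scalemxAr.
Qed.

Lemma potential_eq z : row_mx 0 (row_mx (adjmx z) ('i / 2)%:M)
    *m expmx ((2 * 'i * (F z)%:C) *: A) *m col_mx 1 (col_mx z 0) = 0 :> 'M[C]_1 ->
  eta z *m expF z *m zeta z = 0.
Proof. by rewrite -etaE /expF mexpE /gen scalerA [(F z)%:C * _]mulrC. Qed.

Variable U : set V.
Hypotheses (oU : open U) (U0 : U 0).
Hypothesis Fs : smooth_on U FC.
Hypothesis F_eq : forall z, U z -> eta z *m expF z *m zeta z = 0.

Lemma hol_zeta : hol_mx U zeta.
Proof.
have h : hol_mx U (fun z => zeta 0 + incl *m z).
  exact: (hol_mxD oU (hol_mx_cst oU _) (hol_mxM oU (hol_mx_cst oU _) (hol_mx_id oU))).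
by move=> i j; apply: (hol_eq oU _ (h i j)) => z _; rewrite -zetaE.
Qed.

Lemma smooth_zeta : smooth_mx U zeta.
Proof. exact: hol_mx_smooth hol_zeta. Qed.

Lemma smooth_eta : smooth_mx U eta.
Proof. exact: (smooth_mxM oU (smooth_adjmx oU smooth_zeta) (smooth_mx_cst oU _)). Qed.

Lemma smooth_expF : smooth_mx U expF.
Proof. exact: (smooth_mexp oU _ Fs). Qed.

Lemma smooth_uF : smooth_on U uF.
Proof.
exact: (smooth_mxM oU (smooth_mxM oU (smooth_mxM oU smooth_eta
  (smooth_mx_cst oU _)) smooth_expF) smooth_zeta 0 0).
Qed.

Lemma mxder_zeta D z : derivation U D -> U z ->
  mxder D zeta z = incl *m mxder D (fun z : V => z) z.
Proof.
move=> dD Uz.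
have si := smooth_mxM oU (smooth_mx_cst oU incl) (smooth_mx_id oU).
have E y : U y -> zeta y = zeta 0 + incl *m y by move=> _; exact: zetaE.
rewrite (mxder_eq dD smooth_zeta E Uz) (mxderD dD (smooth_mx_cst oU _) si Uz).
rewrite (mxderM oU dD (smooth_mx_cst oU _) (smooth_mx_id oU) Uz).
by rewrite !(mxder_cst dD _ Uz) mul0mx !add0r.
Qed.

Lemma mxder_eta D z : derivation U D -> U z ->
  mxder D eta z = mxder D (fun z => adjmx (zeta z)) z *m J.
Proof.
move=> dD Uz.
rewrite (mxderM oU dD (smooth_adjmx oU smooth_zeta) (smooth_mx_cst oU _) Uz).
by rewrite (mxder_cst dD _ Uz) mulmx0 addr0.
Qed.

Lemma mxder_dz_eta k z : U z -> mxder (dz k) eta z = 0.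
Proof.
move=> Uz; rewrite (mxder_eta (derivation_dz oU k) Uz).
rewrite (mxder_dzJ k smooth_zeta Uz) (mxder_dzbar_hol k hol_zeta Uz).
by rewrite adjmx0 mul0mx.
Qed.

Lemma mxder_dzbar_eta k z : U z ->
  mxder (dzbar k) eta z = adjmx (incl *m delta_mx k 0) *m J.
Proof.
move=> Uz; rewrite (mxder_eta (derivation_dzbar oU k) Uz).
rewrite (mxder_dzbarJ k smooth_zeta Uz) (mxder_zeta (derivation_dz oU k) Uz).
by rewrite mxder_dz_id.
Qed.

Lemma mxder_dz_zeta k z : U z -> mxder (dz k) zeta z = incl *m delta_mx k 0.
Proof. by move=> Uz; rewrite (mxder_zeta (derivation_dz oU k) Uz) mxder_dz_id. Qed.

Lemma mxder_dzbar_zeta k z : U z -> mxder (dzbar k) zeta z = 0.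
Proof. by move=> Uz; rewrite (mxder_dzbar_hol k hol_zeta Uz). Qed.

(** Implicit differentiation of the equation of the potential; the hypothesis on [mxder D expF] is
    the chain rule, through which D reaches the exponential by way of F only. *)
Lemma derivation_FC D z : derivation U D -> U z ->
  mxder D expF z = D FC z *: (gen *m expF z) ->
  D FC z * uF z = - (mxder D eta z *m expF z *m zeta z
    + eta z *m expF z *m mxder D zeta z) 0 0.
Proof.
move=> dD Uz DE.
have := mxder_eq dD (smooth_mxM oU (smooth_mxM oU smooth_eta smooth_expF) smooth_zeta)
  F_eq Uz.
rewrite (mxder_cst dD _ Uz).
rewrite (mxderM oU dD (smooth_mxM oU smooth_eta smooth_expF) smooth_zeta Uz).
rewrite (mxderM oU dD smooth_eta smooth_expF Uz) DE.
rewrite -scalemxAr mulmxDl -scalemxAl mulmxA /uF.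
move: (mxder D eta z *m expF z *m zeta z) (eta z *m gen *m expF z *m zeta z)
  (eta z *m expF z *m mxder D zeta z) (D FC z) => P Q S c /matrixP/(_ 0 0).
rewrite !mxE => h; apply/eqP; rewrite -addr_eq0; apply/eqP; rewrite -h; ring.
Qed.

Lemma rderiv_FC e z : U z -> rderiv e FC z * uF z =
  - (adjmx (incl *m e) *m J *m expF z *m zeta z
     + eta z *m expF z *m (incl *m e)) 0 0.
Proof.
move=> Uz; have dr := derivation_rderiv oU e.
rewrite (derivation_FC dr Uz); last exact: (mxder_mexp_rderiv gen Fs e Uz).
rewrite (mxder_zeta dr Uz) (mxder_eta dr Uz) (mxder_rderivJ e smooth_zeta Uz).
by rewrite (mxder_zeta dr Uz) mxder_rderiv_id.
Qed.

Lemma dz_FC k z : U z ->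
  dz k FC z * uF z = - (eta z *m expF z *m (incl *m (delta_mx k 0 : V))) 0 0.
Proof.
move=> Uz; have dr := derivation_dz oU k.
rewrite (derivation_FC dr Uz); last exact: (mxder_mexp_dz gen Fs k Uz).
by rewrite (mxder_dz_eta k Uz) (mxder_dz_zeta k Uz) !mul0mx add0r.
Qed.

Lemma dzbar_FC k z : U z -> dzbar k FC z * uF z =
  - (adjmx (incl *m (delta_mx k 0 : V)) *m J *m expF z *m zeta z) 0 0.
Proof.
move=> Uz; have dr := derivation_dzbar oU k.
rewrite (derivation_FC dr Uz); last exact: (mxder_mexp_dzbar gen Fs k Uz).
by rewrite (mxder_dzbar_eta k Uz) (mxder_dzbar_zeta k Uz) mulmx0 addr0.
Qed.

End Potential.

Section SmoothCongruence.
Variables (R : realType) (m : nat).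
Local Notation C := R[i].
Local Notation V := 'cV[C]_m.
Variable U : set V.
Hypotheses (oU : open U) (U0 : U 0).
Implicit Types (f g h : V -> C).

(** Bundles the smoothness on which the rules for [cong] depend, so that congruences chain without
    side conditions. *)
Definition sc k f g := [/\ smooth_on U f, smooth_on U g & cong k f g].

Definition scong k p q (M N : V -> 'M[C]_(p, q)) :=
  [/\ smooth_mx U M, smooth_mx U N & cong_mx k M N].

Lemma sc_eq k f g : smooth_on U f -> eq_on U f g -> sc k f g.
Proof.
by move=> fs fg; split; [exact: fs|exact: (smooth_eq oU fg fs)|exact: (cong_eq_on oU U0 k fs fg)].
Qed.

Lemma sc_refl k f : smooth_on U f -> sc k f f.
Proof. by move=> fs; exact: sc_eq. Qed.

Lemma sc_sym k f g : sc k f g -> sc k g f.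
Proof. by move=> [fs gs fg]; split; [exact: gs|exact: fs|exact: (cong_sym oU U0 fs gs fg)]. Qed.

Lemma sc_trans k f g h : sc k f g -> sc k g h -> sc k f h.
Proof.
move=> [fs gs fg] [_ hs gh]; split; [exact: fs|exact: hs|].
exact: (cong_trans oU U0 fs gs hs fg gh).
Qed.

Lemma scD k f g f' g' : sc k f f' -> sc k g g' ->
  sc k (fun z => f z + g z) (fun z => f' z + g' z).
Proof.
move=> [fs fs' ff] [gs gs' gg]; split; [exact: (smoothD oU)|exact: (smoothD oU)|].
exact: (congD oU U0 fs gs fs' gs' ff gg).
Qed.

Lemma scN k f f' : sc k f f' -> sc k (fun z => - f z) (fun z => - f' z).
Proof.
move=> [fs fs' ff]; split; [exact: (smoothN oU)|exact: (smoothN oU)|].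
exact: (congN oU U0 fs fs' ff).
Qed.

Lemma scM k f g f' g' : sc k f f' -> sc k g g' ->
  sc k (fun z => f z * g z) (fun z => f' z * g' z).
Proof.
move=> [fs fs' ff] [gs gs' gg]; split; [exact: (smoothM oU)|exact: (smoothM oU)|].
exact: (congM oU U0 fs gs fs' gs' ff gg).
Qed.

Lemma sc_dz k j f g : sc k.+1 f g -> sc k (dz j f) (dz j g).
Proof.
move=> [fs gs fg]; have dj := derivation_dz oU j.
by split; [exact: (der_smooth dj fs)|exact: (der_smooth dj gs)|exact: (cong_dz oU U0 j fs gs fg)].
Qed.

Lemma sc_val k f g : sc k f g -> f 0 = g 0.
Proof. by move=> [_ _ /cong_val]. Qed.

Lemma sc_cancel k f g h : smooth_on U f -> smooth_on U g -> smooth_on U h ->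
  h 0 != 0 -> sc k (fun z => f z * h z) (fun z => g z * h z) -> sc k f g.
Proof.
move=> fs gs hs h0 [fhs ghs fgh]; split; [exact: fs|exact: gs|].
have Z0U : [set 0] `<=` U by move=> z ->.
apply: (flat_cancel oU Z0U (smoothB oU fs gs) hs); first by move=> z ->.
apply: (flat_eq oU Z0U (smoothB oU fhs ghs) _ fgh) => z Uz.
by rewrite mulrBl.
Qed.

Lemma sc_hol_eq f g : hol U f -> hol U g -> (forall k, sc k f g) ->
  \forall z \near (0 : V), f z = g z.
Proof.
by move=> fh gh fg; apply: (hol_cong_eq oU U0 fh gh) => k; have [] := fg k.
Qed.

Lemma scong_refl k p q (M : V -> 'M[C]_(p, q)) : smooth_mx U M -> scong k M M.
Proof. by move=> Ms; split; [exact: Ms|exact: Ms|exact: (cong_mx_refl oU U0 k Ms)]. Qed.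

Lemma scong_cst k p q (M : 'M[C]_(p, q)) : scong k (fun=> M) (fun=> M).
Proof. by apply: scong_refl; exact: (smooth_mx_cst oU). Qed.

Lemma scongM k p q s (M M' : V -> 'M[C]_(p, q)) (N N' : V -> 'M[C]_(q, s)) :
  scong k M M' -> scong k N N' ->
  scong k (fun z => M z *m N z) (fun z => M' z *m N' z).
Proof.
move=> [Ms Ms' MM] [Ns Ns' NN]; split; [exact: (smooth_mxM oU)|exact: (smooth_mxM oU)|].
exact: (cong_mxM oU U0 Ms Ns Ms' Ns' MM NN).
Qed.

Lemma scongD k p q (M M' N N' : V -> 'M[C]_(p, q)) :
  scong k M M' -> scong k N N' ->
  scong k (fun z => M z + N z) (fun z => M' z + N' z).
Proof.
move=> [Ms Ms' MM] [Ns Ns' NN]; split; [exact: (smooth_mxD oU)|exact: (smooth_mxD oU)|].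
exact: (cong_mxD oU U0 Ms Ns Ms' Ns' MM NN).
Qed.

Lemma scongZ k p q (f f' : V -> C) (M M' : V -> 'M[C]_(p, q)) :
  sc k f f' -> scong k M M' ->
  scong k (fun z => f z *: M z) (fun z => f' z *: M' z).
Proof.
move=> [fs fs' ff] [Ms Ms' MM]; split; [exact: (smooth_mxZ oU)|exact: (smooth_mxZ oU)|].
exact: (cong_mxZ oU U0 fs Ms fs' Ms' ff MM).
Qed.

Lemma scong_entry k p q (M N : V -> 'M[C]_(p, q)) i j :
  scong k M N -> sc k (fun z => M z i j) (fun z => N z i j).
Proof. by move=> [Ms Ns MN]; split; [exact: Ms|exact: Ns|exact: MN]. Qed.

Lemma scong_adjmx_hol k p q (M : V -> 'M[C]_(p, q)) : hol_mx U M ->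
  scong k (fun z => adjmx (M z)) (fun=> adjmx (M 0)).
Proof.
move=> Mh; split; [exact: (smooth_adjmx oU (hol_mx_smooth Mh))|exact: (smooth_mx_cst oU)|].
move=> i j; under eq_fun do rewrite !mxE.
under [X in cong _ _ X]eq_fun do rewrite !mxE.
exact: (cong_conj_hol oU U0 k (Mh j i)).
Qed.

Lemma sc_cst k f : smooth_on U f -> (forall j, eq_on U (dz j f) (fun=> 0)) ->
  sc k f (fun=> f 0).
Proof.
move=> fs f0; split; [exact: fs|exact: (smooth_cst oU)|].
exact: (cong_cst oU U0 k fs f0).
Qed.

End SmoothCongruence.

Lemma adjmx_delta_mul (R : realType) n (l : 'I_n) (z : 'cV[R[i]]_n) :
  (adjmx (delta_mx l 0 : 'cV[R[i]]_n) *m z) 0 0 = z l 0.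
Proof.
rewrite mxE (bigD1 l)//= big1 ?addr0 => [|j jl]; rewrite !mxE ?eqxx.
  by rewrite conjC1 mul1r.
by rewrite (negPf jl) conjC0 mul0r.
Qed.

(** * Jets of the potential modulo zbar *)

Section PotentialJets.
Variables (R : realType) (n : nat).
Local Notation C := R[i].
Local Notation V := 'cV[C]_n.
Local Notation N := (1 + (n + 1))%N.
Variables (a : 'cV[R]_n) (X : 'M[R]_n) (r : R) (F : V -> R).
Hypothesis X_diag : is_diag_mx X.
Local Notation A := (Amx a X r).
Local Notation J := (Jmx R n).
Local Notation FC := (fun z : V => (F z)%:C).
Local Notation gen := (gen a X r).
Local Notation expF := (expF a X r F).
Local Notation uF := (uF a X r F).
Local Notation zeta := (@zeta R n).
Local Notation eta := (@eta R n).
Local Notation incl := (incl R n).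
Implicit Types (z e v : V).

Lemma zeta_col3 z : zeta z = col3 1%:M z 0.
Proof. by []. Qed.

Lemma incl_col3 v : incl *m v = col3 0 v 0.
Proof. by rewrite inclE. Qed.

Lemma eta0_row3 : eta 0 = row3 0 0 ('i / 2)%:M.
Proof. by rewrite etaE adjmx0. Qed.

Lemma eta0_A : eta 0 *m A = row3 ('i / 2)%:M 0 0.
Proof.
by rewrite eta0_row3 AmxE row3_blk3 !mul0mx !mulmx0 mulmx1 !(add0r, addr0).
Qed.

Lemma A_zeta z : A *m zeta z =
  col3 (- (2 * 'i) *: (adjmx (cmx a) *m z)) ('i *: (cmx X *m z)) 1%:M.
Proof.
rewrite zeta_col3 AmxE blk3_col3 !mul0mx !mulmx0 !add0r !addr0 mulmx1.
by rewrite -!scalemxAl.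
Qed.

Lemma eta0_gen : eta 0 *m gen = row3 (- 1%:M) 0 0.
Proof.
rewrite /gen -scalemxAr eta0_A /row3 !scale_row_mx !scaler0 scale_scalar_mx.
by rewrite mul2i_halfi raddfN.
Qed.

Lemma eta0_gen_zeta z : eta 0 *m gen *m zeta z = - 1%:M.
Proof. by rewrite eta0_gen zeta_col3 row3_col3 !mul0mx mulmx1 !addr0. Qed.

Lemma eta0_incl v : eta 0 *m (incl *m v) = 0.
Proof. by rewrite eta0_row3 incl_col3 row3_col3 !mul0mx mulmx0 !addr0. Qed.

Lemma eta0_gen_incl v : eta 0 *m gen *m (incl *m v) = 0.
Proof. by rewrite eta0_gen incl_col3 row3_col3 !mul0mx mulmx0 !addr0. Qed.

Lemma gen_zeta z : gen *m zeta z =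
  col3 (4 *: (adjmx (cmx a) *m z)) (- 2 *: (cmx X *m z)) (2 * 'i)%:M.
Proof.
rewrite /gen -scalemxAl A_zeta /col3 !scale_col_mx !scalerA scale_scalar_mx mulr1.
have i2 : ('i : C) * 'i = -1 by exact: mulii.
have -> : 2 * 'i * - (2 * 'i) = 4 :> C by ring : i2.
by have -> : 2 * 'i * 'i = - 2 :> C by ring : i2.
Qed.

Lemma eta0_gen_gen_zeta z :
  eta 0 *m gen *m (gen *m zeta z) = - 4 *: (adjmx (cmx a) *m z).
Proof.
rewrite eta0_gen gen_zeta row3_col3 !mul0mx !addr0 mulNmx mul1mx.
by rewrite scaleNr.
Qed.

Lemma adj_incl_J v : adjmx (incl *m v) *m J = row3 0 (adjmx v) 0.
Proof.
rewrite incl_col3 adjmx_col3 !adjmx0 /Jmx row3_blk3.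
by rewrite !mul0mx !mulmx0 mulmx1 !add0r !addr0.
Qed.

Lemma adj_incl_J_zeta v z : adjmx (incl *m v) *m J *m zeta z = adjmx v *m z.
Proof. by rewrite adj_incl_J zeta_col3 row3_col3 !mul0mx addr0 add0r. Qed.

Lemma adj_incl_J_incl v e : adjmx (incl *m v) *m J *m (incl *m e) = adjmx v *m e.
Proof. by rewrite adj_incl_J incl_col3 row3_col3 !mul0mx addr0 add0r. Qed.

Lemma adj_incl_J_gen_zeta v z : adjmx (incl *m v) *m J *m (gen *m zeta z) =
  - 2 *: (adjmx v *m (cmx X *m z)).
Proof.
by rewrite adj_incl_J gen_zeta row3_col3 !mul0mx addr0 add0r -scalemxAr.
Qed.

Variable U : set V.
Hypotheses (oU : open U) (U0 : U 0).
Hypothesis Fs : smooth_on U FC.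
Hypothesis F_eq : forall z, U z -> eta z *m expF z *m zeta z = 0.
Hypothesis F0 : F 0 = 0.
Local Notation sc := (sc U).
Local Notation scong := (scong U).

Lemma expF0 : expF 0 = 1%:M.
Proof. by rewrite /expF F0 mexp0. Qed.

Lemma uF0 : uF 0 = -1.
Proof. by rewrite /uF expF0 mulmx1 eta0_gen_zeta !mxE eqxx. Qed.

Lemma uF0_neq0 : uF 0 != 0.
Proof. by rewrite uF0 oppr_eq0 oner_eq0. Qed.

Lemma scong_eta k : scong k eta (fun=> eta 0).
Proof.
have h := scong_adjmx_hol oU U0 k (hol_zeta oU).
exact: (scongM oU U0 h (scong_cst oU U0 k J)).
Qed.

(** Since dz_j E = (dz_j F) gen E, one more order to which F is congruent to 0 gives one more order
    to which E is congruent to 1. *)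
Lemma sc_expF k : sc k FC (fun=> 0) -> scong k expF (fun=> 1%:M).
Proof.
have sE := smooth_expF a X r oU Fs.
elim: k => [|k IH] Fk.
  split; [exact: sE|exact: (smooth_mx_cst oU)|move=> i j].
  by split=> // z ->; rewrite expF0 subrr.
have FkW : sc k FC (fun=> 0).
  by have [s1 s2 h] := Fk; split; [exact: s1|exact: s2|exact: flatW h].
have Ek := IH FkW.
have dF j : sc k (dz j FC) (fun=> 0).
  apply: (sc_trans oU U0 (sc_dz oU U0 j Fk)).
  apply: (sc_eq oU U0); first exact: (der_smooth (derivation_dz oU j) (smooth_cst oU _)).
  by move=> z Uz; rewrite (der_cst (derivation_dz oU j) _ Uz).
split; [exact: sE|exact: (smooth_mx_cst oU)|move=> i l].
apply: (cong_S oU U0 (sE i l) (smooth_cst oU _)); first by rewrite expF0.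
move=> j; have dj := derivation_dz oU j.
have h1 : sc k (dz j (fun z => expF z i l)) (fun z => dz j FC z * (gen *m expF z) i l).
  apply: (sc_eq oU U0 k (der_smooth dj (sE i l))) => z Uz.
  have /matrixP/(_ i l) := mxder_mexp_dz gen Fs j Uz.
  by rewrite mxE => ->; rewrite mxE.
have h2 : sc k (fun z => dz j FC z * (gen *m expF z) i l)
    (fun z => 0 * (gen *m expF z) i l).
  apply: (scM oU U0 (dF j)).
  exact: (scong_entry i l (scongM oU U0 (scong_cst oU U0 k gen) (scong_refl oU U0 k sE))).
have h3 : sc k (fun z => 0 * (gen *m expF z) i l) (dz j (fun z => (1%:M : 'M[C]_N) i l)).
  apply: (sc_eq oU U0); first by have [] := h2.
  by move=> z Uz; rewrite mul0r (der_cst dj _ Uz).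
by have [] := sc_trans oU U0 (sc_trans oU U0 h1 h2) h3.
Qed.

(* F has no terms in z alone in its Taylor expansion at 0. *)
Lemma sc_FC k : sc k FC (fun=> 0).
Proof.
elim: k => [|k IH].
  split; [exact: Fs|exact: (smooth_cst oU)|].
  by split=> // z ->; rewrite F0 subrr.
(* With E congruent to 1 up to order k, the formula for (dz_j F) [uF] has a right-hand side
   congruent to 0, by [eta0_incl]; dividing by [uF], which is -1 at 0, gains one order for F. *)
have Ek := sc_expF IH.
split; [exact: Fs|exact: (smooth_cst oU)|].
apply: (cong_S oU U0 Fs (smooth_cst oU _)); first by rewrite F0.
move=> j; have dj := derivation_dz oU j.
have su := smooth_uF a X r oU Fs.
have sd := der_smooth dj Fs.
have h1 : sc k (fun z => dz j FC z * uF z)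
    (fun z => - (eta z *m expF z *m (incl *m (delta_mx j 0 : V))) 0 0).
  apply: (sc_eq oU U0 k (smoothM oU sd su)) => z Uz.
  exact: (dz_FC oU Fs F_eq j Uz).
have h2 : sc k (fun z => - (eta z *m expF z *m (incl *m (delta_mx j 0 : V))) 0 0)
    (fun z => - (eta 0 *m 1%:M *m (incl *m (delta_mx j 0 : V))) 0 0).
  apply: (scN oU U0); apply: (scong_entry 0 0).
  exact: (scongM oU U0 (scongM oU U0 (scong_eta k) Ek) (scong_cst oU U0 k _)).
have h3 : sc k (fun z : V => - (eta 0 *m 1%:M *m (incl *m (delta_mx j 0 : V))) 0 0)
    (fun z => 0 * uF z).
  apply: (sc_eq oU U0); first exact: (smooth_cst oU).
  by move=> z Uz; rewrite mulmx1 eta0_incl mxE oppr0 mul0r.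
have h4 := sc_cancel oU U0 sd (smooth_cst oU 0) su uF0_neq0
  (sc_trans oU U0 (sc_trans oU U0 h1 h2) h3).
have h5 : sc k (fun=> 0) (dz j (fun=> 0)).
  apply: (sc_eq oU U0); first exact: (smooth_cst oU).
  by move=> z Uz; rewrite (der_cst dj _ Uz).
by have [] := sc_trans oU U0 h4 h5.
Qed.

Lemma scong_expF k : scong k expF (fun=> 1%:M).
Proof. exact: sc_expF (sc_FC k). Qed.

Lemma sc_uF k : sc k uF (fun=> -1).
Proof.
have h := scong_entry 0 0 (scongM oU U0 (scongM oU U0 (scongM oU U0 (scong_eta k)
  (scong_cst oU U0 k gen)) (scong_expF k)) (scong_refl oU U0 k (smooth_zeta oU))).
apply: (sc_trans oU U0 h); apply: (sc_eq oU U0); first by have [] := h.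
by move=> z Uz; rewrite mulmx1 eta0_gen_zeta !mxE eqxx.
Qed.

(** Together with [sc_FC]: at the level of jets, F is |z|^2 up to terms of degree at least 2 in
    zbar. *)
Lemma sc_dzbar_FC k l : sc k (dzbar l FC) (fun z => z l 0).
Proof.
have dl := derivation_dzbar oU l.
have su := smooth_uF a X r oU Fs.
have sd := der_smooth dl Fs.
pose e : V := delta_mx l 0.
have h1 : sc k (fun z => dzbar l FC z * uF z)
    (fun z => - (adjmx (incl *m e) *m J *m expF z *m zeta z) 0 0).
  apply: (sc_eq oU U0 k (smoothM oU sd su)) => z Uz.
  exact: (dzbar_FC oU Fs F_eq l Uz).
have h2 : sc k (fun z => - (adjmx (incl *m e) *m J *m expF z *m zeta z) 0 0)
    (fun z => - (adjmx (incl *m e) *m J *m 1%:M *m zeta z) 0 0).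
  apply: (scN oU U0); apply: (scong_entry 0 0).
  exact: (scongM oU U0 (scongM oU U0 (scong_cst oU U0 k _) (scong_expF k))
    (scong_refl oU U0 k (smooth_zeta oU))).
have h3 : sc k (fun z => - (adjmx (incl *m e) *m J *m 1%:M *m zeta z) 0 0)
    (fun z => z l 0 * -1).
  apply: (sc_eq oU U0); first by have [] := h2.
  move=> z Uz; rewrite mulmx1 adj_incl_J_zeta mulrN1; congr (- _).
  exact: adjmx_delta_mul.
have h4 : sc k (fun z => z l 0 * -1) (fun z => z l 0 * uF z).
  apply: (scM oU U0); first exact: (sc_refl oU U0 k (smooth_coord oU l)).
  exact: (sc_sym oU U0 (sc_uF k)).
exact: (sc_cancel oU U0 sd (smooth_coord oU l) su uF0_neq0
  (sc_trans oU U0 (sc_trans oU U0 (sc_trans oU U0 h1 h2) h3) h4)).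
Qed.

End PotentialJets.

(** * Lie derivatives of the potential and of the Kaehler form *)

Section LieDerivative.
Variables (R : realType) (n : nat).
Local Notation C := R[i].
Local Notation V := 'cV[C]_n.
Variables (F : V -> R) (U : set V).
Local Notation FC := (fun z : V => (F z)%:C).
Hypothesis oU : open U.
Hypothesis Fs : smooth_on U FC.
Implicit Types (v : V -> V) (z e : V).

Definition lieF v z : C := cdiff FC z (v z).

Lemma rderiv_lieF v z : U z -> rderiv (v z) FC z = lieF v z.
Proof. by move=> Uz; rewrite (rderivE _ oU (smooth_C1 Fs) Uz). Qed.

Let sdz l := der_smooth (derivation_dz oU l) Fs.
Let sdzbar l := der_smooth (derivation_dzbar oU l) Fs.

Lemma smooth_lieF v : smooth_mx U v -> smooth_on U (lieF v).
Proof.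
move=> vs; apply: (smooth_sum oU) => l.
apply: (smoothD oU); first exact: (smoothM oU (vs l 0) (sdz l)).
exact: (smoothM oU (smoothJ oU (vs l 0)) (sdzbar l)).
Qed.

Lemma FC_conj : (fun z => (FC z)^*) = FC.
Proof. by apply/funext => z; rewrite conjR. Qed.

Lemma dzbar_FC_conj l z : U z -> dzbar l FC z = (dz l FC z)^*.
Proof. by move=> Uz; rewrite -(dzbarJ l Fs Uz) FC_conj. Qed.

Lemma lieF_conj v z : U z -> (lieF v z)^* = lieF v z.
Proof.
move=> Uz; rewrite /lieF /cdiff.
apply: (@etrans _ _ (\sum_l (v z l 0 * dz l FC z + (v z l 0)^* * dzbar l FC z)^*)).
  exact: rmorph_sum.
apply: eq_bigr => l _.
rewrite (dzbar_FC_conj l Uz).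
move: (v z l 0) (dz l FC z) => x y.
by rewrite conjD !conjM !conjCK addrC.
Qed.

Lemma dzbar_lieF v k z : hol_mx U v -> U z -> dzbar k (lieF v) z =
  \sum_l (v z l 0 * dzbar k (dz l FC) z
    + ((dz k (fun x => v x l 0) z)^* * dzbar l FC z
       + (v z l 0)^* * dzbar k (dzbar l FC) z)).
Proof.
move=> vh Uz; have dk := derivation_dzbar oU k.
have vs l := (vh l 0).1.
have s1 l := smoothM oU (vs l) (sdz l).
have s2 l := smoothM oU (smoothJ oU (vs l)) (sdzbar l).
rewrite (der_sum oU dk _ _ (fun l => smoothD oU (s1 l) (s2 l)) Uz).
apply: eq_bigr => l _; rewrite (derD dk (s1 l) (s2 l) Uz).
rewrite (derM dk (vs l) (sdz l) Uz) (derM dk (smoothJ oU (vs l)) (sdzbar l) Uz).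
by rewrite ((vh l 0).2 k z Uz) mul0r add0r (dzbarJ k (vs l) Uz).
Qed.

Lemma dz_dzbar_lieF v j k z : hol_mx U v -> U z -> dz j (dzbar k (lieF v)) z =
  \sum_l ((dz j (fun x => v x l 0) z * dzbar k (dz l FC) z
       + v z l 0 * dz j (dzbar k (dz l FC)) z)
    + ((dz k (fun x => v x l 0) z)^* * dz j (dzbar l FC) z
       + (v z l 0)^* * dz j (dzbar k (dzbar l FC)) z)).
Proof.
move=> vh Uz; have dj := derivation_dz oU j; have dk := derivation_dzbar oU k.
have vs l := (vh l 0).1; have vkh l := hol_dz oU k (vh l 0).
have vks l := (vkh l).1.
have s1 l := smoothM oU (vs l) (der_smooth dk (sdz l)).
have s2 l := smoothM oU (smoothJ oU (vks l)) (sdzbar l).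
have s3 l := smoothM oU (smoothJ oU (vs l)) (der_smooth dk (sdzbar l)).
have E : eq_on U (dzbar k (lieF v)) (fun z => \sum_l (v z l 0 * dzbar k (dz l FC) z
    + ((dz k (fun x => v x l 0) z)^* * dzbar l FC z
       + (v z l 0)^* * dzbar k (dzbar l FC) z))).
  by move=> y Uy; exact: dzbar_lieF.
apply: etrans (der_eq dj (der_smooth dk (smooth_lieF (hol_mx_smooth vh))) E Uz) _.
apply: etrans (der_sum oU dj _ _
  (fun l => smoothD oU (s1 l) (smoothD oU (s2 l) (s3 l))) Uz) _.
apply: eq_bigr => l _.
apply: etrans (derD dj (s1 l) (smoothD oU (s2 l) (s3 l)) Uz) _.
congr (_ + _); first exact: (derM dj (vs l) (der_smooth dk (sdz l)) Uz).
apply: etrans (derD dj (s2 l) (s3 l) Uz) _.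
congr (_ + _).
  apply: etrans (derM dj (smoothJ oU (vks l)) (sdzbar l) Uz) _.
  by rewrite (dzJ j (vks l) Uz) ((vkh l).2 j z Uz) conjC0 mul0r add0r.
apply: etrans (derM dj (smoothJ oU (vs l)) (der_smooth dk (sdzbar l)) Uz) _.
by rewrite (dzJ j (vs l) Uz) ((vh l 0).2 j z Uz) conjC0 mul0r add0r.
Qed.

(** Holomorphy of v removes the terms in which dzbar_k meets v or dz_j meets its conjugate. For each
    l four terms remain on either side, and they match after the derivatives are commuted. *)
Lemma lie_kmetricE v j k z : hol_mx U v -> U z ->
  lie_kmetric F v j k z = dz j (dzbar k (lieF v)) z.
Proof.
move=> vh Uz; rewrite (dz_dzbar_lieF j k vh Uz) /lie_kmetric.
have dj := derivation_dz oU j; have dk := derivation_dzbar oU k.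
have sg : smooth_on U (kmetric F j k) by exact: (der_smooth dj (sdzbar k)).
rewrite (rderivE _ oU (smooth_C1 sg) Uz) /cdiff -big_split /=.
apply: eq_bigr => l _.
have E1 : dz l (kmetric F j k) z = dz j (dzbar k (dz l FC)) z.
  apply: etrans (commuting_dz oU l j (sdzbar k) Uz) _.
  apply: (der_eq dj (der_smooth (derivation_dz oU l) (sdzbar k)) _ Uz) => y Uy.
  exact: (commuting_dz_dzbar oU l k Fs Uy).
have E2 : dzbar l (kmetric F j k) z = dz j (dzbar k (dzbar l FC)) z.
  apply: etrans (esym (commuting_dz_dzbar oU j l (sdzbar k) Uz)) _.
  apply: (der_eq dj (der_smooth (derivation_dzbar oU l) (sdzbar k)) _ Uz) => y Uy.
  exact: (commuting_dzbar oU l k Fs Uy).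
have E3 : kmetric F l k z = dzbar k (dz l FC) z.
  exact: (commuting_dz_dzbar oU l k Fs Uz).
have add4 (x y s t : C) : x + y + (s + t) = s + x + (t + y) by ring.
apply: etrans (add4 _ _ _ _) _.
exact: (congr2 +%R (congr2 +%R (congr1 (GRing.mul _) E3) (congr1 (GRing.mul _) E1))
  (congr2 +%R (erefl _) (congr1 (GRing.mul _) E2))).
Qed.

(** Modulo zbar, dz_l F is 0, dzbar_l F is z_l, and the conjugate of v is its value at 0. *)
Lemma sc_lieF v k (a : 'cV[R]_n) (X : 'M[R]_n) (r : R) :
  U 0 -> (forall z, U z -> eta z *m expF a X r F z *m zeta z = 0) -> F 0 = 0 ->
  hol_mx U v -> sc U k (lieF v) (fun z => (adjmx (v 0) *m z) 0 0).
Proof.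
move=> U0 F_eq F0 vh.
have h : sc U k (lieF v) (fun z => \sum_l (v z l 0 * dz l (fun=> (0 : C)) z
    + (v 0 l 0)^* * z l 0)).
  have term l : sc U k
      (fun z => v z l 0 * dz l FC z + (v z l 0)^* * dzbar l FC z)
      (fun z => v z l 0 * dz l (fun=> (0 : C)) z + (v 0 l 0)^* * z l 0).
    apply: (scD oU U0); apply: (scM oU U0).
    - exact: (sc_refl oU U0 k (vh l 0).1).
    - exact: (sc_dz oU U0 l (sc_FC oU U0 Fs F_eq F0 k.+1)).
    - have := scong_entry 0 l (scong_adjmx_hol oU U0 k vh).
      by under eq_fun do rewrite !mxE; under [X in sc _ _ _ X]eq_fun do rewrite !mxE.
    - exact: (sc_dzbar_FC oU U0 Fs F_eq F0 k l).
  split.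
  - exact: (smooth_lieF (hol_mx_smooth vh)).
  - by apply: (smooth_sum oU) => l; have [] := term l.
  - apply: (cong_sum oU U0) => l; last by move=> _; have [] := term l.
      by have [] := term l.
    by have [] := term l.
apply: (sc_trans oU U0 h); apply: (sc_eq oU U0); first by have [] := h.
move=> z Uz; rewrite mxE; apply: eq_bigr => l _.
by rewrite (der_cst (derivation_dz oU l) _ Uz) mulr0 add0r !mxE.
Qed.

End LieDerivative.

(** * Killing fields *)

Section KillingFields.
Variables (R : realType) (n : nat).
Local Notation C := R[i].
Local Notation V := 'cV[C]_n.
Variables (a : 'cV[R]_n) (X : 'M[R]_n) (r : R) (F : V -> R).
Hypothesis X_diag : is_diag_mx X.
Local Notation J := (Jmx R n).
Local Notation FC := (fun z : V => (F z)%:C).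
Local Notation gen := (gen a X r).
Local Notation expF := (expF a X r F).
Local Notation uF := (uF a X r F).
Local Notation zeta := (@zeta R n).
Local Notation eta := (@eta R n).
Local Notation incl := (incl R n).
Variable U : set V.
Hypotheses (oU : open U) (U0 : U 0).
Hypothesis Fs : smooth_on U FC.
Hypothesis F_eq : forall z, U z -> eta z *m expF z *m zeta z = 0.
Hypothesis F0 : F 0 = 0.
Local Notation sc := (sc U).
Local Notation scong := (scong U).
Variable v : V -> V.
Hypothesis vh : hol_mx U v.
Hypothesis v_killing : forall j k z, U z -> dz j (dzbar k (lieF F v)) z = 0.
Implicit Types (z : V) (k : 'I_n).

Let S := lieF F v.
Let e k : V := delta_mx k 0.
Let dk k := derivation_dzbar oU k.
Let sv := hol_mx_smooth vh.
Let sS := smooth_lieF oU Fs sv.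
Let sE := smooth_expF a X r oU Fs.
Let sz := smooth_zeta oU.
Let se := smooth_eta oU.
Let su := smooth_uF a X r oU Fs.
Let cst p q (M : 'M[C]_(p, q)) := smooth_mx_cst oU M.
Let siv : smooth_mx U (fun z => incl *m v z) := smooth_mxM oU (cst incl) sv.
Let sq1 : smooth_mx U (fun z => adjmx (incl *m v z) *m J *m expF z *m zeta z) :=
  smooth_mxM oU (smooth_mxM oU (smooth_mxM oU (smooth_adjmx oU siv) (cst J)) sE) sz.
Let sq2 : smooth_mx U (fun z => eta z *m expF z *m (incl *m v z)) :=
  smooth_mxM oU (smooth_mxM oU se sE) siv.

Lemma lieF_identity z : U z -> S z * uF z +
  ((adjmx (incl *m v z) *m J *m expF z *m zeta z) 0 0
   + (eta z *m expF z *m (incl *m v z)) 0 0) = 0.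
Proof.
move=> Uz; have := rderiv_FC oU Fs F_eq (v z) Uz.
rewrite (rderiv_lieF oU Fs v Uz) => ->.
by rewrite [X in - X]mxE addNr.
Qed.

Lemma mxder_expF k z : U z ->
  mxder (dzbar k) expF z = dzbar k FC z *: (gen *m expF z).
Proof. by move=> Uz; exact: (mxder_mexp_dzbar gen Fs k Uz). Qed.

Lemma dzbar_uF k z : U z -> dzbar k uF z =
  (adjmx (incl *m e k) *m J *m gen *m expF z *m zeta z
   + eta z *m gen *m (dzbar k FC z *: (gen *m expF z)) *m zeta z) 0 0.
Proof.
move=> Uz; have s1 := smooth_mxM oU se (cst gen); have s2 := smooth_mxM oU s1 sE.
have := mxderM oU (dk k) s2 sz Uz.
rewrite (mxderM oU (dk k) s1 sE Uz) (mxderM oU (dk k) se (cst gen) Uz).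
rewrite (mxder_cst (dk k) _ Uz) mulmx0 addr0 (mxder_dzbar_eta oU k Uz).
rewrite (mxder_dzbar_zeta oU k Uz) mulmx0 addr0 (mxder_expF k Uz) mulmxDl.
by move=> /matrixP/(_ 0 0); rewrite mxE.
Qed.

Lemma mxder_q1 k z : U z ->
  mxder (dzbar k) (fun z => adjmx (incl *m v z) *m J *m expF z *m zeta z) z =
  adjmx (incl *m mxder (dz k) v z) *m J *m expF z *m zeta z
  + adjmx (incl *m v z) *m J *m (dzbar k FC z *: (gen *m expF z)) *m zeta z.
Proof.
move=> Uz; have s0 := smooth_adjmx oU siv; have s1 := smooth_mxM oU s0 (cst J).
rewrite (mxderM oU (dk k) (smooth_mxM oU s1 sE) sz Uz).
rewrite (mxderM oU (dk k) s1 sE Uz) (mxderM oU (dk k) s0 (cst J) Uz).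
rewrite (mxder_cst (dk k) _ Uz) mulmx0 addr0 (mxder_dzbar_zeta oU k Uz) mulmx0 addr0.
rewrite (mxder_dzbarJ k siv Uz) (mxderM oU (derivation_dz oU k) (cst incl) sv Uz).
rewrite (mxder_cst (derivation_dz oU k) _ Uz) mul0mx add0r (mxder_expF k Uz).
by rewrite mulmxDl.
Qed.

Lemma mxder_q2 k z : U z ->
  mxder (dzbar k) (fun z => eta z *m expF z *m (incl *m v z)) z =
  adjmx (incl *m e k) *m J *m expF z *m (incl *m v z)
  + eta z *m (dzbar k FC z *: (gen *m expF z)) *m (incl *m v z).
Proof.
move=> Uz; rewrite (mxderM oU (dk k) (smooth_mxM oU se sE) siv Uz).
rewrite (mxderM oU (dk k) se sE Uz) (mxderM oU (dk k) (cst incl) sv Uz).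
rewrite (mxder_cst (dk k) _ Uz) mul0mx add0r (mxder_dzbar_hol k vh Uz) !mulmx0 addr0.
by rewrite (mxder_dzbar_eta oU k Uz) (mxder_expF k Uz) mulmxDl.
Qed.

(** As v F is real, its dzbar_k is the conjugate of its dz_k, and the latter is read off
    [sc_lieF]. *)
Lemma dzbar_lieF0 k : dzbar k S 0 = v 0 k 0.
Proof.
have SJ : eq_on U (fun z => (S z)^*) S by move=> z Uz; exact: lieF_conj.
rewrite -(der_eq (dk k) (smoothJ oU sS) SJ U0) (dzbarJ k sS U0).
have h := sc_lieF oU Fs 1 U0 F_eq F0 vh.
rewrite (sc_val (sc_dz oU U0 k h)).
have dz_k := derivation_dz oU k.
have s := smooth_mxM oU (cst (adjmx (v 0))) (smooth_mx_id oU).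
have /matrixP/(_ 0 0) := mxderM oU dz_k (cst (adjmx (v 0))) (smooth_mx_id oU) U0.
rewrite (mxder_cst dz_k _ U0) mul0mx add0r mxder_dz_id mxE => ->.
have -> : (adjmx (v 0) *m (delta_mx k 0 : V)) 0 0 =
    ((adjmx (delta_mx k 0 : V) *m v 0) 0 0)^*.
  rewrite -[in LHS](adjmxK (delta_mx k 0 : V)) -adjmxM.
  by rewrite !mxE.
by rewrite adjmx_delta_mul conjCK.
Qed.

(** The Killing condition enters here: it makes dzbar_k (v F) antiholomorphic, so that only its
    value at 0 survives modulo zbar. *)
Lemma sc_dzbar_lieF p k : sc p (dzbar k S) (fun=> v 0 k 0).
Proof.
rewrite -dzbar_lieF0; apply: (sc_cst oU U0 p); first exact: (der_smooth (dk k) sS).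
by move=> j z Uz; exact: v_killing.
Qed.

Lemma killing_identity k z : U z ->
  dzbar k S z * uF z
  + S z * (adjmx (incl *m e k) *m J *m gen *m expF z *m zeta z
     + eta z *m gen *m (dzbar k FC z *: (gen *m expF z)) *m zeta z) 0 0
  + ((adjmx (incl *m mxder (dz k) v z) *m J *m expF z *m zeta z
      + adjmx (incl *m v z) *m J *m (dzbar k FC z *: (gen *m expF z)) *m zeta z) 0 0
     + (adjmx (incl *m e k) *m J *m expF z *m (incl *m v z)
      + eta z *m (dzbar k FC z *: (gen *m expF z)) *m (incl *m v z)) 0 0) = 0.
Proof.
move=> Uz.
have s1 := smoothM oU sS su; have s2 := smoothD oU (sq1 0 0) (sq2 0 0).
have E := der_eq (dk k) (smoothD oU s1 s2) lieF_identity Uz.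
have E1 := derD (dk k) s1 s2 Uz.
have E2 := derM (dk k) sS su Uz.
have E3 := derD (dk k) (sq1 0 0) (sq2 0 0) Uz.
have E4 : dzbar k (fun z => (adjmx (incl *m v z) *m J *m expF z *m zeta z) 0 0) z =
    (adjmx (incl *m mxder (dz k) v z) *m J *m expF z *m zeta z
      + adjmx (incl *m v z) *m J *m (dzbar k FC z *: (gen *m expF z)) *m zeta z) 0 0.
  by rewrite -(mxder_q1 k Uz) [RHS]mxE.
have E5 : dzbar k (fun z => (eta z *m expF z *m (incl *m v z)) 0 0) z =
    (adjmx (incl *m e k) *m J *m expF z *m (incl *m v z)
      + eta z *m (dzbar k FC z *: (gen *m expF z)) *m (incl *m v z)) 0 0.
  by rewrite -(mxder_q2 k Uz) [RHS]mxE.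
apply: etrans (etrans E (der_cst (dk k) 0 Uz)).
apply: etrans (esym E1); congr (_ + _).
  by apply: etrans (esym E2); rewrite -(dzbar_uF k Uz).
by apply: etrans (esym E3); rewrite E4 E5.
Qed.

Lemma sc_killing p k : sc p
  (fun z => dzbar k S z * uF z
  + S z * (adjmx (incl *m e k) *m J *m gen *m expF z *m zeta z
     + eta z *m gen *m (dzbar k FC z *: (gen *m expF z)) *m zeta z) 0 0
  + ((adjmx (incl *m mxder (dz k) v z) *m J *m expF z *m zeta z
      + adjmx (incl *m v z) *m J *m (dzbar k FC z *: (gen *m expF z)) *m zeta z) 0 0
     + (adjmx (incl *m e k) *m J *m expF z *m (incl *m v z)
      + eta z *m (dzbar k FC z *: (gen *m expF z)) *m (incl *m v z)) 0 0))
  (fun z => v 0 k 0 * -1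
  + (adjmx (v 0) *m z) 0 0 * (adjmx (incl *m e k) *m J *m gen *m 1%:M *m zeta z
     + eta 0 *m gen *m (z k 0 *: (gen *m 1%:M)) *m zeta z) 0 0
  + ((adjmx (incl *m mxder (dz k) v 0) *m J *m 1%:M *m zeta z
      + adjmx (incl *m v 0) *m J *m (z k 0 *: (gen *m 1%:M)) *m zeta z) 0 0
     + (adjmx (incl *m e k) *m J *m 1%:M *m (incl *m v z)
      + eta 0 *m (z k 0 *: (gen *m 1%:M)) *m (incl *m v z)) 0 0)).
Proof.
have ce := scong_eta oU U0 p.
have cE := scong_expF oU U0 Fs F_eq F0 p.
have cF := sc_dzbar_FC oU U0 Fs F_eq F0 p k.
have cz := scong_refl oU U0 p sz.
have cc q s (M : 'M[C]_(q, s)) := scong_cst oU U0 p M.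
have cgE : scong p (fun z => dzbar k FC z *: (gen *m expF z))
    (fun z => z k 0 *: (gen *m 1%:M)).
  exact: (scongZ oU U0 cF (scongM oU U0 (cc _ _ gen) cE)).
have hdv : hol_mx U (mxder (dz k) v).
  by move=> i j; apply: (hol_eq oU _ (hol_dz oU k (vh i j))) => z _; rewrite mxE.
have civ := scong_adjmx_hol oU U0 p (hol_mxM oU (hol_mx_cst oU incl) vh).
have cidv := scong_adjmx_hol oU U0 p (hol_mxM oU (hol_mx_cst oU incl) hdv).
have cv := scong_refl oU U0 p siv.
apply: (scD oU U0); first apply: (scD oU U0).
- exact: (scM oU U0 (sc_dzbar_lieF p k) (sc_uF oU U0 Fs F_eq F0 p)).
- apply: (scM oU U0 (sc_lieF oU Fs p U0 F_eq F0 vh)); apply: (scong_entry 0 0).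
  apply: (scongD oU U0).
    exact: (scongM oU U0 (scongM oU U0 (cc _ _ _) cE) cz).
  exact: (scongM oU U0 (scongM oU U0 (scongM oU U0 ce (cc _ _ gen)) cgE) cz).
- apply: (scD oU U0); apply: (scong_entry 0 0); apply: (scongD oU U0).
  + exact: (scongM oU U0 (scongM oU U0 (scongM oU U0 cidv (cc _ _ J)) cE) cz).
  + exact: (scongM oU U0 (scongM oU U0 (scongM oU U0 civ (cc _ _ J)) cgE) cz).
  + exact: (scongM oU U0 (scongM oU U0 (cc _ _ _) cE) cv).
  + exact: (scongM oU U0 (scongM oU U0 ce cgE) cv).
Qed.

(* The value of H read off v = b + i H z + O(|z|^2), with the adjoint that the
   Taylor coefficients of the identity produce; jetH_hermitian makes it immaterial. *)
Definition jetH : 'M[C]_n := 'i *: adjmx (\matrix_(l, k) dz k (fun z => v z l 0) 0).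

(** The left-hand side is what [sc_killing] leaves modulo zbar. The exponential has disappeared from
    it, v at z occurs in a single term, and the rest is a polynomial in z; this is the origin of
    [leaf_field]. *)
Lemma killing_polynomial k z :
  v 0 k 0 * -1
  + (adjmx (v 0) *m z) 0 0 * (adjmx (incl *m e k) *m J *m gen *m 1%:M *m zeta z
     + eta 0 *m gen *m (z k 0 *: (gen *m 1%:M)) *m zeta z) 0 0
  + ((adjmx (incl *m mxder (dz k) v 0) *m J *m 1%:M *m zeta z
      + adjmx (incl *m v 0) *m J *m (z k 0 *: (gen *m 1%:M)) *m zeta z) 0 0
     + (adjmx (incl *m e k) *m J *m 1%:M *m (incl *m v z)
      + eta 0 *m (z k 0 *: (gen *m 1%:M)) *m (incl *m v z)) 0 0) =
  v z k 0 - leaf_field a X jetH (v 0) z k 0.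
Proof.
have T (P : 'rV[C]_(1 + (n + 1))) G c (Q : 'cV[C]_(1 + (n + 1))) :
    P *m (c *: (G *m 1%:M)) *m Q = c *: (P *m (G *m Q)).
  by rewrite mulmx1 -scalemxAr -scalemxAl mulmxA.
have T1 : adjmx (incl *m e k) *m J *m gen *m 1%:M *m zeta z =
    - 2 *: (adjmx (e k) *m (cmx X *m z)).
  by rewrite mulmx1 -(mulmxA _ gen) adj_incl_J_gen_zeta.
have T2 : eta 0 *m gen *m (z k 0 *: (gen *m 1%:M)) *m zeta z =
    z k 0 *: (- 4 *: (adjmx (cmx a) *m z)).
  exact: etrans (T _ _ _ _) (congr1 (GRing.scale _) (eta0_gen_gen_zeta _ _ _ _)).
have T3 (w : V) : adjmx (incl *m w) *m J *m 1%:M *m zeta z = adjmx w *m z.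
  exact: etrans (congr1 (mulmx^~ _) (mulmx1 _)) (adj_incl_J_zeta _ _).
have T4 : adjmx (incl *m v 0) *m J *m (z k 0 *: (gen *m 1%:M)) *m zeta z =
    z k 0 *: (- 2 *: (adjmx (v 0) *m (cmx X *m z))).
  exact: etrans (T _ _ _ _) (congr1 (GRing.scale _) (adj_incl_J_gen_zeta _ _ _ _ _)).
have T5 : adjmx (incl *m e k) *m J *m 1%:M *m (incl *m v z) = adjmx (e k) *m v z.
  exact: etrans (congr1 (mulmx^~ _) (mulmx1 _)) (adj_incl_J_incl _ _).
have T6 : eta 0 *m (z k 0 *: (gen *m 1%:M)) *m (incl *m v z) = 0.
  apply: etrans (T _ _ _ _) _; rewrite mulmxA.
  exact: etrans (congr1 (GRing.scale _) (eta0_gen_incl _ _ _ _)) (scaler0 _ _).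
have Z (d : C) (P : 'M[C]_1) : (d *: P) 0 0 = d * P 0 0 by rewrite mxE.
have E (P Q P' Q' : 'M[C]_1) c d : P = P' -> Q = Q' -> P' 0 0 = c -> Q' 0 0 = d ->
    (P + Q) 0 0 = c + d.
  by move=> -> -> <- <-; rewrite mxE.
have E1 : (- 2 *: (adjmx (e k) *m (cmx X *m z))) 0 0 = - 2 * (cmx X *m z) k 0.
  by rewrite Z adjmx_delta_mul.
have E2 : (z k 0 *: (- 4 *: (adjmx (cmx a) *m z))) 0 0 =
    z k 0 * (- 4 * (adjmx (cmx a) *m z) 0 0).
  by rewrite !Z.
have E4 : (z k 0 *: (- 2 *: (adjmx (v 0) *m (cmx X *m z)))) 0 0 =
    z k 0 * (- 2 * (adjmx (v 0) *m (cmx X *m z)) 0 0).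
  by rewrite !Z.
have E6 : (0 : 'M[C]_1) 0 0 = 0 by rewrite mxE.
apply: etrans (congr2 +%R (congr2 +%R (erefl _)
    (congr1 (GRing.mul _) (E _ _ _ _ _ _ T1 T2 E1 E2)))
  (congr2 +%R (E _ _ _ _ _ _ (T3 _) T4 (erefl _) E4)
    (E _ _ _ _ _ _ T5 T6 (adjmx_delta_mul _ _) E6))) _.
have H1 : (adjmx (mxder (dz k) v 0) *m z) 0 0 = - ('i * (jetH *m z) k 0).
  have i2 : ('i : C) * 'i = -1 by exact: mulii.
  rewrite /jetH -scalemxAl [in RHS]mxE mulrA i2 mulN1r opprK !mxE.
  by apply: eq_bigr => l _; rewrite !mxE.
have H2 : leaf_field a X jetH (v 0) z k 0 = v 0 k 0 + 'i * (jetH *m z) k 0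
    + 2 * (adjmx (v 0) *m cmx X *m z) 0 0 * z k 0
    + 2 * (adjmx (v 0) *m z) 0 0 * (cmx X *m z) k 0
    + 4 * (adjmx (v 0) *m z) 0 0 * (adjmx (cmx a) *m z) 0 0 * z k 0.
  have D' (P Q : V) : (P + Q) k 0 = P k 0 + Q k 0 by rewrite mxE.
  have Z' (c : C) (P : V) : (c *: P) k 0 = c * P k 0 by rewrite mxE.
  by rewrite /leaf_field !D' !Z'.
rewrite H1 H2 -(mulmxA _ (cmx X)).
move: (v 0 k 0) ('i * _) ((adjmx (v 0) *m z) 0 0) ((cmx X *m z) k 0)
  ((adjmx (cmx a) *m z) 0 0) ((adjmx (v 0) *m _) 0 0) (z k 0) (v z k 0).
by move=> *; ring.
Qed.

End KillingFields.

Section LeafFieldJet.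
Variables (R : realType) (n : nat).
Local Notation C := R[i].
Local Notation V := 'cV[C]_n.
Variables (a : 'cV[R]_n) (X : 'M[R]_n).
Variable U : set V.
Hypotheses (oU : open U) (U0 : U 0).
Implicit Types (H : 'M[C]_n) (b z : V).

Lemma hol_mul_entry p (M : 'M[C]_(p, n)) i : hol U (fun z => (M *m z) i 0).
Proof. exact: (hol_mxM oU (hol_mx_cst oU M) (hol_mx_id oU) i 0). Qed.

Lemma hol_leaf_field H b : hol_mx U (leaf_field a X H b).
Proof.
have hM (M : 'M[C]_n) := hol_mxM oU (hol_mx_cst oU M) (hol_mx_id oU).
have hs c (M : 'rV[C]_n) := holM oU (hol_cst oU c) (hol_mul_entry M 0).
apply: (hol_mxD oU); first apply: (hol_mxD oU); first apply: (hol_mxD oU).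
- exact: (hol_mxD oU (hol_mx_cst oU b) (hol_mxZ oU (hol_cst oU 'i) (hM H))).
- exact: (hol_mxZ oU (hs 2 _) (hol_mx_id oU)).
- exact: (hol_mxZ oU (hs 2 _) (hM (cmx X))).
- exact: (hol_mxZ oU (holM oU (hs 4 _) (hol_mul_entry (adjmx (cmx a)) 0)) (hol_mx_id oU)).
Qed.

Lemma mxderZ0 D (f : V -> C) p q (M : V -> 'M[C]_(p, q)) : derivation U D ->
  hol U f -> hol_mx U M -> f 0 = 0 -> M 0 = 0 -> mxder D (fun z => f z *: M z) 0 = 0.
Proof.
move=> dD [fs _] /hol_mx_smooth Ms f0 M0.
by apply: etrans (mxderZ dD fs Ms U0) _; rewrite f0 M0 scaler0 scale0r addr0.
Qed.

Lemma mxder_dz_leaf_field H b l :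
  mxder (dz l) (leaf_field a X H b) 0 = 'i *: (H *m (delta_mx l 0 : V)).
Proof.
have dl := derivation_dz oU l.
have hM (M : 'M[C]_n) := hol_mxM oU (hol_mx_cst oU M) (hol_mx_id oU).
have hs c (M : 'rV[C]_n) := holM oU (hol_cst oU c) (hol_mul_entry M 0).
have h1 := hol_mxZ oU (hol_cst oU 'i) (hM H).
have h01 := hol_mxD oU (hol_mx_cst oU b) h1.
have h2 := hol_mxZ oU (hs 2 (adjmx b *m cmx X)) (hol_mx_id oU).
have h3 := hol_mxZ oU (hs 2 (adjmx b)) (hM (cmx X)).
have hq := holM oU (hs 4 (adjmx b)) (hol_mul_entry (adjmx (cmx a)) 0).
have h4 := hol_mxZ oU hq (hol_mx_id oU).
have h012 := hol_mxD oU h01 h2; have h0123 := hol_mxD oU h012 h3.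
have s p q (M : V -> 'M[C]_(p, q)) (h : hol_mx U M) := hol_mx_smooth h.
have m0 (M : 'rV[C]_n) : (M *m (0 : V)) 0 0 = 0 by rewrite mulmx0 mxE.
have e2 : mxder (dz l) (fun z : V => (2 * (adjmx b *m cmx X *m z) 0 0) *: z) 0 = 0.
  by apply: (mxderZ0 dl (hs 2 _) (hol_mx_id oU)); rewrite ?m0 ?mulr0.
have e3 : mxder (dz l) (fun z : V => (2 * (adjmx b *m z) 0 0) *: (cmx X *m z)) 0 = 0.
  by apply: (mxderZ0 dl (hs 2 _) (hM _)); rewrite ?m0 ?mulr0 ?mulmx0.
have e4 : mxder (dz l)
    (fun z : V => (4 * (adjmx b *m z) 0 0 * (adjmx (cmx a) *m z) 0 0) *: z) 0 = 0.
  by apply: (mxderZ0 dl hq (hol_mx_id oU)); rewrite ?m0 ?mulr0.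
have e1 : mxder (dz l) (fun z : V => b + 'i *: (H *m z)) 0 =
    'i *: (H *m (delta_mx l 0 : V)).
  apply: etrans (mxderD dl (smooth_mx_cst oU b) (s _ _ _ h1) U0) _.
  rewrite (mxder_cst dl b U0) add0r.
  apply: etrans (mxderZ dl (smooth_cst oU 'i) (s _ _ _ (hM H)) U0) _.
  rewrite (der_cst dl 'i U0) scale0r add0r; congr (_ *: _).
  apply: etrans (mxderM oU dl (smooth_mx_cst oU H) (smooth_mx_id oU) U0) _.
  by rewrite (mxder_cst dl H U0) mul0mx add0r mxder_dz_id.
apply: etrans (mxderD dl (s _ _ _ h0123) (s _ _ _ h4) U0) _.
apply: etrans (congr2 +%R (mxderD dl (s _ _ _ h012) (s _ _ _ h3) U0) e4) _.
rewrite addr0.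
apply: etrans (congr2 +%R (mxderD dl (s _ _ _ h01) (s _ _ _ h2) U0) e3) _.
by rewrite addr0; apply: etrans (congr2 +%R e1 e2) (addr0 _).
Qed.

Lemma leaf_field0 H b : leaf_field a X H b 0 = b.
Proof. by rewrite /leaf_field !mulmx0 !scaler0 !addr0. Qed.

(** Let W be the matrix of first derivatives of v at 0. By definition H is 'i times the adjoint of
    W, and the equality with [leaf_field] gives W = 'i H; eliminating W shows that H is its own
    adjoint. *)
Lemma jetH_hermitian (v : V -> V) : hol_mx U v ->
  (forall z, U z -> v z = leaf_field a X (jetH v) (v 0) z) ->
  adjmx (jetH v) = jetH v.
Proof.
move=> vh vE.
pose W : 'M[C]_n := \matrix_(l, k) dz k (fun z => v z l 0) 0.
have i2 : ('i : C) * 'i = -1 by exact: mulii.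
have HW : W = 'i *: jetH v.
  apply/matrixP => l k; rewrite mxE.
  have := mxder_eq (derivation_dz oU k) (hol_mx_smooth vh) vE U0.
  rewrite mxder_dz_leaf_field => /matrixP/(_ l 0); rewrite mxE => ->.
  rewrite !mxE (bigD1 k)//= big1 ?addr0 => [|j jk]; rewrite !mxE ?eqxx ?mulr1//.
  by rewrite (negPf jk) mulr0.
have jE : jetH v = 'i *: adjmx W by [].
rewrite {1}jE adjmxZ adjmxK conjI HW scalerA.
by rewrite mulNr i2 opprK scale1r.
Qed.

End LeafFieldJet.

Section Restriction.
Variables (R : realType) (m : nat).
Local Notation C := R[i].
Local Notation V := 'cV[C]_m.
Variables U U' : set V.
Hypothesis UU' : U' `<=` U.

Lemma smooth_onW (f : V -> C) : smooth_on U f -> smooth_on U' f.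
Proof.
move=> fs k; elim: k f fs => [|k IH] f fs; have [fc _] := fs 0%N.
  by split; [move=> z /UU'; exact: fc|].
split; first by move=> z /UU'; exact: fc.
split=> [z e /UU' Uz|e]; first exact: (smooth_rderivable e fs Uz).
by apply: IH; exact: (smooth_rderiv e fs).
Qed.

Lemma holW (f : V -> C) : hol U f -> hol U' f.
Proof. by move=> [fs fh]; split; [exact: smooth_onW|move=> k z /UU'; exact: fh]. Qed.

Lemma hol_mxW p q (M : V -> 'M[C]_(p, q)) : hol_mx U M -> hol_mx U' M.
Proof. by move=> Mh i j; exact: holW. Qed.

End Restriction.

(** Both signs are provided in order to separate the parts of even and of odd degree of a polynomial
    that vanishes near 0. *)
Lemma near0_pm (R : realType) m (P : 'cV[R[i]]_m -> Prop) (y : 'cV[R[i]]_m) :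
  (\forall z \near (0 : 'cV[R[i]]_m), P z) ->
  exists2 t : R, 0 < t & P (t%:C *: y) /\ P ((- t)%:C *: y).
Proof.
move=> /near0_open[U [oU U0 UP]]; have := near_line oU y U0.
move=> /nbhs_ballP[_ /posnumP[r] rU].
have r20 : 0 < r%:num / 2 :> R by rewrite divr_gt0.
have r2r : r%:num / 2 < r%:num :> R by rewrite ltr_pdivrMr// ltr_pMr// ltr1n.
exists (r%:num / 2) => //; split; apply: UP; rewrite -[X in U X]add0r; apply: rU.
  by rewrite -ball_normE /ball_ /= sub0r normrN gtr0_norm.
by rewrite -ball_normE /ball_ /= sub0r opprK gtr0_norm.
Qed.

Lemma dz_dzbar_holDJ (R : realType) m (U : set 'cV[R[i]]_m) (f g : 'cV[R[i]]_m -> R[i])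
    j k z : open U -> hol U f -> hol U g -> U z ->
  dz j (dzbar k (fun z => f z + (g z)^*)) z = 0.
Proof.
move=> oU [fs fh] gh Uz; have [gs _] := gh; have [dgs dgh] := hol_dz oU k gh.
have dk := derivation_dzbar oU k; have dj := derivation_dz oU j.
have E : eq_on U (dzbar k (fun z => f z + (g z)^*)) (fun z => (dz k g z)^*).
  move=> y Uy; apply: etrans (derD dk fs (smoothJ oU gs) Uy) _.
  by rewrite (fh k y Uy) add0r (dzbarJ k gs Uy).
have s := smoothD oU fs (smoothJ oU gs).
apply: etrans (der_eq dj (der_smooth dk s) E Uz) _.
by rewrite (dzJ j dgs Uz) (dgh j z Uz) conjC0.
Qed.

(* dz k h is holomorphic and flat at 0, hence 0; as h is real, h is then
   holomorphic itself. *)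
Lemma pluriharmonic_real_flat_eq0 (R : realType) m (U : set 'cV[R[i]]_m)
    (h : 'cV[R[i]]_m -> R[i]) : open U -> U 0 -> smooth_on U h ->
  (forall z, U z -> (h z)^* = h z) ->
  (forall j k z, U z -> dz j (dzbar k h) z = 0) ->
  (forall p, sc U p h (fun=> 0)) -> \forall z \near (0 : 'cV[R[i]]_m), h z = 0.
Proof.
move=> oU U0 hs hJ hh hf.
have sc0 p j : sc U p (dz j h) (fun=> 0).
  apply: (sc_trans oU U0 (sc_dz oU U0 j (hf p.+1))); apply: (sc_eq oU U0).
    exact: (der_smooth (derivation_dz oU j) (smooth_cst oU _)).
  by move=> z Uz; rewrite (der_cst (derivation_dz oU j) _ Uz).
have dh k : hol U (dz k h).
  split; first exact: (der_smooth (derivation_dz oU k) hs).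
  move=> j z Uz; apply: etrans (esym (commuting_dz_dzbar oU k j hs Uz)) _.
  exact: hh.
have near_k k := sc_hol_eq oU U0 (dh k) (hol_cst oU 0) (fun p => sc0 p k).
have near_all : \forall z \near (0 : 'cV[R[i]]_m), forall k, dz k h z = 0.
  exact: (@filter_forall _ 'I_m _ (nbhs (0 : 'cV[R[i]]_m)) _ near_k).
have Unear : \forall z \near (0 : 'cV[R[i]]_m), U z by exact: open_nbhs_nbhs.
have [U' [oU' U'0 U'P]] := near0_open (filterI near_all Unear).
have UU' : U' `<=` U by move=> z /U'P[].
have hol_h : hol U' h.
  split; first exact: (smooth_onW UU' hs).
  move=> k z U'z; have Uz := UU' z U'z; have [dz0 _] := U'P z U'z.
  have hJ' : eq_on U (fun z => (h z)^*) h by move=> y; exact: hJ.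
  rewrite -(der_eq (derivation_dzbar oU k) (smoothJ oU hs) hJ' Uz).
  by rewrite (dzbarJ k hs Uz) dz0 conjC0.
apply: (hol_flat_eq0 oU' U'0 hol_h) => p.
have Z0U : [set 0] `<=` U by move=> z ->.
have [_ _ hp] := hf p.
apply: (flat_eq oU Z0U _ _ hp); first exact: (smoothB oU hs (smooth_cst oU 0)).
by move=> z _; rewrite subr0.
Qed.

Section LeafFieldKilling.
Variables (R : realType) (n : nat).
Local Notation C := R[i].
Local Notation V := 'cV[C]_n.
Variables (a : 'cV[R]_n) (X : 'M[R]_n) (r : R) (F : V -> R).
Hypothesis X_diag : is_diag_mx X.
Local Notation J := (Jmx R n).
Local Notation A := (Amx a X r).
Local Notation FC := (fun z : V => (F z)%:C).
Local Notation gen := (gen a X r).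
Local Notation expF := (expF a X r F).
Local Notation uF := (uF a X r F).
Local Notation zeta := (@zeta R n).
Local Notation eta := (@eta R n).
Local Notation incl := (incl R n).
Variable U : set V.
Hypotheses (oU : open U) (U0 : U 0).
Hypothesis Fs : smooth_on U FC.
Hypothesis F_eq : forall z, U z -> eta z *m expF z *m zeta z = 0.
Hypothesis F0 : F 0 = 0.
Variables (H : 'M[C]_n) (b : V).
Hypothesis hH : adjmx H = H.
Local Notation B := (Bmx a X H b).
Implicit Types (z : V) (k : 'I_n).

(** 2 Re <z, c>, the value of v F for the field of an admissible pair with vector [c]. *)
Definition lie_potential (c : V) z : C :=
  (adjmx c *m z) 0 0 + ((adjmx c *m z) 0 0)^*.

(* Zero when B commutes with A, and conversely by exp_defect_admissible. *)
Definition exp_defect z : C :=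
  (eta z *m (expF z *m B - B *m expF z) *m zeta z) 0 0.

Lemma adj_linear_J (M : 'M[C]_(1 + (n + 1))) z (P : 'M[C]_(1 + (n + 1))) :
  adjmx M *m J = - (J *m M) ->
  adjmx (M *m zeta z) *m J *m P *m zeta z = - (eta z *m (M *m P) *m zeta z).
Proof.
move=> MJ; rewrite adjmxM /eta -!mulmxA (mulmxA (adjmx M)) MJ.
by rewrite !mulmxA mulmxN !mulNmx !mulmxA.
Qed.

(** In the lift of the field, the term with B gives the defect. In the term with A, skewness for J
    and commutation with E leave only the coefficient c minus its conjugate, which is 2 'i times
    [lie_potential b z]. *)
Lemma lieF_leaf_field z : U z ->
  lieF F (leaf_field a X H b) z * uF z = lie_potential b z * uF z - exp_defect z.
Proof.
move=> Uz; have hz := F_eq Uz.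
have := lieF_identity oU Fs F_eq (leaf_field a X H b) Uz.
rewrite inclE; have [mu ->] := lift_leaf_field a r X_diag H b z.
rewrite -/(zeta z); set c := 2 * 'i * _.
set x := lieF _ _ _ * _; move: x => x.
have EA : expF z *m A = A *m expF z.
  have h : A *m gen = gen *m A by rewrite /gen -scalemxAr -scalemxAl.
  exact: esym (mexp_commute (F z) h).
pose y := (eta z *m (A *m expF z) *m zeta z) 0 0.
pose p := (eta z *m (expF z *m B) *m zeta z) 0 0.
pose p' := (eta z *m (B *m expF z) *m zeta z) 0 0.
have uE : uF z = 2 * 'i * y.
  by rewrite /uF /gen /y -scalemxAr -!scalemxAl mxE -!mulmxA.
have TE : exp_defect z = p - p'.
  rewrite /exp_defect /p /p' mulmxBr mulmxBl.
  by rewrite mxE [X in _ + X]mxE.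
have h2 : (eta z *m expF z *m (B *m zeta z - c *: (A *m zeta z) + mu *: zeta z)) 0 0 =
    p - c * y.
  rewrite mulmxDr mulmxBr -!scalemxAr hz scaler0 addr0 /p /y -EA !mulmxA.
  by rewrite mxE [X in _ + X]mxE [X in - X]mxE.
have hz' : adjmx (zeta z) *m J *m expF z *m zeta z = 0 by exact: hz.
have h1 : (adjmx (B *m zeta z - c *: (A *m zeta z) + mu *: zeta z) *m J
    *m expF z *m zeta z) 0 0 = - p' + c^* * y.
  rewrite adjmxD adjmxD adjmxN !adjmxZ !mulmxDl !mulNmx -!scalemxAl hz' scaler0 addr0.
  apply: etrans (congr1 (fun M : 'M[C]_1 => M 0 0) (congr2 (fun M N => M - c^* *: N)
    (adj_linear_J z (expF z) (adjmx_B_J a X b hH))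
    (adj_linear_J z (expF z) (adjmx_A_J a r X_diag)))) _.
  rewrite scalerN opprK.
  by rewrite mxE [X in _ + X]mxE [X in X + _]mxE.
rewrite h1 h2 TE uE /lie_potential /c !conjM conj2 conjI.
move: ((adjmx b *m z) 0 0) => s /eqP; rewrite addr_eq0 => /eqP ->; ring.
Qed.

Let w_hol : hol U (fun z => (adjmx b *m z) 0 0) := hol_mul_entry oU (adjmx b) 0.

Lemma smooth_lie_potential : smooth_on U (lie_potential b).
Proof. exact: (smoothD oU w_hol.1 (smoothJ oU w_hol.1)). Qed.

Lemma dz_dzbar_lie_potential j k z : U z -> dz j (dzbar k (lie_potential b)) z = 0.
Proof. exact: (dz_dzbar_holDJ j k oU w_hol w_hol). Qed.

Lemma sc_lie_potential p : sc U p (lie_potential b) (fun z => (adjmx b *m z) 0 0).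
Proof.
have c : sc U p (fun z => ((adjmx b *m z) 0 0)^*) (fun=> 0).
  have [ws _] := w_hol; split; [exact: smoothJ|exact: smooth_cst|].
  have := cong_conj_hol oU U0 p w_hol.
  by rewrite mulmx0 [X in X^*]mxE conjC0.
apply: (sc_trans oU U0 (scD oU U0 (sc_refl oU U0 p w_hol.1) c)).
apply: (sc_eq oU U0); first exact: (smoothD oU w_hol.1 (smooth_cst oU 0)).
by move=> z _; rewrite addr0.
Qed.

Lemma lie_potential_conj z : (lie_potential b z)^* = lie_potential b z.
Proof. by rewrite /lie_potential conjD conjCK addrC. Qed.

Let leaf_hol := hol_leaf_field a X oU H b.

Lemma near_uF_neq0 : \forall z \near (0 : V), uF z != 0.
Proof.
have su := smooth_uF a X r oU Fs.
have uc : {for 0, continuous uF} := smooth_continuous su U0.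
have u0 : uF 0 != 0 by exact: uF0_neq0 F0.
exact: (cvgr_neq0 (uF 0) uc u0).
Qed.

Lemma lieF_commuting_leaf_field : A *m B = B *m A ->
  \forall z \near (0 : V), U z /\ lieF F (leaf_field a X H b) z = lie_potential b z.
Proof.
move=> AB; have Unear : \forall z \near (0 : V), U z by exact: open_nbhs_nbhs.
apply: filterS (filterI Unear near_uF_neq0) => z [Uz uz]; split=> //.
apply: (mulIf uz); rewrite (lieF_leaf_field Uz).
have BE : B *m expF z = expF z *m B.
  by apply: mexp_commute; rewrite /gen -scalemxAr -scalemxAl AB.
by rewrite /exp_defect BE subrr mulmx0 mul0mx [X in _ - X]mxE subr0.
Qed.

Hypothesis leaf_killing : forall j k z, U z ->
  dz j (dzbar k (lieF F (leaf_field a X H b))) z = 0.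

Lemma exp_defect_eq0 : \forall z \near (0 : V), U z /\ exp_defect z = 0.
Proof.
pose S := lieF F (leaf_field a X H b).
have sS : smooth_on U S := smooth_lieF oU Fs (hol_mx_smooth leaf_hol).
have sw := smooth_lie_potential.
have h0 : \forall z \near (0 : V), S z - lie_potential b z = 0.
  apply: (pluriharmonic_real_flat_eq0 oU U0 (smoothB oU sS sw)).
  - move=> z Uz; rewrite conjD conjN lie_potential_conj.
    by congr (_ - _); exact: (lieF_conj Fs _ Uz).
  - move=> j k z Uz; have dk := derivation_dzbar oU k; have dj := derivation_dz oU j.
    have E : eq_on U (dzbar k (fun z => S z - lie_potential b z))
        (fun z => dzbar k S z - dzbar k (lie_potential b) z).
      by move=> y Uy; exact: (derB oU dk sS sw Uy).
    apply: etrans (der_eq dj (der_smooth dk (smoothB oU sS sw)) E Uz) _.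
    apply: etrans (derB oU dj (der_smooth dk sS) (der_smooth dk sw) Uz) _.
    by rewrite (dz_dzbar_lie_potential j k Uz) subr0; exact: leaf_killing.
  - move=> p; have h1 := sc_lieF oU Fs p U0 F_eq F0 leaf_hol.
    rewrite leaf_field0 in h1.
    have h2 := scD oU U0 (sc_trans oU U0 h1 (sc_sym oU U0 (sc_lie_potential p)))
      (scN oU U0 (sc_refl oU U0 p sw)).
    apply: (sc_trans oU U0 h2); apply: (sc_eq oU U0); first by have [] := h2.
    by move=> z _; rewrite subrr.
have Unear : \forall z \near (0 : V), U z by exact: open_nbhs_nbhs.
apply: filterS (filterI Unear h0) => z [Uz /eqP]; rewrite subr_eq0 => /eqP Sz.
split=> //; have := lieF_leaf_field Uz; rewrite -/S Sz => /eqP.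
by rewrite eq_sym -subr_eq0 addrC addKr oppr_eq0 => /eqP.
Qed.

End LeafFieldKilling.

(** [D] has the shape of [A, B]; these are the contractions of it that occur in the second
    dzbar-derivative of the defect. *)
Lemma blk3_sandwich (R : realType) n (a : 'cV[R]_n) (X : 'M[R]_n) (r : R)
    (c : 'M[R[i]]_1) p q (K : 'M[R[i]]_n) u (e : 'rV[R[i]]_n) z :
  let D := blk3 c p q 0 K u 0 0 c in
  [/\ eta 0 *m D *m zeta z = 0,
      eta 0 *m D *m Amx a X r *m zeta z = ('i / 2) *: c,
      eta 0 *m Amx a X r *m D *m zeta z = ('i / 2) *: (c + p *m z) &
      row3 0 e 0 *m D *m zeta z = e *m (K *m z)].
Proof.
move=> D; have eD : eta 0 *m D = row3 0 0 (('i / 2) *: c).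
  by rewrite eta0_row3 row3_blk3 !mul0mx !mulmx0 !add0r mul_scalar_mx.
split.
- by rewrite eD zeta_col3 row3_col3 !mul0mx mulmx0 !addr0.
- by rewrite -mulmxA eD A_zeta row3_col3 !mul0mx mulmx1 !add0r.
- rewrite -mulmxA eta0_A zeta_col3 blk3_col3 row3_col3 !mul0mx !addr0 mulmx1.
  by rewrite mulmx0 addr0 mul_scalar_mx.
- rewrite -mulmxA zeta_col3 blk3_col3 row3_col3 !mul0mx.
  by rewrite mulmx0 !addr0 !add0r.
Qed.

(** * Admissibility from the vanishing of the exponential defect *)

Section ExponentialDefect.
Variables (R : realType) (n : nat).
Local Notation C := R[i].
Local Notation V := 'cV[C]_n.
Local Notation N := (1 + (n + 1))%N.
Variables (a : 'cV[R]_n) (X : 'M[R]_n) (r : R) (F : V -> R).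
Hypothesis X_diag : is_diag_mx X.
Local Notation J := (Jmx R n).
Local Notation A := (Amx a X r).
Local Notation FC := (fun z : V => (F z)%:C).
Local Notation gen := (gen a X r).
Local Notation expF := (expF a X r F).
Local Notation zeta := (@zeta R n).
Local Notation eta := (@eta R n).
Local Notation incl := (incl R n).
Variable U : set V.
Hypotheses (oU : open U) (U0 : U 0).
Hypothesis Fs : smooth_on U FC.
Hypothesis F_eq : forall z, U z -> eta z *m expF z *m zeta z = 0.
Hypothesis F0 : F 0 = 0.
Variables (H : 'M[C]_n) (b : V).
Hypothesis hH : adjmx H = H.
Local Notation B := (Bmx a X H b).
Hypothesis defect0 : forall z, U z -> exp_defect a X r F H b z = 0.
Implicit Types (z : V) (k : 'I_n).

Let eps k : 'rV[C]_N := adjmx (incl *m (delta_mx k 0 : V)) *m J.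
Let dk k := derivation_dzbar oU k.
Let sz := smooth_zeta oU.
Let se := smooth_eta oU.
Let cst p q (M : 'M[C]_(p, q)) := smooth_mx_cst oU M.
Let sE := smooth_expF a X r oU Fs.

Lemma mxder_dzbar_sandwich k (M M' : V -> 'M[C]_N) z : smooth_mx U M -> U z ->
  mxder (dzbar k) M z = M' z ->
  mxder (dzbar k) (fun z => eta z *m M z *m zeta z) z =
  eps k *m M z *m zeta z + eta z *m M' z *m zeta z.
Proof.
move=> Ms Uz <-; apply: etrans (mxderM oU (dk k) (smooth_mxM oU se Ms) sz Uz) _.
rewrite (mxder_dzbar_hol k (hol_zeta oU) Uz) mulmx0 addr0 -mulmxDl.
congr (_ *m _); apply: etrans (mxderM oU (dk k) se Ms Uz) _.
by rewrite (mxder_dzbar_eta oU k Uz).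
Qed.

Lemma mxder_dzbar_cst_sandwich k (P : 'rV[C]_N) (M M' : V -> 'M[C]_N) z :
  smooth_mx U M -> U z -> mxder (dzbar k) M z = M' z ->
  mxder (dzbar k) (fun z => P *m M z *m zeta z) z = P *m M' z *m zeta z.
Proof.
move=> Ms Uz <-; apply: etrans (mxderM oU (dk k) (smooth_mxM oU (cst P) Ms) sz Uz) _.
rewrite (mxder_dzbar_hol k (hol_zeta oU) Uz) mulmx0 addr0.
congr (_ *m _); apply: etrans (mxderM oU (dk k) (cst P) Ms Uz) _.
by rewrite (mxder_cst (dk k) P Uz) mul0mx add0r.
Qed.

(** A family closed under dzbar_k, which multiplies [G] by [gen] and brings out the factor dzbar_k
    F. *)
Definition exp_comm (G : 'M[C]_N) z : 'M[C]_N := G *m expF z *m B - B *m (G *m expF z).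

Lemma smooth_exp_comm G : smooth_mx U (exp_comm G).
Proof.
have s := smooth_mxM oU (cst G) sE.
exact: (smooth_mxD oU (smooth_mxM oU s (cst B)) (smooth_mxN oU (smooth_mxM oU (cst B) s))).
Qed.

Lemma mxder_exp_comm k G z : U z ->
  mxder (dzbar k) (exp_comm G) z = dzbar k FC z *: exp_comm (G *m gen) z.
Proof.
move=> Uz; have s := smooth_mxM oU (cst G) sE.
have sB := smooth_mxM oU s (cst B); have Bs := smooth_mxM oU (cst B) s.
have d : mxder (dzbar k) (fun z => G *m expF z) z =
    dzbar k FC z *: (G *m gen *m expF z).
  apply: etrans (mxderM oU (dk k) (cst G) sE Uz) _.
  rewrite (mxder_cst (dk k) G Uz) mul0mx add0r.
  apply: etrans (congr1 (mulmx G) (mxder_mexp_dzbar gen Fs k Uz)) _.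
  by rewrite -scalemxAr mulmxA.
apply: etrans (mxderD (dk k) sB (smooth_mxN oU Bs) Uz) _.
rewrite scalerBr; congr (_ + _).
  apply: etrans (mxderM oU (dk k) s (cst B) Uz) _.
  by rewrite (mxder_cst (dk k) B Uz) mulmx0 addr0 d -scalemxAl.
apply: etrans (mxderN oU (dk k) Bs Uz) _; congr (- _).
apply: etrans (mxderM oU (dk k) (cst B) s Uz) _.
by rewrite (mxder_cst (dk k) B Uz) mul0mx add0r d -scalemxAr.
Qed.

Lemma exp_defect_dzbar k z : U z ->
  eps k *m exp_comm 1%:M z *m zeta z +
  dzbar k FC z *: (eta z *m exp_comm gen z *m zeta z) = 0.
Proof.
move=> Uz.
have s := smooth_exp_comm 1%:M.
have E y : U y -> eta y *m exp_comm 1%:M y *m zeta y = 0.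
  move=> Uy; have := defect0 Uy; rewrite /exp_defect /exp_comm mul1mx.
  by move=> h; apply/matrixP => i j; rewrite !ord1 h mxE.
have := mxder_eq (dk k) (smooth_mxM oU (smooth_mxM oU se s) sz) E Uz.
rewrite (mxder_cst (dk k) _ Uz).
rewrite (mxder_dzbar_sandwich (M' := fun z => dzbar k FC z *: exp_comm gen z) s Uz).
  by rewrite -scalemxAr -scalemxAl.
by rewrite (mxder_exp_comm k 1%:M Uz) mul1mx.
Qed.

(** One derivative is not enough: modulo zbar, the terms of [exp_defect_dzbar] contain [1, B] = 0
    and eta(0) [gen, B] zeta = 0, so no condition on H and b results. *)
Lemma exp_defect_dzbar2 k z : U z ->
  eps k *m (dzbar k FC z *: exp_comm gen z) *m zeta z +
  (dzbar k (dzbar k FC) z *: (eta z *m exp_comm gen z *m zeta z) +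
   dzbar k FC z *: (eps k *m exp_comm gen z *m zeta z +
      eta z *m (dzbar k FC z *: exp_comm (gen *m gen) z) *m zeta z)) = 0.
Proof.
move=> Uz; have s1 := smooth_exp_comm 1%:M; have s2 := smooth_exp_comm gen.
have sF := der_smooth (dk k) Fs.
have s3 := smooth_mxM oU (smooth_mxM oU (cst (eps k)) s1) sz.
have s4 := smooth_mxM oU (smooth_mxM oU se s2) sz.
have s5 := smooth_mxZ oU sF s4.
have := mxder_eq (dk k) (smooth_mxD oU s3 s5) (exp_defect_dzbar k) Uz.
rewrite (mxder_cst (dk k) _ Uz) => h; apply: etrans h; apply: esym.
apply: etrans (mxderD (dk k) s3 s5 Uz) _; congr (_ + _).
  apply: (mxder_dzbar_cst_sandwich (M' := fun z => dzbar k FC z *: exp_comm gen z) _ s1 Uz).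
  by rewrite (mxder_exp_comm k 1%:M Uz) mul1mx.
apply: etrans (mxderZ (dk k) sF s4 Uz) _; congr (_ + _ *: _).
apply: (mxder_dzbar_sandwich (M' := fun z => dzbar k FC z *: exp_comm (gen *m gen) z) s2 Uz).
exact: (mxder_exp_comm k gen Uz).
Qed.

Let comm0 (G : 'M[C]_N) : 'M[C]_N := G *m 1%:M *m B - B *m (G *m 1%:M).

Lemma scong_exp_comm p G : scong U p (exp_comm G) (fun=> comm0 G).
Proof.
have cE := scong_expF oU U0 Fs F_eq F0 p.
have cc q s (M : 'M[C]_(q, s)) := scong_cst oU U0 p M.
have s := smooth_exp_comm G.
have h1 := scongM oU U0 (scongM oU U0 (cc _ _ G) cE) (cc _ _ B).
have h2 := scongM oU U0 (cc _ _ (- B)) (scongM oU U0 (cc _ _ G) cE).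
have [_ _ h] := scongD oU U0 h1 h2; split; [exact: s|exact: cst|].
move: h; under [X in cong_mx _ X]eq_fun do rewrite mulNmx.
by under [X in cong_mx _ _ X]eq_fun do rewrite mulNmx.
Qed.

(** The second derivative of F is left as it stands, because its factor turns out to be 0 in
    [exp_defect_polynomial]. *)
Lemma sc_exp_defect p k : sc U p (fun=> 0) (fun z =>
  (eps k *m (z k 0 *: comm0 gen) *m zeta z +
  (dzbar k (dzbar k FC) z *: (eta 0 *m comm0 gen *m zeta z) +
   z k 0 *: (eps k *m comm0 gen *m zeta z +
      eta 0 *m (z k 0 *: comm0 (gen *m gen)) *m zeta z))) 0 0).
Proof.
have cF := sc_dzbar_FC oU U0 Fs F_eq F0 p k.
have cz := scong_refl oU U0 p sz.
have ce := scong_eta oU U0 p.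
have cq := scong_cst oU U0 p (eps k).
have cg := scong_exp_comm p gen.
have cgg := scong_exp_comm p (gen *m gen).
have cFF := sc_refl oU U0 p (der_smooth (dk k) (der_smooth (dk k) Fs)).
have h1 := scongM oU U0 (scongM oU U0 cq (scongZ oU U0 cF cg)) cz.
have h2 := scongZ oU U0 cFF (scongM oU U0 (scongM oU U0 ce cg) cz).
have h3 := scongM oU U0 (scongM oU U0 cq cg) cz.
have h4 := scongM oU U0 (scongM oU U0 ce (scongZ oU U0 cF cgg)) cz.
have h := scong_entry 0 0 (scongD oU U0 h1 (scongD oU U0 h2
  (scongZ oU U0 cF (scongD oU U0 h3 h4)))).
apply: (sc_trans oU U0 _ h); apply: (sc_eq oU U0 p (smooth_cst oU 0)) => z Uz.
have z00 : (0 : 'M[C]_1) 0 0 = 0 by rewrite mxE.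
exact: esym (etrans (congr1 (fun M : 'M[C]_1 => M 0 0) (exp_defect_dzbar2 k Uz)) z00).
Qed.

Let gen_comm : comm0 gen = (2 * 'i) *: (A *m B - B *m A).
Proof.
by rewrite /comm0 mulmx1 /gen -scalemxAl -scalemxAr scalerBr.
Qed.

Let gen2_comm : comm0 (gen *m gen) =
  - 4 *: (A *m (A *m B - B *m A) + (A *m B - B *m A) *m A).
Proof.
have i2 : ('i : C) * 'i = -1 by exact: mulii.
have gg : gen *m gen = - 4 *: (A *m A).
  rewrite /gen -scalemxAl -scalemxAr scalerA.
  by have -> : 2 * 'i * (2 * 'i) = - 4 :> C by ring : i2.
rewrite /comm0 mulmx1 gg -scalemxAl -scalemxAr -scalerBr; congr (_ *: _).
by rewrite mulmxBr mulmxBl !mulmxA addrA subrK.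
Qed.

Definition defect_poly k z : C :=
  z k 0 * (2 * (Kmx a X H b *m z) k 0 - z k 0 *
    (2 * kap a b 0 0 - 2 * 'i * (adjmx (uvec a X r H b) *m z) 0 0)).

Lemma exp_defect_polynomial k z :
  (eps k *m (z k 0 *: comm0 gen) *m zeta z +
  (dzbar k (dzbar k FC) z *: (eta 0 *m comm0 gen *m zeta z) +
   z k 0 *: (eps k *m comm0 gen *m zeta z +
      eta 0 *m (z k 0 *: comm0 (gen *m gen)) *m zeta z))) 0 0 =
  2 * 'i * defect_poly k z.
Proof.
have [] := blk3_sandwich a X r (kap a b) (- (2 * 'i) *: adjmx (uvec a X r H b))
  (2 *: (adjmx (cmx a) *m cmx X *m b + adjmx b *m cmx X *m cmx a)) (Kmx a X H b)
  (uvec a X r H b) (adjmx (delta_mx k 0 : V)) z.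
rewrite -(commutator_AB a r X_diag b hH) -(adj_incl_J (delta_mx k 0)) -/(eps k).
move: gen_comm gen2_comm (dzbar k _ z); move: (A *m B - B *m A).
move=> D gD ggD c eDz eDA eAD kD.
have E1 : eps k *m comm0 gen *m zeta z =
    (2 * 'i) *: (adjmx (delta_mx k 0 : V) *m (Kmx a X H b *m z)).
  by rewrite gD -scalemxAr -scalemxAl kD.
have E2 : eta 0 *m comm0 gen *m zeta z = 0.
  by rewrite gD -scalemxAr -scalemxAl eDz scaler0.
have S1 (P : 'rV[C]_N) s (M : 'M[C]_N) (Q : 'cV[C]_N) :
    P *m (s *: M) *m Q = s *: (P *m M *m Q).
  by rewrite -scalemxAr -scalemxAl.
have E3 : eta 0 *m (z k 0 *: comm0 (gen *m gen)) *m zeta z = z k 0 *: (- 4 *: (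
    ('i / 2) *: (kap a b + - (2 * 'i) *: adjmx (uvec a X r H b) *m z)
     + ('i / 2) *: kap a b)).
  have S2 (P : 'rV[C]_N) s t (M : 'M[C]_N) (Q : 'cV[C]_N) :
      P *m (s *: (t *: M)) *m Q = s *: (t *: (P *m M *m Q)).
    exact: etrans (S1 _ _ _ _) (congr1 (GRing.scale s) (S1 _ _ _ _)).
  have S3 (P : 'rV[C]_N) (M M' : 'M[C]_N) (Q : 'cV[C]_N) :
      P *m (M *m M' + M' *m M) *m Q = P *m M *m M' *m Q + P *m M' *m M *m Q.
    by rewrite mulmxDr mulmxDl !mulmxA.
  rewrite ggD; apply: etrans (S2 _ _ _ _ _) _; congr (_ *: (_ *: _)).
  exact: etrans (S3 _ _ _ _) (congr2 +%R eAD eDA).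
have E4 := etrans (S1 _ (z k 0) _ _) (congr1 (GRing.scale _) E1).
apply: etrans (congr1 (fun M : 'M[C]_1 => M 0 0) (congr2 +%R E4
  (congr2 +%R (congr1 (GRing.scale _) E2) (congr1 (GRing.scale _) (congr2 +%R E1 E3))))) _.
rewrite /defect_poly scaler0 add0r {E1 E2 E3 E4 eDz eDA eAD kD gD ggD S1}.
rewrite -scalemxAl; have ad := adjmx_delta_mul k (Kmx a X H b *m z).
have t2 : 2 * ('i / 2) = 'i :> C by rewrite mulrCA mulfV ?mulr1// pnatr_eq0.
have S (P Q : 'M[C]_1) : (P + Q) 0 0 = P 0 0 + Q 0 0 by rewrite mxE.
have Z (s : C) (P : 'M[C]_1) : (s *: P) 0 0 = s * P 0 0 by rewrite mxE.
move: (adjmx (delta_mx k 0 : V) *m _) (kap a b) (adjmx (uvec _ _ _ _ _) *m z) ad.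
move=> P Q M; rewrite !(S, Z) => ->.
move: (z k 0) (P 0 0) (Q 0 0) (M 0 0) ((_ *m z) k 0) ('i / 2) t2 => y p q m x h <-.
by ring.
Qed.

Lemma exp_defect_near0 : \forall z \near (0 : V), forall k,
  defect_poly k z = 0.
Proof.
have h k : \forall z \near (0 : V), defect_poly k z = 0.
  have hz : hol U (fun z => z k 0) := hol_coord oU k.
  have hK := holM oU (hol_cst oU 2) (hol_mul_entry oU (Kmx a X H b) k).
  have hu := holM oU (hol_cst oU (2 * 'i)) (hol_mul_entry oU (adjmx (uvec a X r H b)) 0).
  have hp := holM oU hz (holB oU hK (holM oU hz
    (holB oU (hol_cst oU (2 * kap a b 0 0)) hu))).
  have n2i : (2 * 'i : C) != 0 by rewrite mulf_neq0 ?pnatr_eq0 ?neq0Ci.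
  have hq := holM oU (hol_cst oU (2 * 'i)) hp.
  have := sc_hol_eq oU U0 (hol_cst oU 0) hq.
  have key p := sc_exp_defect p k.
  have pE : (fun z => _) = _ := funext (exp_defect_polynomial k).
  rewrite pE in key.
  by move=> /(_ key); apply: filterS => z /esym/eqP; rewrite mulf_eq0 (negPf n2i) => /eqP.
exact: (@filter_forall V 'I_n _ (nbhs (0 : V)) _ h).
Qed.

(** [defect_poly] has a quadratic and a cubic homogeneous part, which are separated by evaluating at
    opposite points. On basis vectors they give the diagonal of K and u = 0; sums of two basis
    vectors give the entries of K off the diagonal. *)
Lemma scalar_Kmx : Kmx a X H b = (kap a b 0 0)%:M /\ uvec a X r H b = 0.
Proof.
set K := Kmx _ _ _ _; set u := uvec _ _ _ _ _; set c := kap _ _ 0 0.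
have line k (y : V) : y k 0 * ((K *m y) k 0 - y k 0 * c) = 0 /\
    y k 0 * y k 0 * (adjmx u *m y) 0 0 = 0.
  have [t t0 []] := near0_pm y exp_defect_near0.
  move=> /(_ k) + /(_ k); rewrite /defect_poly -/K -/u -/c.
  have -> : (- t)%:C = - t%:C :> C by rewrite rmorphN.
  rewrite scaleNr.
  have tn0 : t%:C != 0 :> C by rewrite gt_eqF// ltcR.
  rewrite -!scalemxAr !mulmxN -!scalemxAr.
  have Z m (s : C) (P : 'cV[C]_m) i : (s *: P) i 0 = s * P i 0 by rewrite mxE.
  have Nn m (P : 'cV[C]_m) i : (- P) i 0 = - P i 0 by rewrite mxE.
  rewrite !(Z, Nn).
  move: (y k 0) ((K *m y) k 0) ((adjmx u *m y) 0 0) (t%:C) tn0.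
  move=> yk Ky uy s s0 e1 e2.
  have i2 : ('i : C) * 'i = -1 by exact: mulii.
  have n4 : (4 * (s * s) : C) != 0 by rewrite !mulf_neq0// pnatr_eq0.
  have n4i : (4 * 'i * (s * (s * s)) : C) != 0.
    by rewrite !mulf_neq0// ?pnatr_eq0// neq0Ci.
  split.
    apply: (mulfI n4); rewrite mulr0.
    by have := congr2 +%R e1 e2; rewrite addr0 => <-; ring.
  apply: (mulfI n4i); rewrite mulr0.
  by have := congr2 (fun x y => x - y) e1 e2; rewrite subrr => <-; ring.
have dE k j : (delta_mx k 0 : V) j 0 = (j == k)%:R by rewrite mxE andbT.
have Kd p (M : 'M[C]_(p, n)) k j : (M *m (delta_mx k 0 : V)) j 0 = M j k.
  rewrite mxE (bigD1 k)//= big1 ?addr0 => [|i ik]; rewrite dE ?eqxx ?mulr1//.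
  by rewrite (negPf ik) mulr0.
have ud k : u k 0 = 0.
  have [_] := line k (delta_mx k 0); rewrite dE eqxx !mul1r Kd.
  by rewrite mxE [u^T _ _]mxE => /eqP; rewrite conjC_eq0 => /eqP.
split; last by apply/matrixP => k j; rewrite ord1 ud mxE.
have Kkk k : K k k = c.
  have [h _] := line k (delta_mx k 0); move: h; rewrite Kd dE eqxx !mul1r.
  by move/eqP; rewrite subr_eq0 => /eqP.
apply/matrixP => k j; rewrite [RHS]mxE.
have [<-|kj] := eqVneq k j; first by rewrite Kkk.
have [h _] := line k (delta_mx k 0 + delta_mx j 0).
move: h; rewrite mulmxDr [X in X * _]mxE [X in _ * (X - _)]mxE [X in _ * (_ - X * _)]mxE.
rewrite !Kd !dE eqxx (negPf kj) addr0 !mul1r Kkk addrAC subrr add0r.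
by rewrite mulr0n.
Qed.

(** It remains to see that the scalar kap is 0. With [t] as in the proof, kap = - 'i t, whereas the
    trace of K = kap gives n kap = 2 'i t; hence (n + 2) 'i t = 0. *)
Lemma exp_defect_admissible : admissible a X r (H, b).
Proof.
have [hK hu] := scalar_Kmx; apply: (admissible_uvec hH _ hu).
set t := \tr (cmx a *m adjmx b + b *m adjmx (cmx a)).
have kE : kap a b 0 0 = - 'i * t by rewrite kap_tr mxE eqxx mulr1n.
have trK : \tr (Kmx a X H b) = 2 * 'i * t.
  have trB (P Q : 'M[C]_n) : \tr (P - Q) = \tr P - \tr Q by exact: raddfB.
  by rewrite /Kmx mxtraceD trB mxtrace_mulC subrr add0r mxtraceZ.
move: trK; rewrite hK mxtrace_scalar kE.
move/eqP; rewrite eq_sym -subr_eq0 => /eqP h.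
have n2 : (n.+2%:R : C) != 0 by rewrite pnatr_eq0.
have it : 'i * t = 0.
  apply: (mulfI n2); rewrite mulr0 -h -mulr_natr -[n.+2]addn2 natrD; ring.
by rewrite mulNr it oppr0 raddf0.
Qed.

End ExponentialDefect.

Lemma holomorphic0_hol_mx (R : realType) m p (v : 'cV[R[i]]_m -> 'cV[R[i]]_p) :
  holomorphic0 v -> exists U : set 'cV[R[i]]_m, [/\ open U, U 0 & hol_mx U v].
Proof.
move=> /holomorphic0P/near0_open[U [oU U0 UP]]; exists U; split=> // i j.
rewrite ord1; split; first by apply: smooth_on_at => z /UP/(_ i)[].
by move=> k z /UP/(_ i)[].
Qed.

Lemma hol_mx_holomorphic0 (R : realType) m p (U : set 'cV[R[i]]_m)
    (v : 'cV[R[i]]_m -> 'cV[R[i]]_p) :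
  open U -> U 0 -> hol_mx U v -> holomorphic0 v.
Proof. by move=> oU U0 vh; apply: (hol_holomorphic0 oU U0) => j; exact: vh. Qed.

(** * Classification on the leaf space *)

Section InfinitesimalAutomorphisms.
Variables (R : realType) (n : nat).
Local Notation C := R[i].
Local Notation V := 'cV[C]_n.
Variables (a : 'cV[R]_n) (X : 'M[R]_n) (r : R) (F : V -> R).
Hypothesis X_diag : is_diag_mx X.
Local Notation A := (Amx a X r).
Local Notation FC := (fun z : V => (F z)%:C).
Local Notation expF := (expF a X r F).
Local Notation zeta := (@zeta R n).
Local Notation eta := (@eta R n).

(** The germ conditions on F, made simultaneous on one open set; [potential_onW] shrinks it whenever
    a further germ identity is to hold throughout. *)
Definition potential_on (U : set V) := [/\ open U, U 0, smooth_on U FC,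
  (forall z, U z -> eta z *m expF z *m zeta z = 0) & F 0 = 0].

Lemma potential_potential_on : potential a X r F -> exists U, potential_on U.
Proof.
move=> [F0 Fs Fe].
have [U [oU U0 UP]] := near0_open (filterI (smooth0P Fs) Fe).
exists U; split=> //; first by apply: smooth_on_at => z /UP[].
by move=> z /UP[_ h]; exact: potential_eq h.
Qed.

Lemma potential_onW U (P : V -> Prop) : potential_on U ->
  (\forall z \near (0 : V), P z) ->
  exists U', [/\ potential_on U', U' `<=` U & forall z, U' z -> P z].
Proof.
move=> [oU U0 Fs Fe F0] nP; have Unear : \forall z \near (0 : V), U z.
  exact: open_nbhs_nbhs.
have [U' [oU' U'0 U'P]] := near0_open (filterI Unear nP).
have UU' : U' `<=` U by move=> z /U'P[].
exists U'; split=> //; last by move=> z /U'P[].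
split; [exact: oU'|exact: U'0|exact: (smooth_onW UU' Fs)| |exact: F0].
by move=> z /UU'; exact: Fe.
Qed.

Lemma admissible_lieF U H b : potential_on U -> admissible a X r (H, b) ->
  \forall z \near (0 : V), lieF F (leaf_field a X H b) z = lie_potential b z.
Proof.
move=> [oU U0 Fs Fe F0] Hb; have [hH _ _] := Hb.
have := lieF_commuting_leaf_field X_diag oU U0 Fs Fe F0 hH
  (admissible_commute X_diag Hb).
by apply: filterS => z [].
Qed.

Lemma admissible_inf_automorphism U H b : potential_on U ->
  admissible a X r (H, b) -> inf_automorphism F (leaf_field a X H b).
Proof.
move=> PU Hb; have [U' [[oU U0 Fs Fe F0] _ UE]] :=
  potential_onW PU (admissible_lieF PU Hb).
have vh := hol_leaf_field a X oU H b.
split; first exact: (hol_mx_holomorphic0 oU U0 vh).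
have Unear : \forall z \near (0 : V), U' z by exact: open_nbhs_nbhs.
apply: filterS Unear => z Uz j k.
rewrite (lie_kmetricE oU Fs j k vh Uz).
have dk := derivation_dzbar oU k; have dj := derivation_dz oU j.
have sv := smooth_lieF oU Fs (hol_mx_smooth vh).
apply: etrans (dz_dzbar_lie_potential oU b j k Uz).
apply: (der_eq dj (der_smooth dk sv) _ Uz) => y Uy.
exact: (der_eq dk sv UE Uy).
Qed.

Lemma killing_leaf_field U v : potential_on U -> hol_mx U v ->
  (forall j k z, U z -> dz j (dzbar k (lieF F v)) z = 0) ->
  \forall z \near (0 : V), v z = leaf_field a X (jetH v) (v 0) z.
Proof.
move=> [oU U0 Fs Fe F0] vh vk.
have h k : \forall z \near (0 : V), v z k 0 = leaf_field a X (jetH v) (v 0) z k 0.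
  have lh := hol_leaf_field a X oU (jetH v) (v 0).
  have dh := holB oU (vh k 0) (lh k 0).
  have key p : sc U p
      (fun z => v z k 0 - leaf_field a X (jetH v) (v 0) z k 0) (fun=> 0).
    have h1 := sc_killing oU U0 Fs Fe F0 vh vk p k.
    have [s1 s2 _] := h1.
    have h2 := sc_eq oU U0 p dh.1 (fun z _ => esym (killing_polynomial a X r v k z)).
    have h3 := sc_eq oU U0 p s1 (fun z Uz => killing_identity oU Fs Fe vh k Uz).
    exact: (sc_trans oU U0 h2 (sc_trans oU U0 (sc_sym oU U0 h1) h3)).
  have := sc_hol_eq oU U0 dh (hol_cst oU 0) key.
  by apply: filterS => z /eqP; rewrite subr_eq0 => /eqP.
have hall : \forall z \near (0 : V), forall k,
    v z k 0 = leaf_field a X (jetH v) (v 0) z k 0.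
  exact: (@filter_forall V 'I_n _ (nbhs (0 : V)) _ h).
by apply: filterS hall => z E; apply/matrixP => k j; rewrite ord1; exact: E.
Qed.

(** Equality with [leaf_field] on an open set transfers the Killing condition to that polynomial
    field, for which the defect argument is formulated. *)
Lemma killing_admissible U v : potential_on U -> hol_mx U v ->
  (forall j k z, U z -> dz j (dzbar k (lieF F v)) z = 0) ->
  exists2 Hb, admissible a X r Hb &
    \forall z \near (0 : V), v z = leaf_field a X Hb.1 Hb.2 z.
Proof.
move=> PU vh vk; have nE := killing_leaf_field PU vh vk.
exists (jetH v, v 0) => //.
have [U' [PU' UU' vE]] := potential_onW PU nE.
have vh' := hol_mxW UU' vh; have [oU U0 Fs Fe F0] := PU'.
have hH := jetH_hermitian oU U0 vh' vE.
have lh := hol_leaf_field a X oU (jetH v) (v 0).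
have lk j k z : U' z ->
    dz j (dzbar k (lieF F (leaf_field a X (jetH v) (v 0)))) z = 0.
  move=> Uz; apply: etrans (vk j k z (UU' z Uz)).
  have dk := derivation_dzbar oU k; have dj := derivation_dz oU j.
  have sl := smooth_lieF oU Fs (hol_mx_smooth lh).
  apply: (der_eq dj (der_smooth dk sl) _ Uz) => y Uy.
  apply: (der_eq dk sl _ Uy) => x Ux.
  by rewrite /lieF -(vE x Ux).
have n0 := exp_defect_eq0 X_diag oU U0 Fs Fe F0 hH lk.
have [U2 [[oU2 U20 Fs2 Fe2 _] _ U2P]] := potential_onW PU' n0.
apply: (exp_defect_admissible X_diag oU2 U20 Fs2 Fe2 F0 hH) => z.
by move=> /U2P[].
Qed.

(** The value at 0 gives b; once b agrees, every term except the one containing H cancels. *)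
Lemma leaf_field_inj H b H' b' :
  (\forall z \near (0 : V), leaf_field a X H b z = leaf_field a X H' b' z) ->
  H = H' /\ b = b'.
Proof.
move=> nE; have bb : b = b'.
  have := nbhs_singleton nE; rewrite !leaf_field0//.
split=> //; apply: near0_mulmx_inj; apply: filterS nE => z.
rewrite /leaf_field -bb => /addIr/addIr/addIr/addrI h.
by apply: (scalerI (@neq0Ci C)).
Qed.

Lemma inf_automorphism_unique U v : potential_on U -> inf_automorphism F v ->
  exists! Hb : 'M[C]_n * V, admissible a X r Hb /\
    descends_to a X r (aut_field a X Hb.1 Hb.2) v.
Proof.
move=> PU [/holomorphic0_hol_mx[U1 [oU1 U10 vh]] vl].
have U1near : \forall z \near (0 : V), U1 z by exact: open_nbhs_nbhs.
have [U2 [PU2 _ U2P]] := potential_onW PU (filterI U1near vl).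
have [oU2 U20 Fs _ _] := PU2.
have vh2 : hol_mx U2 v by apply: (hol_mxW _ vh) => z /U2P[].
have vk j k z : U2 z -> dz j (dzbar k (lieF F v)) z = 0.
  by move=> Uz; rewrite -(lie_kmetricE oU2 Fs j k vh2 Uz); have [_] := U2P z Uz.
have [[H b] Hb nE] := killing_admissible PU2 vh2 vk.
exists (H, b); split; first by split=> //; apply/descends_toP.
move=> [H' b'] [_ /(@descends_toP R n a X r X_diag H' b' v) nE'].
have [-> ->] // : H = H' /\ b = b'.
by apply: leaf_field_inj; apply: filterS (filterI nE nE') => z [/= <- <-].
Qed.

End InfinitesimalAutomorphisms.

(** * Infinitesimal CR automorphisms *)

Section LinearPullback.
Variables (R : realType) (m p : nat) (L : 'M[R[i]]_(p, m)).
Local Notation C := R[i].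
Variable U : set 'cV[C]_p.
Hypothesis oU : open U.

Definition lin_preimage : set 'cV[C]_m := [set z | U (L *m z)].

Lemma continuous_mulmx : continuous (fun z : 'cV[C]_m => L *m z).
Proof.
move=> z; apply: (cvg_mx_entries (F := nbhs z)) => i j.
have s := smooth_mxM openT (smooth_mx_cst openT L) (smooth_mx_id openT).
exact: (smooth_continuous (s i j) I : {for z, continuous _}).
Qed.

Lemma open_lin_preimage : open lin_preimage.
Proof. by apply: open_comp => // z _; exact: continuous_mulmx. Qed.

Lemma mulmx_line (z e : 'cV[C]_m) (t : R) : L *m (z + t%:C *: e) = L *m z + t%:C *: (L *m e).
Proof. by rewrite mulmxDr -scalemxAr. Qed.

Lemma rderiv_lin (f : 'cV[C]_p -> C) e :
  rderiv e (fun z => f (L *m z)) = fun z => rderiv (L *m e) f (L *m z).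
Proof.
apply/funext => z; rewrite /rderiv.
by under eq_fun do rewrite mulmx_line; under [in X in (_ +i* X)%C]eq_fun do
  rewrite mulmx_line.
Qed.

Lemma smooth_lin f : smooth_on U f -> smooth_on lin_preimage (fun z => f (L *m z)).
Proof.
move=> fs k; elim: k f fs => [|k IH] f fs.
  split=> // z Uz; apply: continuous_comp; first exact: continuous_mulmx.
  exact: (smooth_continuous fs Uz).
split=> [z Uz|].
  apply: continuous_comp; first exact: continuous_mulmx.
  exact: (smooth_continuous fs Uz).
split=> [z e Uz|e]; last by rewrite rderiv_lin; apply: IH; exact: (smooth_rderiv _ fs).
apply: is_cder_rderivable; under eq_fun do rewrite mulmx_line.
exact: (rderivP (smooth_rderivable (L *m e) fs Uz)).
Qed.

Lemma hol_lin f : hol U f -> hol lin_preimage (fun z => f (L *m z)).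
Proof.
move=> fh; split=> [|k z Uz]; first exact: (smooth_lin fh.1).
rewrite /dzbar !rderiv_lin (rderiv_hol oU _ fh Uz) (rderiv_hol oU _ fh Uz).
rewrite mulr_sumr -big_split /= big1 ?mul0r// => j _.
have E (e : 'cV[C]_m) : (L *m ('i *: e)) j 0 = 'i * (L *m e) j 0.
  by rewrite -scalemxAr mxE.
have i2 : ('i : C) * 'i = -1 by exact: mulii.
by rewrite E; move: ((L *m _) j 0) (dz j f _) => x y; ring : i2.
Qed.

Lemma hol_mx_lin q s (M : 'cV[C]_p -> 'M[C]_(q, s)) : hol_mx U M ->
  hol_mx lin_preimage (fun z => M (L *m z)).
Proof. by move=> Mh i j; exact: hol_lin (Mh i j). Qed.

End LinearPullback.

Lemma near0_lin (R : realType) m p (L : 'M[R[i]]_(p, m)) (P : 'cV[R[i]]_p -> Prop) :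
  (\forall z \near (0 : 'cV[R[i]]_p), P z) ->
  \forall z \near (0 : 'cV[R[i]]_m), P (L *m z).
Proof.
move=> nP; have c := @continuous_mulmx R m p L 0.
by rewrite /continuous_at mulmx0 in c; exact: (c _ nP).
Qed.

Section SphereAutomorphisms.
Variables (R : realType) (n : nat) (a : 'cV[R]_n) (X : 'M[R]_n) (r : R).
Hypothesis X_diag : is_diag_mx X.
Implicit Types (H : 'M[R[i]]_n) (b : 'cV[R[i]]_n).

Lemma admissible_inf_CR_automorphism H b : admissible a X r (H, b) ->
  inf_CR_automorphism (aut_field a X H b).
Proof.
move=> [hH _ _]; rewrite aut_fieldE; split.
  exact: (hol_mx_holomorphic0 openT I (hol_affine_field openT _)).
apply: (@filterE _ (nbhs (0 : 'cV[R[i]]_(n + 1)))) => p.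
apply: (affine_field_tangent openT I).
exact: (adjmx_B_J a X b hH).
Qed.

Lemma admissible_commute0 H b : admissible a X r (H, b) ->
  commute0 (aut_field a X H b) (reeb a X r).
Proof.
move=> Hb; rewrite aut_fieldE; apply: (@filterE _ (nbhs (0 : 'cV[R[i]]_(n + 1)))) => p.
exact: (bracket_affine_field openT I (admissible_commute X_diag Hb)).
Qed.

End SphereAutomorphisms.

Lemma affine_fieldZ (R : realType) n c (B : 'M[R[i]]_(1 + (n + 1))) p :
  affine_field (c *: B) p = c *: affine_field B p.
Proof.
rewrite !affine_fieldE -scalemxAl -scalemxAr topcZ scalerBr scalerA.
by [].
Qed.

Lemma mxder_rderivZ (R : realType) m p q (U : set 'cV[R[i]]_m) c e
    (M : 'cV[R[i]]_m -> 'M[R[i]]_(p, q)) z : open U -> hol_mx U M -> U z ->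
  mxder (rderiv (c *: e)) M z = c *: mxder (rderiv e) M z.
Proof.
move=> oU Mh Uz; apply/matrixP => i j; rewrite !mxE.
rewrite (rderiv_hol oU _ (Mh i j) Uz) (rderiv_hol oU _ (Mh i j) Uz) mulr_sumr.
by apply: eq_bigr => k _; rewrite mxE mulrA.
Qed.

Lemma is_mxcderB (R : realType) p q (f g : R -> 'M[R[i]]_(p, q)) t d e :
  is_mxcder f t d -> is_mxcder g t e -> is_mxcder (fun s => f s - g s) t (d - e).
Proof.
move=> fd ge i j; under eq_fun do rewrite !mxE.
by rewrite !mxE; exact: is_cderD (fd i j) (is_cderN (ge i j)).
Qed.

Lemma is_mxcder0_cst (R : realType) p q (f : R -> 'M[R[i]]_(p, q)) x :
  (forall t, `|t| <= `|x| -> is_mxcder f t 0) -> f x = f 0.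
Proof.
move=> f0; have d i j t : `|t| <= `|x| -> is_cder (fun s => f s i j) t 0.
  by move=> tx; have := f0 t tx i j; rewrite mxE.
apply/matrixP => i j; case: (lerP 0 x) => x0.
  apply/esym/(is_cder0_cst (f := fun s => f s i j)) => // t.
  by rewrite in_itv /= => /andP[t0 tx]; apply: d; rewrite !ger0_norm.
apply: (is_cder0_cst (f := fun s => f s i j)) => [|t]; first exact: ltW.
by rewrite in_itv /= => /andP[t0 tx]; apply: d; rewrite !ler0_norm ?lerN2// ltW.
Qed.

(** * The projective flow of a linear field *)

Section Flow.
Variables (R : realType) (n : nat).
Local Notation C := R[i].
Local Notation V := 'cV[C]_(n + 1).
Local Notation N := (1 + (n + 1))%N.
Variables (G : 'M[C]_N) (Y : V -> V) (U : set V).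
Hypotheses (oU : open U) (Yh : hol_mx U Y).
Hypothesis Y_comm : forall p, U p -> bracket Y (affine_field G) p = 0.
Variable p0 : V.

(** The flow is linear in homogeneous coordinates; [flow] is its image in the chart, meaningful as
    long as [flow_top] is not 0. *)
Definition flow_hom (x : R) : 'cV[C]_N := mexp G x *m hom p0.
Definition flow_top x : C := topc (flow_hom x).
Definition flow x : V := (flow_top x)^-1 *: (lowmx R n *m flow_hom x).

Lemma flow0 : flow 0 = p0.
Proof.
rewrite /flow /flow_top /flow_hom mexp0 mul1mx topc_hom invr1 scale1r.
by rewrite lowmxE /hom col_mxKd.
Qed.

Lemma flow_top0 : flow_top 0 = 1.
Proof. by rewrite /flow_top /flow_hom mexp0 mul1mx topc_hom. Qed.

Lemma hom_flow x : flow_top x != 0 -> flow_top x *: hom (flow x) = flow_hom x.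
Proof.
move=> t0; rewrite hom_lift scalerDr /flow -liftZ scalerA mulfV// scale1r.
by rewrite lift_low /flow_top addrC subrK.
Qed.

Lemma is_mxcder_mull p q s (M : 'M[C]_(p, q)) (f : R -> 'M[C]_(q, s)) t d :
  is_mxcder f t d -> is_mxcder (fun x => M *m f x) t (M *m d).
Proof.
move=> fd; have := is_mxcderM (is_mxcder_cst M t) fd.
by rewrite mul0mx add0r.
Qed.

Lemma is_cder_topc (f : R -> 'cV[C]_N) t d :
  is_mxcder f t d -> is_cder (fun x => topc (f x)) t (topc d).
Proof.
move=> fd; have := is_mxcder_mull (upmx R n) fd 0 0.
by rewrite upmxE; under eq_fun do rewrite upmxE.
Qed.

Lemma is_mxcder_flow_hom x : is_mxcder flow_hom x (G *m flow_hom x).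
Proof.
have := is_mxcderM (is_mxcder_mexp G x) (is_mxcder_cst (hom p0) x).
by rewrite mulmx0 addr0 -mulmxA.
Qed.

Lemma is_cder_flow_top x : is_cder flow_top x (topc (G *m flow_hom x)).
Proof. exact: is_cder_topc (is_mxcder_flow_hom x). Qed.

Lemma is_mxcder_flow x : flow_top x != 0 ->
  is_mxcder flow x (affine_field G (flow x)).
Proof.
move=> t0; have := is_mxcderZ (is_cderV (is_cder_flow_top x) t0)
  (is_mxcder_mull (lowmx R n) (is_mxcder_flow_hom x)).
congr is_mxcder; rewrite affine_fieldE.
have -> : hom (flow x) = (flow_top x)^-1 *: flow_hom x.
  by rewrite -(hom_flow t0) scalerA mulVf// scale1r.
rewrite -!scalemxAr topcZ /flow scalerA addrC; congr (_ + _).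
rewrite -scaleNr; congr (_ *: _); rewrite expr2 invfM.
by move: (topc _) (flow_top x)^-1 => c y; ring.
Qed.

Lemma is_mxcder_field x : flow_top x != 0 -> U (flow x) ->
  is_mxcder (fun x => Y (flow x)) x (mxder (rderiv (affine_field G (flow x))) Y (flow x)).
Proof.
move=> t0 Ux i j; rewrite mxE.
have dP := is_mxcder_flow t0.
exact: (is_cder_comp oU (smooth_C1 (Yh i j).1) Ux (fun k => dP k 0)).
Qed.

Lemma field_commute p : U p ->
  mxder (rderiv (affine_field G p)) Y p = mxder (rderiv (Y p)) (affine_field G) p.
Proof.
move=> Up; have := Y_comm Up.
rewrite (bracketE oU Yh (hol_affine_field oU G) Up) => /eqP.
by rewrite subr_eq0 => /eqP.
Qed.

(** The vector Y at the moving point, lifted at the representative [flow_hom x] instead of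
    [hom (flow x)]; the two differ by the factor [flow_top x]. *)
Definition hom_field x : 'cV[C]_N := flow_top x *: lift (Y (flow x)).

Lemma is_mxcder_hom_field x : flow_top x != 0 -> U (flow x) ->
  is_mxcder hom_field x
    (G *m hom_field x - topc (G *m lift (Y (flow x))) *: flow_hom x).
Proof.
move=> t0 Ux.
have d1 := is_mxcder_mull (col_mx 0 1%:M : 'M[C]_(N, n + 1)) (is_mxcder_field t0 Ux).
have := is_mxcderZ (is_cder_flow_top x) d1.
rewrite -lift_mulmx -lift_mulmx => h.
have -> : hom_field = fun s => flow_top s *: (col_mx 0 1%:M *m Y (flow s)).
  by apply/funext => s; rewrite -lift_mulmx.
move: h; congr is_mxcder; rewrite -lift_mulmx.
rewrite (field_commute Ux) (lift_mxder_affine_field oU G (Y (flow x)) Ux).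
rewrite /hom_field -(hom_flow t0) -!scalemxAr topcZ.
move: (flow_top x) (hom _) (lift _) (topc (G *m hom _)) (G *m lift _) => t h l s g.
move: (topc g) => c; rewrite !scalerBr !scalerA.
by apply/matrixP => i j; rewrite !mxE; ring.
Qed.

(* As Y commutes with the flow, exp (- x G) transports the lift of Y along the flow
   to a curve with derivative a multiple of hom p0. *)
Lemma flow_lift x :
  (forall t, `|t| <= `|x| -> flow_top t != 0 /\ U (flow t)) ->
  exists s : C, hom_field x = mexp G x *m lift (Y p0) + s *: flow_hom x.
Proof.
move=> ok; pose L t := mexp G (- t) *m hom_field t.
have dL t : `|t| <= `|x| -> is_mxcder L t
    (- topc (G *m lift (Y (flow t))) *: hom p0).
  move=> /ok[t0 Ut]; have := is_mxcderM (is_mxcder_mexpN G t) (is_mxcder_hom_field t0 Ut).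
  congr is_mxcder; rewrite mulmxBr mulmxA -(mexp_comm G (- t)) mulNmx.
  by rewrite addrA addNr add0r -scalemxAr mulmxA mexpNK mul1mx scaleNr.
(* Subtracting the psi-component times [hom p0] cancels the derivative of [L], which is a multiple
   of [hom p0]; so [T] is constant. *)
pose T t := L t - topc (L t) *: hom p0.
have dT t : `|t| <= `|x| -> is_mxcder T t 0.
  move=> tx; have d := dL t tx.
  have := is_mxcderB d (is_mxcderZ (is_cder_topc d) (is_mxcder_cst (hom p0) t)).
  congr is_mxcder; rewrite topcZ topc_hom mulr1 scaler0 addr0 subrr.
  by [].
have := is_mxcder0_cst dT; rewrite {2}/T /L /hom_field oppr0 mexp0 mul1mx.
rewrite flow_top0 flow0 scale1r [topc (lift _)]/topc col_mxKu mxE scale0r subr0.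
move=> /eqP; rewrite /T subr_eq => /eqP E; exists (topc (L x)).
have : mexp G x *m L x = hom_field x.
  by rewrite /L mulmxA -{1}[x]opprK mexpNK mul1mx.
by move=> h; apply: etrans (esym h) _; rewrite {1}E mulmxDr -scalemxAr.
Qed.

End Flow.

Lemma cvg_mulmx_entries (R : realType) (T : Type) (Phi : set_system T) (FF : Filter Phi)
    p q s (M : T -> 'M[R[i]]_(p, q)) (N : T -> 'M[R[i]]_(q, s))
    (A : 'M[R[i]]_(p, q)) (B : 'M[R[i]]_(q, s)) (i : 'I_p) (j : 'I_s) :
  (forall k, M t i k @[t --> Phi] --> A i k) ->
  (forall k, N t k j @[t --> Phi] --> B k j) ->
  (M t *m N t) i j @[t --> Phi] --> (A *m B) i j.
Proof.
move=> MA NB; rewrite mxE; under eq_fun do rewrite mxE.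
by apply: cvg_sumC => k; apply: cvgM; [exact: MA|exact: NB].
Qed.

(** Joint continuity in time and starting point at (0, 0) gives one lifetime for all starting points
    near 0. *)
Lemma flow_near (R : realType) n (G : 'M[R[i]]_(1 + (n + 1)))
    (U : set 'cV[R[i]]_(n + 1)) : open U -> U 0 ->
  exists2 d : R, 0 < d & \forall p \near (0 : 'cV[R[i]]_(n + 1)),
    forall t, `|t| < d -> flow_top G p t != 0 /\ U (flow G p t).
Proof.
move=> oU U0; pose V := 'cV[R[i]]_(n + 1).
pose Phi := filter_prod (nbhs (0 : R)) (nbhs (0 : V)).
have FPhi : Filter Phi by exact: filter_prod_filter.
have cq i : flow_hom G tp.2 tp.1 i 0 @[tp --> Phi] --> hom (0 : V) i 0.
  rewrite -[hom 0]mul1mx -(mexp0 G); apply: cvg_mulmx_entries => k.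
    apply: (cvg_comp fst (fun t => mexp G t i k)); first exact: cvg_fst.
    exact: (is_cder_continuous (is_cder_mexp G 0 i k)).
  apply: (cvg_comp snd (fun p : V => hom p k 0)); first exact: cvg_snd.
  have hs := (hol_hom (R := R) (n := n) openT k 0).1.
  exact: (smooth_continuous (z := 0) hs I).
have clow i : (lowmx R n *m flow_hom G tp.2 tp.1) i 0 @[tp --> Phi] --> (0 : R[i]).
  rewrite (_ : 0 = (lowmx R n *m hom 0) i 0); last first.
    by rewrite lowmxE /hom col_mxKd mxE.
  apply: cvg_mulmx_entries => k; first exact: cvg_cst.
  exact: cq.
have ctop : flow_top G tp.2 tp.1 @[tp --> Phi] --> (1 : R[i]).
  rewrite /flow_top -(topc_hom (0 : V)) -upmxE.
  under eq_fun do rewrite -upmxE.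
  by apply: cvg_mulmx_entries => k; [exact: cvg_cst|exact: cq].
have n1 : (1 : R[i]) != 0 by exact: oner_neq0.
have cflow : flow G tp.2 tp.1 @[tp --> Phi] --> (0 : V).
  apply: (cvg_mx_entries (F := Phi)) => i j; rewrite ord1 mxE.
  under eq_fun do rewrite mxE.
  rewrite (_ : 0 = 1^-1 * 0 :> R[i]); last by rewrite mulr0.
  by apply: cvgM; [exact: cvgV|exact: clow].
have nU : nbhs (0 : V) U by exact: open_nbhs_nbhs.
have h1 : Phi [set tp | U (flow G tp.2 tp.1)] by exact: (cflow _ nU).
have h2 : Phi [set tp | flow_top G tp.2 tp.1 != 0] by exact: (cvgr_neq0 (1 : R[i]) ctop n1).
have [[A B] /= [nA nB] AB] := filterI h2 h1.
have /nbhs_ballP[_ /posnumP[d] dA] := nA.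
exists d%:num => //; apply: filterS nB => p Bp t td.
have At : A t by apply: dA; rewrite -ball_normE /ball_ /= sub0r normrN.
by have [] := AB (t, p) (conj At Bp).
Qed.

(** * Projection of a CR field to the leaf space *)

Section LeafProjection.
Variables (R : realType) (n : nat).
Local Notation C := R[i].
Local Notation V := 'cV[C]_n.
Local Notation V' := 'cV[C]_(n + 1).
Variables (a : 'cV[R]_n) (X : 'M[R]_n) (r : R) (F : V -> R).
Hypothesis X_diag : is_diag_mx X.
Local Notation J := (Jmx R n).
Local Notation A := (Amx a X r).
Local Notation FC := (fun z : V => (F z)%:C).
Local Notation gen := (gen a X r).
Local Notation expF := (expF a X r F).
Local Notation uF := (uF a X r F).
Local Notation zeta := (@zeta R n).
Local Notation eta := (@eta R n).
Local Notation incl := (incl R n).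
Local Notation reeb := (reeb a X r).
Variable Y : V' -> V'.

Definition leaf_incl : 'M[C]_(n + 1, n) := col_mx 1%:M 0.
(** Along w = 0 the Reeb field has w-component 1, so the w-component of Y is its Reeb coefficient in
    the decomposition of [descends_to]. *)
Definition leaf_coef (z : V) : C := wpart (Y (col_mx z 0)).
Definition leaf_proj (z : V) : V :=
  zpart (Y (col_mx z 0)) - leaf_coef z *: zpart (reeb (col_mx z 0)).

Lemma leaf_inclE (z : V) : leaf_incl *m z = col_mx z 0.
Proof. by rewrite mul_col_mx mul1mx mul0mx. Qed.

Lemma leaf_projE (z : V) :
  Y (col_mx z 0) = col_mx (leaf_proj z) 0 + leaf_coef z *: reeb (col_mx z 0).
Proof.
rewrite /leaf_proj /leaf_coef /zpart /wpart reeb_leaf.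
rewrite !col_mxKu scale_col_mx add_col_mx add0r subrK.
rewrite -{1}[Y _]vsubmxK; congr col_mx.
by rewrite scale_scalar_mx mulr1; exact: mx11_scalarE.
Qed.

Lemma hol_leaf_coef (U : set V') : open U -> hol_mx U Y ->
  hol (lin_preimage leaf_incl U) leaf_coef.
Proof.
move=> oU Yh; have Ph := hol_mx_lin leaf_incl oU Yh.
have h := Ph (rshift n 0) 0.
have E : eq_on (lin_preimage leaf_incl U)
    (fun z => Y (leaf_incl *m z) (rshift n 0) 0) leaf_coef.
  by move=> z _; rewrite leaf_inclE /leaf_coef /wpart mxE.
exact: (hol_eq (open_lin_preimage (L := leaf_incl) oU) E h).
Qed.

Lemma hol_leaf_proj (U : set V') : open U -> hol_mx U Y ->
  hol_mx (lin_preimage leaf_incl U) leaf_proj.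
Proof.
move=> oU Yh i j; have oP := open_lin_preimage (L := leaf_incl) oU.
have Ph := hol_mx_lin leaf_incl oU Yh.
have Rh := hol_mx_lin leaf_incl oU (hol_affine_field oU A).
have h := holB oP (Ph (lshift 1 i) j)
  (holM oP (hol_leaf_coef oU Yh) (Rh (lshift 1 i) j)).
have E : eq_on (lin_preimage leaf_incl U) (fun z => Y (leaf_incl *m z) (lshift 1 i) j
    - leaf_coef z * affine_field A (leaf_incl *m z) (lshift 1 i) j)
    (fun z => leaf_proj z i j).
  by move=> z _; rewrite leaf_inclE /leaf_proj !mxE.
exact: (hol_eq oP E h).
Qed.

Variables (U : set V) (UY : set V').
Hypotheses (oU : open U) (U0 : U 0).
Hypothesis Fs : smooth_on U FC.
Hypothesis F_eq : forall z, U z -> eta z *m expF z *m zeta z = 0.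
Hypothesis F0 : F 0 = 0.
Hypotheses (oUY : open UY) (UY0 : UY 0) (Yh : hol_mx UY Y).
Hypothesis Y_tangent : forall p, UY p -> sphere_fun p = 0 ->
  rderiv (Y p) (@sphere_fun R n) p = 0.
Hypothesis Y_comm : forall p, UY p -> bracket Y reeb p = 0.

(** The bracket of holomorphic fields is complex bilinear, so commutation passes from the Reeb field
    to its multiple by 2 'i, whose flow in real time leads from (z, 0) to the sphere. *)
Lemma bracket_gen (p : V') : UY p -> bracket Y (affine_field gen) p = 0.
Proof.
move=> Up; have hA := hol_affine_field oUY A.
rewrite (bracketE oUY Yh (hol_affine_field oUY gen) Up) affine_fieldZ.
rewrite (mxder_rderivZ _ _ oUY Yh Up).
have := Y_comm Up; rewrite (bracketE oUY Yh hA Up) => /eqP; rewrite subr_eq0 => /eqP <-.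
have dr := derivation_rderiv oUY (Y p).
have E y : UY y -> affine_field gen y = (2 * 'i) *: affine_field A y.
  by move=> _; exact: affine_fieldZ.
apply/eqP; rewrite subr_eq0; apply/eqP.
apply: etrans (mxder_eq dr (hol_mx_smooth (hol_affine_field oUY gen)) E Up) _.
apply: etrans (mxderZ dr (smooth_cst oUY (2 * 'i)) (hol_mx_smooth hA) Up) _.
by rewrite (der_cst dr _ Up) scale0r add0r.
Qed.

Lemma tangent_scaled (h l : 'cV[C]_(1 + (n + 1))) (s : C) :
  (adjmx l *m J *m h + adjmx h *m J *m l) 0 0 = 0 ->
  adjmx (s *: l) *m J *m (s *: h) + adjmx (s *: h) *m J *m (s *: l) = 0.
Proof.
move=> hl; rewrite !adjmxZ -!scalemxAl -!scalemxAr !scalerA -scalerDr.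
by rewrite (mx11_scalarE (_ + _)) hl raddf0 scaler0.
Qed.

Lemma tangent_shift (w q : 'cV[C]_(1 + (n + 1))) (s : C) : adjmx q *m J *m q = 0 ->
  adjmx (w + s *: q) *m J *m q + adjmx q *m J *m (w + s *: q) =
  adjmx w *m J *m q + adjmx q *m J *m w.
Proof.
move=> qq; rewrite mulmxDr adjmxD adjmxZ !mulmxDl -!scalemxAl -scalemxAr.
by rewrite qq !scaler0 !addr0.
Qed.

Lemma sandwich_shiftr (P : 'rV[C]_(1 + (n + 1))) (i w q : 'cV[C]_(1 + (n + 1))) (c s : C) :
  P *m q = 0 -> P *m (i + c *: (w - s *: q)) = P *m i + c *: (P *m w).
Proof.
by move=> Pq; rewrite mulmxDr -scalemxAr mulmxBr -scalemxAr Pq scaler0 subr0.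
Qed.

Lemma sandwich_shiftl (Q : 'cV[C]_(1 + (n + 1))) (i w q : 'cV[C]_(1 + (n + 1))) (c s : C) :
  adjmx q *m Q = 0 ->
  adjmx (i + c *: (w - s *: q)) *m Q = adjmx i *m Q + c^* *: (adjmx w *m Q).
Proof.
move=> qQ; rewrite adjmxD adjmxZ adjmxD adjmxN adjmxZ !mulmxDl -scalemxAl.
by rewrite mulmxDl mulNmx -scalemxAl qQ scaler0 subr0.
Qed.

(* At time F z / 2 the flow of 2i times the Reeb field meets the sphere. *)
Lemma flow_tangent (z : V) (x : R) : U z -> x + x = F z ->
  (forall t, `|t| <= `|x| ->
    flow_top gen (col_mx z 0) t != 0 /\ UY (flow gen (col_mx z 0) t)) ->
  adjmx (lift (Y (col_mx z 0))) *m J *m expF z *m zeta z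
  + eta z *m expF z *m lift (Y (col_mx z 0)) = 0.
Proof.
move=> Uz xx ok; have [t0 Up] := ok x (lexx _).
have [s hs] := flow_lift oUY Yh bracket_gen ok.
set q := flow_hom gen (col_mx z 0) x in hs; set l0 := lift (Y _) in hs *.
set p := flow gen _ x in Up; set psi := flow_top _ _ x in t0.
have hq : psi *: hom p = q by exact: hom_flow.
have EJ : adjmx (mexp gen x) *m J = J *m mexp gen x.
  by rewrite (adjmx_mexp x (adjmx_gen_J a r X_diag)).
(* As [gen] is self-adjoint for J, the exponentials from the two arguments of the form combine to
   exp (2 x gen); this is why the time is half of F z. *)
have EE : mexp gen x *m mexp gen x = expF z by rewrite -mexpD xx.
have qE : q = mexp gen x *m zeta z by [].
have JE (l : 'cV[C]_(1 + (n + 1))) : adjmx (mexp gen x *m l) *m J *m q =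
    adjmx l *m J *m expF z *m zeta z.
  by rewrite qE adjmxM -!mulmxA (mulmxA (adjmx (mexp gen x))) EJ -EE !mulmxA.
have EJ' (l : 'cV[C]_(1 + (n + 1))) : adjmx q *m J *m (mexp gen x *m l) =
    eta z *m expF z *m l.
  by rewrite qE adjmxM -!mulmxA (mulmxA (adjmx (mexp gen x))) EJ -EE /eta !mulmxA.
have qq : adjmx q *m J *m q = 0 by rewrite {2}qE EJ' F_eq.
have p_sphere : sphere_fun p = 0.
  rewrite sphere_funE; have := qq; rewrite -hq adjmxZ -!scalemxAl -scalemxAr scalerA.
  move=> /eqP; rewrite scaler_eq0 mulf_eq0 conjC_eq0 !(negPf t0) /= => /eqP ->.
  by rewrite mxE oppr0.
have := Y_tangent Up p_sphere; rewrite (rderiv_sphere_fun oUY _ Up) => /eqP.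
rewrite oppr_eq0 => /eqP /(tangent_scaled psi); rewrite hq.
have -> : psi *: lift (Y p) = mexp gen x *m l0 + s *: q by exact: hs.
move=> h; apply: etrans (esym (congr2 +%R (JE l0) (EJ' l0))) _.
exact: etrans (esym (tangent_shift _ s qq)) h.
Qed.

(** The tangency condition, transported back to (z, 0), is compared with the identity satisfied by v
    F. The Reeb component contributes its coefficient minus the conjugate, because A is skew for J
    and commutes with E. *)
Lemma CR_lieF : \forall z \near (0 : V),
  U z /\ lieF F leaf_proj z * (2 * 'i) = leaf_coef z - (leaf_coef z)^*.
Proof.
have [d d0 nd] := flow_near gen oUY UY0.
have nd' := near0_lin leaf_incl nd.
have Unear : \forall z \near (0 : V), U z by exact: open_nbhs_nbhs.
have u0 := near_uF_neq0 a X r oU U0 Fs F0.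
have Fc : \forall z \near (0 : V), `|F z / 2| < d.
  have Fc0 := (continuous_ReIm _ _).1 (smooth_continuous Fs U0).
  have d20 : 0 < d * 2 by rewrite mulr_gt0.
  have /cvgrPdist_lt/(_ _ d20) := Fc0.1; rewrite /= F0.
  apply: filterS => z; rewrite sub0r normrN => h.
  by rewrite normrM [`|2^-1|]gtr0_norm// ltr_pdivrMr.
apply: filterS (filterI (filterI Unear u0) (filterI Fc nd')) => z [[Uz uz] [Fz]].
rewrite leaf_inclE => ok; split=> //.
have xx : F z / 2 + F z / 2 = F z by rewrite -splitr.
have := flow_tangent Uz xx (fun t tx => ok t (le_lt_trans tx Fz)).
have := lieF_identity oU Fs F_eq leaf_proj Uz.
rewrite leaf_projE liftD liftZ lift_affine_field -/(zeta z) -inclE.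
set nu := topc _; set c := leaf_coef z.
pose y := (eta z *m (A *m expF z) *m zeta z) 0 0.
have EA : expF z *m A = A *m expF z.
  have h : A *m gen = gen *m A by rewrite /gen -scalemxAr -scalemxAl.
  exact: esym (mexp_commute (F z) h).
have uE : uF z = 2 * 'i * y.
  by rewrite /uF /gen /y -scalemxAr -!scalemxAl mxE -!mulmxA.
have y0 : y != 0.
  by move: uz; rewrite uE; apply: contraNneq => ->; rewrite mulr0.
have hz := F_eq Uz.
have mA (P : 'rV[C]_(1 + (n + 1))) (G1 G2 : 'M[C]_(1 + (n + 1))) (Q : 'cV[C]_(1 + (n + 1))) :
    P *m G1 *m G2 *m Q = P *m (G1 *m G2 *m Q) by rewrite !mulmxA.
have hz' : adjmx (zeta z) *m (J *m expF z *m zeta z) = 0.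
  exact: etrans (esym (mA _ _ _ _)) hz.
have k1 := adj_linear_J z (expF z) (adjmx_A_J a r X_diag).
have k2 : eta z *m expF z *m (A *m zeta z) = eta z *m (A *m expF z) *m zeta z.
  by rewrite -EA !mulmxA.
have e2 := etrans (sandwich_shiftr (incl *m leaf_proj z) (A *m zeta z) c nu hz)
  (congr1 (fun M => _ + c *: M) k2).
have e1 := etrans (mA _ J (expF z) (zeta z))
  (sandwich_shiftl (incl *m leaf_proj z) (A *m zeta z) c nu hz').
have k1' := etrans (esym (mA _ J (expF z) (zeta z))) k1.
move=> h1 h2.
have := congr1 (fun M : 'M[C]_1 => M 0 0)
  (etrans (esym (congr2 +%R (etrans e1 (congr2 (fun M N => M + c^* *: N)
    (esym (mA _ J (expF z) (zeta z))) k1')) e2)) h2).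
move: h1; rewrite uE -/y; clear -y0.
have D (P Q : 'M[C]_1) : (P + Q) 0 0 = P 0 0 + Q 0 0 by rewrite mxE.
have Z (s : C) (P : 'M[C]_1) : (s *: P) 0 0 = s * P 0 0 by rewrite mxE.
have Nn (P : 'M[C]_1) : (- P) 0 0 = - P 0 0 by rewrite mxE.
have O : (0 : 'M[C]_1) 0 0 = 0 by rewrite mxE.
move: (adjmx (incl *m leaf_proj z) *m J *m expF z *m zeta z)
  (eta z *m expF z *m (incl *m leaf_proj z)) @y y0.
move: (eta z *m (A *m expF z) *m zeta z) (lieF F leaf_proj z) => Q S P P' y y0 h1.
rewrite !(D, Z, Nn) O -/y => h2.
apply: (mulIf y0).
have -> : S * (2 * 'i) * y = (S * (2 * 'i * y) + (P 0 0 + P' 0 0)) -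
  (P 0 0 + P' 0 0) by ring.
rewrite h1 sub0r.
have -> : P 0 0 + P' 0 0 = (P 0 0 + c^* * - y + (P' 0 0 + c * y)) - (c - c^*) * y by ring.
by rewrite h2 sub0r opprK.
Qed.

End LeafProjection.

Lemma flat_sub (R : realType) m (Z Z' : set 'cV[R[i]]_m) k f :
  Z' `<=` Z -> flat Z k f -> flat Z' k f.
Proof.
move=> ZZ; elim: k f => [|k IH] f [f0 fj]; split=> //; do ?by move=> z /ZZ; exact: f0.
by move=> j; exact: IH (fj j).
Qed.

(** Being equal to its conjugate, f is antiholomorphic as well, so every dz_j f vanishes and f has
    the jets of a constant. *)
Lemma hol_real_cst (R : realType) m (U : set 'cV[R[i]]_m) f : open U -> U 0 ->
  hol U f -> (forall z, U z -> (f z)^* = f z) ->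
  \forall z \near (0 : 'cV[R[i]]_m), f z = f 0.
Proof.
move=> oU U0 fh fJ; have [fs fb] := fh.
have dz0 j : eq_on U (dz j f) (fun=> 0).
  move=> z Uz; have E : eq_on U (fun z => (f z)^*) f by move=> y; exact: fJ.
  rewrite -(der_eq (derivation_dz oU j) (smoothJ oU fs) E Uz) (dzJ j fs Uz).
  by rewrite (fb j z Uz) conjC0.
apply: (sc_hol_eq oU U0 fh (hol_cst oU _)) => k.
exact: (sc_cst oU U0 k fs dz0).
Qed.

Lemma bracket_sub_reeb (R : realType) m (U : set 'cV[R[i]]_m) Y Z W (c : R[i]) p :
  open U -> hol_mx U Y -> hol_mx U Z -> hol_mx U W -> U p ->
  bracket (fun q => Y q - (Z q + c *: W q)) W p = bracket Y W p - bracket Z W p.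
Proof.
move=> oU Yh Zh Wh Up; apply/matrixP => j i; rewrite !mxE -sumrB.
apply: eq_bigr => k _; have dk := derivation_dz oU k.
have E : eq_on U (fun x => (Y x - (Z x + c *: W x)) j 0)
    (fun x => Y x j 0 - (Z x j 0 + c * W x j 0)) by move=> x _; rewrite !mxE.
have [Ys _] := Yh j 0; have [Zs _] := Zh j 0; have [Ws _] := Wh j 0.
have cs := smoothM oU (smooth_cst oU c) Ws; have s1 := smoothD oU Zs cs.
have s := smoothB oU Ys s1.
have -> : dz k (fun x => (Y x - (Z x + c *: W x)) j 0) p =
    dz k (fun x => Y x j 0) p
    - (dz k (fun x => Z x j 0) p + c * dz k (fun x => W x j 0) p).
  have E' : eq_on U (fun x => Y x j 0 - (Z x j 0 + c * W x j 0))
    (fun x => (Y x - (Z x + c *: W x)) j 0) by move=> x Ux; rewrite -(E x Ux).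
  apply: etrans (esym (der_eq dk s E' Up)) _.
  apply: etrans (derB oU dk Ys s1 Up) _; congr (_ - _).
  apply: etrans (derD dk Zs cs Up) _; congr (_ + _).
  exact: (derZ oU dk c Ws Up).
rewrite !mxE; move: (dz k _ p) (dz k _ p) (dz k _ p) => x y z.
by move: (Y p k 0) (Z p k 0) (W p k 0) => *; ring.
Qed.

(** * Fields that commute with the Reeb field and vanish on w = 0 *)

Section FlatAlongLeafSpace.
Variables (R : realType) (n : nat).
Local Notation C := R[i].
Local Notation V := 'cV[C]_(n + 1).
Variable U : set V.
Hypotheses (oU : open U) (U0 : U 0).

Definition zero_wpart : set V := [set p | U p /\ wpart p = 0].

Let ZU : zero_wpart `<=` U. Proof. by move=> p []. Qed.

Lemma rderiv_tangent_eq0 f e p : (forall q, zero_wpart q -> f q = 0) ->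
  wpart e = 0 -> zero_wpart p -> rderiv e f p = 0.
Proof.
move=> f0 e0 [Up p0]; apply: is_cder_rderiv.
apply: (near_eq_is_cder (f := fun=> 0)); last exact: is_cder_cst.
apply: filterS (near_line oU e Up) => t Ut; rewrite f0//; split=> //.
by rewrite /wpart linearD linearZ /= !mxE -/(wpart _) in p0 e0 *; rewrite p0 e0 mulr0 addr0.
Qed.

(** The z-directions are tangent to w = 0, so differentiating along them costs no order of flatness;
    only the w-derivative has to be recovered from the bracket. *)
Lemma flat_dz_tangent k j f : smooth_on U f -> flat zero_wpart k f ->
  flat zero_wpart k (dz (lshift 1 j) f).
Proof.
have w0 (c : C) : wpart (c *: delta_mx (lshift 1 j) 0 : V) = 0.
  by rewrite /wpart !mxE eq_sym eq_lrshift mulr0.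
have v0 g : (forall q, zero_wpart q -> g q = 0) ->
    forall q, zero_wpart q -> dz (lshift 1 j) g q = 0.
  move=> g0 q Zq; rewrite /dz -[delta_mx _ _ in X in X - _]scale1r.
  by rewrite !(rderiv_tangent_eq0 g0 (w0 _) Zq) mulr0 subrr mul0r.
elim: k f => [|k IH] f fs [f0 fj]; first by split=> //; exact: v0.
split; first exact: v0.
move=> l; have dl := derivation_dz oU l.
apply: (flat_eq oU ZU _ _ (IH _ (der_smooth dl fs) (fj l))).
  exact: (der_smooth (derivation_dz oU _) (der_smooth dl fs)).
by move=> p Up; exact: (commuting_dz oU (lshift 1 j) l fs Up).
Qed.

Variables (a : 'cV[R]_n) (X : 'M[R]_n) (r : R).
Local Notation reeb := (reeb a X r).
Variable D : V -> V.
Hypothesis Dh : hol_mx U D.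
Hypothesis D_comm : forall p, U p -> bracket D reeb p = 0.
Hypothesis D0 : forall p, zero_wpart p -> D p = 0.

(* The Reeb field is transversal to w = 0, so the vanishing of the bracket
   expresses the w-derivative of D through D and its tangential derivatives. *)
Lemma flat_commuting_reeb k j : flat zero_wpart k (fun p => D p j 0).
Proof.
have Rh := hol_affine_field oU (Amx a X r).
have v0 i p : zero_wpart p -> D p i 0 = 0 by move=> Zp; rewrite (D0 Zp) mxE.
elim: k j => [|k IH] j; first by split=> // p; exact: v0.
split=> [p|l]; first exact: v0.
have sD i : smooth_on U (fun p => D p i 0) by have [] := Dh i 0.
have sR i : smooth_on U (fun p => reeb p i 0) by have [] := Rh i 0.
have sdz i f (fs : smooth_on U f) := der_smooth (derivation_dz oU i) fs.
case: (split_ordP l) => i ->; first exact: (flat_dz_tangent i (sD j) (IH j)).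
rewrite ord1.
pose w : 'I_(n + 1) := rshift n 0.
apply: (flat_cancel oU ZU (sdz w _ (sD j)) (sR w)).
  move=> p [_ p0].
  have -> : p = col_mx (zpart p) 0.
    rewrite -{1}[p]vsubmxK; congr col_mx.
    by rewrite (mx11_scalarE (dsubmx p)) -/(wpart p) p0 raddf0.
  by rewrite reeb_leaf col_mxEd mxE eqxx oner_neq0.
have s1 := smooth_sum oU (index_enum 'I_(n + 1)) xpredT
  (fun i => smoothM oU (sD i) (sdz i _ (sR j))).
have s2 := smooth_sum oU (index_enum 'I_n) xpredT
  (fun i => smoothM oU (sR (lshift 1 i)) (sdz (lshift 1 i) _ (sD j))).
apply: (flat_eq oU ZU (smoothB oU s1 s2)).
  move=> p Up; have h0 : \sum_i (D p i 0 * dz i (fun q => reeb q j 0) p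
      - reeb p i 0 * dz i (fun q => D q j 0) p) = 0.
    by have /matrixP/(_ j 0) := D_comm Up; rewrite mxE [RHS]mxE.
  move/eqP: h0; rewrite sumrB [X in _ - X == _]big_split_ord /= big_ord1.
  by rewrite opprD addrA subr_eq0 => /eqP h; apply: etrans h (mulrC _ _).
apply: (flatB oU ZU s1 s2).
  apply: (flat_sum oU ZU) => [q|q _]; first exact: (smoothM oU (sD q) (sdz q _ (sR j))).
  exact: (flatM oU ZU (sD q) (sdz q _ (sR j)) (IH q)).
apply: (flat_sum oU ZU) => [q|q _].
  exact: (smoothM oU (sR (lshift 1 q)) (sdz (lshift 1 q) _ (sD j))).
exact: (flatMl oU ZU (sdz (lshift 1 q) _ (sD j)) (sR _) (flat_dz_tangent q (sD j) (IH j))).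
Qed.

(** Flatness along w = 0 restricts to flatness at the origin, where the identity principle
    applies. *)
Lemma commuting_reeb_eq0 : \forall p \near (0 : V), D p = 0.
Proof.
have Z0 : [set (0 : V)] `<=` zero_wpart.
  by move=> p ->; split=> //; rewrite /wpart !mxE.
have h i : \forall p \near (0 : V), D p i 0 = 0.
  apply: (hol_flat_eq0 oU U0 (Dh i 0)) => k.
  exact: (flat_sub Z0 (flat_commuting_reeb k i)).
have hall : \forall p \near (0 : V), forall i, D p i 0 = 0.
  exact: (@filter_forall V 'I_(n + 1) _ (nbhs (0 : V)) _ h).
by apply: filterS hall => p E; apply/matrixP => i j; rewrite ord1 mxE; exact: E.
Qed.

End FlatAlongLeafSpace.

Lemma conj_inv2i (K : numClosedFieldType) : ((2 * 'i)^-1 : K)^* = - (2 * 'i)^-1.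
Proof.
apply: etrans (fmorphV _ _) _.
by rewrite -[X in _ = - X^-1]oppr_conj2i invrN opprK.
Qed.

(** * Classification of the CR fields that commute with the Reeb field *)

Section CRClassification.
Variables (R : realType) (n : nat).
Local Notation C := R[i].
Local Notation V := 'cV[C]_n.
Local Notation V' := 'cV[C]_(n + 1).
Variables (a : 'cV[R]_n) (X : 'M[R]_n) (r : R) (F : V -> R).
Hypothesis X_diag : is_diag_mx X.
Local Notation reeb := (reeb a X r).
Local Notation A := (Amx a X r).
Implicit Types (H : 'M[C]_n) (b : V).

(** Along w = 0 a multiple of the Reeb field changes only the Reeb coefficient, so both sides have
    the same projection to the leaf space. *)
Lemma aut_field_reeb_inj H b H' b' (c c' : C) :
  (\forall p \near (0 : V'),
    aut_field a X H b p + c *: reeb p = aut_field a X H' b' p + c' *: reeb p) ->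
  H = H' /\ b = b'.
Proof.
move=> /(near0_lin (leaf_incl R n)) E; apply: (@leaf_field_inj R n a X).
apply: filterS E => z; rewrite leaf_inclE.
rewrite !(leaf_fieldP a r X_diag) -!addrA -!scalerDl.
by case/leaf_decomposition_unique.
Qed.

Variable Y : V' -> V'.
Hypotheses (Y_CR : inf_CR_automorphism Y) (Y_comm : commute0 Y reeb).

Lemma CR_leaf_field U : potential_on a X r F U ->
  exists H b (s : R), admissible a X r (H, b) /\
    \forall z \near (0 : V),
      Y (col_mx z 0) = aut_field a X H b (col_mx z 0) + s%:C *: reeb (col_mx z 0).
Proof.
move=> PU; have [Y_hol Y_tan] := Y_CR.
have [U1 [oU1 U10 Yh1]] := holomorphic0_hol_mx Y_hol.
have U1near : \forall p \near (0 : V'), U1 p by exact: open_nbhs_nbhs.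
have [UY [oUY UY0 UYP]] := near0_open (filterI U1near (filterI Y_tan Y_comm)).
have Yh : hol_mx UY Y by apply: (hol_mxW _ Yh1) => p /UYP[].
have tan p : UY p -> sphere_fun p = 0 -> rderiv (Y p) (@sphere_fun R n) p = 0.
  by move=> /UYP[_ []].
have comm p : UY p -> bracket Y reeb p = 0 by move=> /UYP[_ []].
have [oU U0 Fs Fe F0] := PU.
have nL := CR_lieF X_diag oU U0 Fs Fe F0 oUY UY0 Yh tan comm.
have UYnear : \forall p \near (0 : V'), UY p by exact: open_nbhs_nbhs.
have [U2 [PU2 _ U2P]] := potential_onW PU
  (filterI nL (near0_lin (leaf_incl R n) UYnear)).
set v := leaf_proj a X r Y in nL U2P.
pose c := leaf_coef Y.
have U2pre : U2 `<=` lin_preimage (leaf_incl R n) UY by move=> z /U2P[].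
have vh : hol_mx U2 v := hol_mxW U2pre (hol_leaf_proj a X r oUY Yh).
have ch : hol U2 c := holW U2pre (hol_leaf_coef oUY Yh).
have [oU2 U20 Fs2 _ _] := PU2.
have i2n0 : (2 * 'i : C) != 0 by rewrite mulf_neq0 ?pnatr_eq0 ?neq0Ci.
(* With this holomorphic f, v F is f plus its conjugate, which exhibits v F as pluriharmonic. *)
pose f (z : V) := (2 * 'i)^-1 * c z.
have fh : hol U2 f := holM oU2 (hol_cst oU2 _) ch.
have lieE z : U2 z -> lieF F v z = f z + (f z)^*.
  move=> /U2P[[_ h] _]; apply: (mulIf i2n0); rewrite h /f -/c.
  rewrite conjM conj_inv2i; have := mulVf i2n0.
  move: (2 * 'i) (2 * 'i)^-1 (c z) => i y x yi.
  have -> : (y * x + - y * x^*) * i = y * i * (x - x^*) by ring.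
  by rewrite yi mul1r.
have vk j k z : U2 z -> dz j (dzbar k (lieF F v)) z = 0.
  move=> Uz; have dk := derivation_dzbar oU2 k; have dj := derivation_dz oU2 j.
  have sl := smooth_lieF oU2 Fs2 (hol_mx_smooth vh).
  apply: etrans (dz_dzbar_holDJ j k oU2 fh fh Uz).
  apply: (der_eq dj (der_smooth dk sl) _ Uz) => y Uy.
  exact: (der_eq dk sl lieE Uy).
have [[H b] Hb nE] := killing_admissible X_diag PU2 vh vk.
have [U3 [PU3 U32 U3P]] := potential_onW PU2
  (filterI nE (admissible_lieF X_diag PU2 Hb)).
have [oU3 U30 _ _ _] := PU3.
pose s (z : V) := (adjmx b *m z) 0 0.
(* The difference of the Reeb coefficients of Y and of [aut_field]. It is holomorphic and real,
   hence constant near 0, and its value at 0 is the required real multiple of the Reeb field. *)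
pose d (z : V) := c z - 2 * 'i * s z.
have dh : hol U3 d.
  apply: (holB oU3 (holW U32 ch)).
  exact: (holM oU3 (hol_cst oU3 _) (hol_mul_entry oU3 (adjmx b) 0)).
have dJ z : U3 z -> (d z)^* = d z.
  move=> U3z; have U2z := U32 z U3z; have [vE lE] := U3P z U3z.
  have [[_ h] _] := U2P z U2z; move: h.
  have -> : lieF F v z = s z + (s z)^* by rewrite -[RHS]lE /lieF vE.
  rewrite -/c /d !conjE => h.
  have : s z * (2 * 'i) + (s z)^* * (2 * 'i) = c z - (c z)^* by rewrite -mulrDl.
  move=> {}h; have -> : (c z)^* = c z - (s z * (2 * 'i) + (s z)^* * (2 * 'i)).
    by rewrite h subKr.
  by ring.
have nd := hol_real_cst oU3 U30 dh dJ.
have d0 : d 0 = (complex.Re (d 0))%:C.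
  apply: complexP => //=; have := congr1 (@complex.Im R) (dJ 0 U30).
  by rewrite ImJ => /eqP; rewrite eq_sym -addr_eq0 -mulr2n mulrn_eq0 /= => /eqP.
exists H, b, (complex.Re (d 0)); split=> //.
have U3near : \forall z \near (0 : V), U3 z by exact: open_nbhs_nbhs.
apply: filterS (filterI U3near nd) => z [U3z dz0]; have [vE _] := U3P z U3z.
rewrite (leaf_projE a X r Y) -/v -d0 -dz0 /= (leaf_fieldP a r X_diag) -addrA -scalerDl.
by rewrite vE -/c /d /s addrC [2 * 'i * _ + _]addrC subrK addrC.
Qed.

Lemma inf_CR_automorphism_unique U : potential_on a X r F U ->
  exists! Hb : 'M[C]_n * V, admissible a X r Hb /\
    exists c : R, \forall p \near (0 : V'),
      Y p = aut_field a X Hb.1 Hb.2 p + c%:C *: reeb p.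
Proof.
move=> PU; have [H [b [s [Hb nz]]]] := CR_leaf_field PU.
have [Y_hol _] := Y_CR.
have [U1 [oU1 U10 Yh1]] := holomorphic0_hol_mx Y_hol.
have [UZ [oUZ UZ0 UZP]] := near0_open nz.
pose pr : 'M[C]_(n, n + 1) := row_mx 1%:M 0.
have prE p : pr *m p = zpart p.
  by rewrite -{1}[p]vsubmxK mul_row_col mul1mx mul0mx addr0.
have UZnear : \forall z \near (0 : V), UZ z by exact: open_nbhs_nbhs.
have U1near : \forall p \near (0 : V'), U1 p by exact: open_nbhs_nbhs.
have [U2 [oU2 U20 U2P]] := near0_open
  (filterI U1near (filterI Y_comm (near0_lin pr UZnear))).
have Yh : hol_mx U2 Y by apply: (hol_mxW _ Yh1) => p /U2P[].
have Zh : hol_mx U2 (aut_field a X H b).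
  by rewrite aut_fieldE; exact: (hol_affine_field oU2).
have Wh : hol_mx U2 reeb := hol_affine_field oU2 A.
pose D p := Y p - (aut_field a X H b p + s%:C *: reeb p).
have Dh : hol_mx U2 D.
  apply: (hol_mxD oU2 Yh); apply: (hol_mxN oU2); apply: (hol_mxD oU2 Zh).
  exact: (hol_mxZ oU2 (hol_cst oU2 _) Wh).
have D_comm p : U2 p -> bracket D reeb p = 0.
  move=> U2p; apply: etrans (bracket_sub_reeb s%:C oU2 Yh Zh Wh U2p) _.
  have [_ [-> _]] := U2P p U2p.
  rewrite aut_fieldE (bracket_affine_field oU2 U2p (admissible_commute X_diag Hb)).
  by rewrite subrr.
have D0 p : zero_wpart U2 p -> D p = 0.
  move=> [U2p p0]; have [_ [_ /UZP]] := U2P p U2p.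
  have -> : p = col_mx (zpart p) 0.
    rewrite -{1}[p]vsubmxK; congr col_mx.
    by rewrite (mx11_scalarE (dsubmx p)) -/(wpart p) p0 raddf0.
  by rewrite prE /zpart col_mxKu /D => ->; rewrite subrr.
have nD := commuting_reeb_eq0 oU2 U20 Dh D_comm D0.
exists (H, b); split.
  split=> //; exists s; apply: filterS nD => p /eqP.
  by rewrite subr_eq0 => /eqP.
move=> [H' b'] [_ [s' nE]].
have [-> ->] // : H = H' /\ b = b'.
apply: (@aut_field_reeb_inj H b H' b' s%:C s'%:C).
by apply: filterS (filterI nD nE) => p [/eqP]; rewrite subr_eq0 => /eqP <- <-.
Qed.

End CRClassification.

Unset Implicit Arguments.
Set Strict Implicit.

Theorem theorem2 (R : realType) (n : nat) (a : 'cV[R]_n) (X : 'M[R]_n) (r : R)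
    (F : 'cV[R[i]]_n -> R)
    (n_ge2 : (2 <= n)%N)
    (X_diag : is_diag_mx X)
    (X_noninc : forall j k : 'I_n, k = j.+1 :> nat -> X k k <= X j j)
    (a_ge0 : forall j : 'I_n, 0 <= a j 0)
    (a_eq0 : forall j k : 'I_n, k = j.+1 :> nat -> X j j = X k k -> a k 0 = 0)
    (F_potential : potential a X r F) :
  [/\ (forall H b, admissible a X r (H, b) ->
         inf_CR_automorphism (aut_field a X H b) /\
         commute0 (aut_field a X H b) (reeb a X r)),
      (forall Y, inf_CR_automorphism Y -> commute0 Y (reeb a X r) ->
         exists! Hb : 'M[R[i]]_n * 'cV[R[i]]_n,
           admissible a X r Hb /\
           exists c : R, \forall p \near (0 : 'cV[R[i]]_(n + 1)),
             Y p = aut_field a X Hb.1 Hb.2 p + c%:C *: reeb a X r p),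
      (forall H b, admissible a X r (H, b) ->
         exists v, inf_automorphism F v /\
           descends_to a X r (aut_field a X H b) v) &
      (forall v, inf_automorphism F v ->
         exists! Hb : 'M[R[i]]_n * 'cV[R[i]]_n,
           admissible a X r Hb /\
           descends_to a X r (aut_field a X Hb.1 Hb.2) v)].
Proof.
have [U PU] := potential_potential_on F_potential.
split.
- move=> H b Hb; split; first exact: (admissible_inf_CR_automorphism Hb).
  exact: (admissible_commute0 X_diag Hb).
- move=> Y Y_CR Y_comm; exact: (inf_CR_automorphism_unique X_diag Y_CR Y_comm PU).
- move=> H b Hb; exists (leaf_field a X H b); split.
    exact: (admissible_inf_automorphism X_diag PU Hb).
  by apply/(@descends_toP R n a X r X_diag); exact: filterE.
- move=> v v_aut; exact: (inf_automorphism_unique X_diag PU v_aut).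
Qed.
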